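(* Let $T>0$ and let $b:[0,\infty)\times C([0,\infty);\mathbb{R}^d)\to\mathbb{R}^d$ be bounded, $\mathcal{B}([0,\infty))\otimes\mathcal{B}(C)$-measurable and such that $w\mapsto b(t,w)$ is $\mathcal{B}_t(C)$-measurable for each $t>0$. Let $X^x$ be the solution of $X_t^x=x+\int_0^tb(s,X^x)\,\mathrm{d}s+W_t$, $t\in[0,T]$, and let $p_t(x,\cdot)$ be the density of $X_t^x$. Then for every $(t,x,y)\in(0,T]\times\mathbb{R}^d\times\mathbb{R}^d$, $$q_t^{y,-\|b\|_\infty}(x,y)\le p_t(x,y)\le q_t^{y,\|b\|_\infty}(x,y).$$
   Context: $C([0,\infty);\mathbb{R}^d)$ carries the topology of locally uniform convergence with Borel $\sigma$-field $\mathcal{B}(C)$; $\mathcal{B}_t(C)$ is the sub-$\sigma$-field generated by $w\mapsto w(t\wedge\cdot)$. $W$ is a $d$-dimensional standard Brownian motion; solutions are weak solutions (unique in law); $\|b\|_\infty=\sup_{t,w}|b(t,w)|$. The density $p_t(x,\cdot)$ exists and is taken in its continuous version. For $\alpha=(\alpha_1,\dots,\alpha_d)^\top$, $\beta=(\beta_1,\dots,\beta_d)^\top\in\mathbb{R}^d$, the bang–bang diffusion $Y^{x,\alpha,\beta}$ solves $Y_t^{x,\alpha,\beta}=x+\int_0^t\beta\,\mathrm{sgn}(\alpha-Y_s^{x,\alpha,\beta})\,\mathrm{d}s+W_t$, where $\mathrm{sgn}(u)=-1$ for $u\le0$, $\mathrm{sgn}(u)=1$ for $u>0$, and $\beta\,\mathrm{sgn}(x):=(\beta_1\mathrm{sgn}(x_1),\dots,\beta_d\mathrm{sgn}(x_d))^\top$.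 $q_t^{\alpha,\beta}(x,\cdot)$ denotes the density of $Y_t^{x,\alpha,\beta}$; it is known that $$q_t^{\alpha,\beta}(x,\alpha)=\prod_{i=1}^d\frac{2}{\sqrt{2\pi t}}\int_{|x_i-\alpha_i|/\sqrt t}^\infty z_i\exp\Big(-\frac{(z_i-\beta_i\sqrt t)^2}{2}\Big)\,\mathrm{d}z_i.$$ When a scalar $c$ is written in place of $\beta$, as in $q_t^{y,\pm\|b\|_\infty}$, it means $\beta=(c,\dots,c)^\top$. *)

(* Defs.v *)
From HB Require Import structures.
From mathcomp Require Import all_boot all_order all_algebra.
From mathcomp Require Import all_classical all_reals all_analysis.

Set Implicit Arguments.
Unset Strict Implicit.
Unset Printing Implicit Defensive.

Import Order.TTheory GRing.Theory Num.Theory numFieldNormedType.Exports.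

Local Open Scope classical_set_scope.
Local Open Scope ring_scope.

Section borel_rV.
Context (R : realType) (d : nat).

Let borel0 : <<s @open 'rV[R]_d >> set0.
Proof. exact: sigma_algebra0. Qed.

Let borelC A : <<s @open 'rV[R]_d >> A -> <<s @open 'rV[R]_d >> (~` A).
Proof. exact: sigma_algebraC. Qed.

Let borel_bigcup (F : (set 'rV[R]_d)^nat) :
  (forall i, <<s @open 'rV[R]_d >> (F i)) ->
  <<s @open 'rV[R]_d >> (\bigcup_i F i).
Proof. exact: sigma_algebra_bigcup. Qed.

HB.instance Definition _ := @isMeasurable.Build default_measure_display
  'rV[R]_d <<s @open 'rV[R]_d >> borel0 borelC borel_bigcup.

End borel_rV.

Lemma measurable_coord (R : realType) (d : nat) (i : 'I_d) :
  measurable_fun [set: 'rV[R]_d] (fun v => v 0 i).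
Proof.
apply: (measurability _ (measurable_realfun.RGenOInfty.measurableE R)).
move=> _ [_ [a ->] <-]; rewrite setTI; apply: sub_sigma_algebra.
by apply: open_comp; [move=> v _; exact: coord_continuous|exact: interval_open].
Qed.

Lemma nbhs_ratbox (R : realType) (x : R) (A : set R) : nbhs x A ->
  exists q : rat * rat, `]ratr q.1, ratr q.2[%classic x /\
    `](ratr q.1 : R), ratr q.2[%classic `<=` A.
Proof.
move/nbhs_ballP => [e /= e0 eA].
have [q1] : exists q : rat, ratr q \in `]x - e, x[.
  by apply: rat_in_itvoo; rewrite ltrBlDr ltrDl.
have [q2] : exists q : rat, ratr q \in `]x, x + e[.
  by apply: rat_in_itvoo; rewrite ltrDl.
rewrite !in_itv /= => /andP[xq2 q2e] /andP[q1e q1x].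
exists (q1, q2); split=> /= [|y /=]; first by rewrite in_itv /= q1x.
rewrite in_itv /= => /andP[q1y yq2]; apply: eA.
rewrite /ball /= distrC ltr_distl (lt_trans q1e q1y) /=.
exact: lt_trans yq2 q2e.
Qed.

Lemma measurable_fun_rV dT (T : measurableType dT) (R : realType) (d : nat)
    (f : T -> 'rV[R]_d) :
  (forall i, measurable_fun setT (fun x => f x 0 i)) -> measurable_fun setT f.
Proof.
move=> mf; apply: (measurability (@open 'rV[R]_d)) => // _ [U oU <-].
rewrite setTI.
pose box (q : {ffun 'I_d -> rat * rat}) : set 'rV[R]_d :=
  [set v | forall i, `](ratr (q i).1 : R), ratr (q i).2[%classic (v 0 i)].
have -> : U = \bigcup_q (if `[< box q `<=` U >] then box q else set0).
  apply/seteqP; split => [v Uv|v [q _]]; last by case: ifPn => // /asboolP; apply.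
  have [P Pv PU] : nbhs v U by exact: open_nbhs_nbhs.
  have /choice[q qP] := fun i => nbhs_ratbox (Pv 0 i).
  exists [ffun i => q i] => //; case: ifPn => [_ i|/asboolPn[]].
    by rewrite ffunE; exact: (qP i).1.
  move=> w bw; apply: PU => i j; rewrite ord1.
  by apply: (qP j).2; have := bw j; rewrite ffunE.
rewrite preimage_bigcup; apply: countable_bigcupT_measurable => // q.
case: ifP => _; last by rewrite preimage_set0.
have -> : f @^-1` box q = \bigcap_(i in [set: 'I_d])
    ((fun x => f x 0 i) @^-1` `](ratr (q i).1 : R), ratr (q i).2[%classic).
  by apply/seteqP; split => x bx i => [_|]; [exact: (bx i)|exact: (bx i I)].
apply: fin_bigcap_measurable => [|i _]; first exact: finite_finset.
by rewrite -[X in measurable X]setTI; apply: mf.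
Qed.

Definition cons_rV (R : realType) (d : nat) (xv : R * 'rV[R]_d) : 'rV[R]_d.+1 :=
  \row_i (if unlift ord0 i is Some j then xv.2 0 j else xv.1).

Definition uncons_rV (R : realType) (d : nat) (v : 'rV[R]_d.+1) : R * 'rV[R]_d :=
  (v 0 ord0, \row_j v 0 (lift ord0 j)).

Lemma cons_rVK (R : realType) (d : nat) :
  cancel (@cons_rV R d) (@uncons_rV R d).
Proof.
move=> [x v]; rewrite /uncons_rV /cons_rV mxE unlift_none; congr pair.
by apply/rowP => j; rewrite !mxE liftK.
Qed.

Lemma measurable_cons_rV (R : realType) (d : nat) :
  measurable_fun setT (@cons_rV R d).
Proof.
apply: measurable_fun_rV => i; rewrite /cons_rV.
under eq_fun do rewrite mxE.
case: unliftP => [j _|_]; last exact: measurable_fst.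
apply: (@measurableT_comp _ _ _ _ _ _ (fun v : 'rV[R]_d => v 0 j)) => //.
exact: measurable_coord.
Qed.

Lemma measurable_uncons_rV (R : realType) (d : nat) :
  measurable_fun setT (@uncons_rV R d).
Proof.
apply: measurable_fun_pair; first exact: measurable_coord.
apply: measurable_fun_rV => i.
under eq_fun do rewrite mxE.
exact: measurable_coord.
Qed.

Section cons_measure.
Context (R : realType) (d : nat).
Context (mu : {sigma_finite_measure set 'rV[R]_d -> \bar R}).

Definition cons_measure : set 'rV[R]_d.+1 -> \bar R :=
  pushforward (@lebesgue_measure R \x mu)%E (@cons_rV R d).

Let cons_measure0 : cons_measure set0 = 0%E.
Proof. by rewrite /cons_measure /pushforward preimage_set0 measure0. Qed.

Let cons_measure_ge0 A : (0 <= cons_measure A)%E.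
Proof. by rewrite /cons_measure /pushforward; exact: measure_ge0. Qed.

Let cons_measure_sigma_additive : semi_sigma_additive cons_measure.
Proof.
move=> F mF tF mUF; rewrite /cons_measure /pushforward preimage_bigcup.
have mK A : measurable A -> measurable (@cons_rV R d @^-1` A).
  by move=> mA; rewrite -[X in measurable X]setTI; exact: measurable_cons_rV.
apply: measure_semi_sigma_additive => [n||]; first exact: mK.
- apply/trivIsetP => i j _ _ ij; rewrite -preimage_setI.
  by move/trivIsetP : tF => /(_ i j Logic.I Logic.I ij) ->; rewrite preimage_set0.
- by rewrite -preimage_bigcup; exact: mK.
Qed.

HB.instance Definition _ := isMeasure.Build _ _ _ cons_measure
  cons_measure0 cons_measure_ge0 cons_measure_sigma_additive.

Let cons_measure_sigma_finite : sigma_finite setT cons_measure.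
Proof.
have /sigma_finiteP[F [TF ndF Foo]] := sigma_finiteT (@lebesgue_measure R).
have /sigma_finiteP[G [TG ndG Goo]] := sigma_finiteT mu.
exists (fun n => @uncons_rV R d @^-1` (F n `*` G n)).
  rewrite -preimage_bigcup; apply/esym; rewrite -subTset => v _.
  have [n _ Fn] : (\bigcup_n F n) (uncons_rV v).1 by rewrite -TF.
  have [k _ Gk] : (\bigcup_n G n) (uncons_rV v).2 by rewrite -TG.
  exists (maxn n k) => //; split.
    exact: (subsetPset _ _ (ndF _ _ (leq_maxl n k))).
  exact: (subsetPset _ _ (ndG _ _ (leq_maxr n k))).
move=> n; have [mF Fn] := Foo n; have [mG Gn] := Goo n; split.
  rewrite -[X in measurable X]setTI; apply: measurable_uncons_rV => //.
  exact: measurableX.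
rewrite /cons_measure /pushforward -comp_preimage.
rewrite (_ : _ \o _ = id); last by apply/funext => xv; exact: cons_rVK.
by rewrite preimage_id product_measure1E // lte_mul_pinfty // ge0_fin_numE.
Qed.

HB.instance Definition _ := Measure_isSigmaFinite.Build _ _ _ cons_measure
  cons_measure_sigma_finite.

End cons_measure.

Fixpoint lebesgue_rV (R : realType) (d : nat) :
    {sigma_finite_measure set 'rV[R]_d -> \bar R} :=
  match d return {sigma_finite_measure set 'rV[R]_d -> \bar R} with
  | 0%N => @dirac _ 'rV[R]_0 0 R
  | d'.+1 => cons_measure (lebesgue_rV R d')
  end.

Lemma lebesgue_rV_box (R : realType) (d : nat) (B : 'I_d -> set R) :
  (forall i, measurable (B i)) ->
  lebesgue_rV R d [set v | forall i, B i (v 0 i)] =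
    (\prod_(i < d) lebesgue_measure (B i))%E.
Proof.
elim: d B => [|d IH] B mB.
  by rewrite big_ord0 /= diracE mem_set // => -[].
rewrite big_ord_recl /= /cons_measure /pushforward.
pose C := [set v : 'rV[R]_d | forall j, B (lift ord0 j) (v 0 j)].
have mC : measurable C.
  have -> : C = \bigcap_(j in [set: 'I_d])
      ((fun v : 'rV[R]_d => v 0 j) @^-1` B (lift ord0 j)).
    by apply/seteqP; split => v Cv j => [_|]; [exact: (Cv j)|exact: (Cv j I)].
  apply: fin_bigcap_measurable => [|j _]; first exact: finite_finset.
  by rewrite -[X in measurable X]setTI; apply: measurable_coord.
rewrite (_ : _ @^-1` _ = B ord0 `*` C); last first.
  apply/seteqP; split => -[x v] /=.
    move=> Bxv; split => /= [|j].
      by have := Bxv ord0; rewrite mxE unlift_none.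
    by have := Bxv (lift ord0 j); rewrite mxE liftK.
  move=> [/= Bx Cv] i; rewrite mxE /=.
  case: (unliftP ord0 i) => [j iE|iE]; rewrite iE; [exact: Cv|exact: Bx].
rewrite product_measure1E; [|exact: mB|exact: mC].
by rewrite -(IH (fun j => B (lift ord0 j))) => [|j]; [|exact: mB].
Qed.

Definition time (R : realType) := set_type [set t : R | 0 <= t].

Lemma max0_ge0 (R : realType) (t : R) : [set t : R | 0 <= t] (Num.max 0 t).
Proof. by rewrite /= le_max lexx. Qed.

(* Negative reals are sent to 0, so that paths can be evaluated at a real time. *)
Definition to_time (R : realType) (t : R) : time R :=
  exist _ (Num.max 0 t) (mem_set (max0_ge0 t)).

Definition pathspace (R : realType) (d : nat) : Type :=
  continuousType (time R) 'rV[R]_d.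

Definition at_time (R : realType) (d : nat) (w : pathspace R d) (t : R) :
  'rV[R]_d := w (to_time t).

Section pathspace_structure.
Context (R : realType) (d : nat).

HB.instance Definition _ := Choice.on (pathspace R d).

(* [{family compact, U -> V}] is U -> V with the topology of uniform
   convergence on the compact subsets of U. *)
HB.instance Definition _ := Topological.copy (pathspace R d)
  (initial_topology
    (fun w : pathspace R d => w : {family compact, time R -> 'rV[R]_d})).

Let zero_path (_ : time R) : 'rV[R]_d := 0.

Let zero_path_continuous : continuous zero_path.
Proof. exact: cst_continuous. Qed.

HB.instance Definition _ := isContinuous.Build _ _ zero_path zero_path_continuous.

HB.instance Definition _ := isPointed.Build (pathspace R d)
  (zero_path : continuousType (time R) 'rV[R]_d).

Let borel0 : <<s @open (pathspace R d) >> set0.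
Proof. exact: sigma_algebra0. Qed.

Let borelC A : <<s @open (pathspace R d) >> A ->
  <<s @open (pathspace R d) >> (~` A).
Proof. exact: sigma_algebraC. Qed.

Let borel_bigcup (F : (set (pathspace R d))^nat) :
  (forall i, <<s @open (pathspace R d) >> (F i)) ->
  <<s @open (pathspace R d) >> (\bigcup_i F i).
Proof. exact: sigma_algebra_bigcup. Qed.

HB.instance Definition _ := @isMeasurable.Build default_measure_display
  (pathspace R d) <<s @open (pathspace R d) >> borel0 borelC borel_bigcup.

End pathspace_structure.

Section stopped_path.
Context (R : realType) (d : nat) (t : R) (w : pathspace R d).

Definition stop_fun (s : time R) : 'rV[R]_d := at_time w (Num.min t (val s)).

Lemma stop_fun_continuous : continuous stop_fun.
Proof.
have ct : continuous (fun s : time R => to_time (Num.min t (val s))).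
  apply: continuous_comp_initial => s.
  apply: (@continuous_comp _ _ _ (val : time R -> R)
    (fun u => Num.max 0 (Num.min t u))); first exact: initial_continuous.
  apply: continuous_max; first exact: cst_continuous.
  by apply: continuous_min; [exact: cst_continuous|move=> ?].
by move=> s; apply: (continuous_comp (ct s)); exact: cts_fun.
Qed.

HB.instance Definition _ := isContinuous.Build _ _ stop_fun stop_fun_continuous.

Definition stop : pathspace R d := stop_fun : continuousType (time R) 'rV[R]_d.

End stopped_path.

(* For t >= 0, the sigma-field B_t(C) generated by w |-> w(t /\ .). *)
Definition past (R : realType) (d : nat) (t : R) :
    set_system (pathspace R d) :=
  preimage_set_system setT (@stop R d t) measurable.

Section weak_solutions.
Context (R : realType) (d : nat).

Definition is_filtration dO (O : measurableType dO) (F : R -> set_system O) :=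
  [/\ forall t, 0 <= t -> sigma_algebra setT (F t),
      forall t, 0 <= t -> F t `<=` measurable &
      forall s t, 0 <= s -> s <= t -> F s `<=` F t].

Definition is_adapted dO (O : measurableType dO) (F : R -> set_system O)
    (J : set R) (X : O -> pathspace R d) :=
  forall t, J t -> forall B, measurable B ->
    F t ((fun o => at_time (X o) t) @^-1` B).

(* The last clause says that W_t - W_s is independent of F_s, with independent
   N(0, t - s) coordinates; [normal_prob] takes a standard deviation. *)
Definition is_brownian_motion dO (O : measurableType dO)
    (P : probability O R) (F : R -> set_system O) (W : O -> pathspace R d) :=
  [/\ is_adapted F `[0, +oo[ W,
      {ae P, forall o, at_time (W o) 0 = 0} &
      forall s t, 0 <= s -> s < t ->
      forall A, F s A -> forall B : 'I_d -> set R, (forall i, measurable (B i)) ->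
        P (A `&` [set o | forall i,
                    B i (at_time (W o) t 0 i - at_time (W o) s 0 i)]) =
        (P A * \prod_(i < d) normal_prob 0 (Num.sqrt (t - s)) (B i))%E].

Definition is_weak_solution (J : set R) (b : R -> pathspace R d -> 'rV[R]_d)
    (x : 'rV[R]_d) dO (O : measurableType dO) (P : probability O R)
    (F : R -> set_system O) (W X : O -> pathspace R d) :=
  [/\ is_filtration F, is_brownian_motion P F W, is_adapted F J X &
      {ae P, forall o, forall t, J t -> forall i,
        at_time (X o) t 0 i =
        x 0 i + \int[lebesgue_measure]_(s in `[0, t]) b s (X o) 0 i
        + at_time (W o) t 0 i}].

Definition is_continuous_density dO (O : measurableType dO)
    (P : probability O R) (Z : O -> 'rV[R]_d) (f : 'rV[R]_d -> R) :=
  [/\ continuous f, forall y, 0 <= f y &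
      forall A, measurable A ->
        P (Z @^-1` A) = (\int[lebesgue_rV R d]_(y in A) (f y)%:E)%E].

(* For bounded b solutions are unique in law, so it does not matter which
   solution is chosen. *)
Definition is_solution_density (J : set R)
    (b : R -> pathspace R d -> 'rV[R]_d) (x : 'rV[R]_d)
    (f : R -> 'rV[R]_d -> R) :=
  exists (dO : measure_display) (O : measurableType dO) (P : probability O R)
         (F : R -> set_system O) (W X : O -> pathspace R d),
    is_weak_solution J b x P F W X /\
    forall t, J t -> 0 < t ->
      is_continuous_density P (fun o => at_time (X o) t) (f t).

Definition euclidean_norm (v : 'rV[R]_d) : R := Num.sqrt (\sum_i v 0 i ^+ 2).

Definition drift_bounded (b : R -> pathspace R d -> 'rV[R]_d) :=
  exists M, forall t w, 0 <= t -> euclidean_norm (b t w) <= M.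

Definition drift_norm (b : R -> pathspace R d -> 'rV[R]_d) : R :=
  sup [set euclidean_norm (b tw.1 tw.2) | tw in [set t | 0 <= t] `*` setT].

(* Unlike [Num.sg], sgn 0 = -1. *)
Definition sgn (u : R) : R := if u <= 0 then -1 else 1.

Definition bang_bang (alpha beta : 'rV[R]_d) (t : R) (w : pathspace R d) :
    'rV[R]_d :=
  \row_i (beta 0 i * sgn (alpha 0 i - at_time w t 0 i)).

End weak_solutions.

(* Main.v *)
(* For [b = M] or [b = -M], the function F(s, z) = profile b s z solves
   F_s = F''/2 + b |F'| in one dimension, and F(s, .) concentrates at 0 as s -> 0.
   Let v(s, z) be the product of the F(s, z_i - y_i). Along any process X with drift
   bounded by M = ||b||, the process u |-> v(eps + t - u, X_u) is a supermartingale if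
   b = M and a submartingale if b = -M, whereas it is a martingale along the bang-bang
   diffusion with the same b. Instead of Ito's formula, this is read off an Euler scheme
   with step h = t / n: only independence and the moments of the Brownian increments
   are used, the error per step is O(h^(3/2)), and in the bang-bang case the
   difference between the frozen drift b sgn(y - X_u) h and the true drift
   integral is multiplied by F'(X_u - y), which is small wherever sgn can change, so
   that its sum vanishes by dominated convergence. Hence
     E v(eps, X_t) <= v(eps + t, x) = E v(eps, Y_t)    if b = M,
   and the reverse if b = -M. As v(eps, .) concentrates at y when eps -> 0,
   this compares the continuous densities of X_t and Y_t at y. *)

From HB Require Import structures.
Require Import Defs.
From mathcomp Require Import all_boot all_order all_algebra.
From mathcomp Require Import all_classical all_reals all_analysis.
From mathcomp Require Import measurable_realfun normal_distribution ring lra.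

Set Implicit Arguments.
Unset Strict Implicit.
Unset Printing Implicit Defensive.

Import Order.TTheory GRing.Theory Num.Theory numFieldNormedType.Exports.

Local Open Scope classical_set_scope.
Local Open Scope ring_scope.

(** * The profile function *)

Section calculus.
Context {R : realType}.

(** The profile is a closed form of the integral in the one-dimensional bang-bang kernel at its
    switching level: [profile b s z] is [(2 pi s)^(-1/2)] times the integral of
    [u exp(-(u - b sqrt s)^2 / 2)] over [u > |z| / sqrt s]. Its equation is the backward equation,
    because [F'] has the sign of [- z], so that [b sgn(- z) F' = b |F'|]. Now [M |F'|] is the
    maximum of [a F'] over [|a| <= M] and [- M |F'|] the minimum: for [b = M] or [b = - M] this is
    the Bellman equation of drift control, with the bang-bang drift as optimal control. Three
    obstacles shape the estimates. [F(s, .)] is singular as [s -> 0]; the offset [eps] keeps all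
    bounds uniform. [F''] has a kink at 0 when [b] is nonzero, but as [F'] vanishes there the Taylor
    remainder is still cubic. And the drift accumulated over a step depends on the noise of that
    step, so it is exchanged for the drift frozen at the start of the step, which the increment is
    independent of. *)

Lemma mean_value_bound (f df : R -> R) (a b K : R) :
  (forall x, a <= x <= b -> is_derive x (1:R) f (df x)) ->
  (forall x, a <= x <= b -> `|df x| <= K) -> a <= b ->
  `|f b - f a| <= K * (b - a).
Proof.
move=> fdf dfK ab.
have [||x] := @MVT_segment R f df a b ab.
- by move=> x; rewrite in_itv /= => xab; apply: fdf; lra.
- by apply: derivable_within_continuous => x; rewrite in_itv /= => /fdf[].
- rewrite in_itv /= => xab ->; rewrite normrM (ger0_norm (x := b - a)) ?subr_ge0//.
  by rewrite ler_wpM2r ?subr_ge0 ?dfK.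
Qed.

Lemma mean_value_bound0 (G dG : R -> R) (d K : R) : G 0 = 0 ->
  (forall s, is_derive s (1:R) G (dG s)) ->
  (forall s, `|s| <= `|d| -> `|dG s| <= K) -> `|G d| <= K * `|d|.
Proof.
move=> G0 GdG dGK; have [d0|d0] := leP 0 d.
  rewrite -[G d]subr0 -G0 -[X in _ * X]subr0 (ger0_norm d0).
  rewrite -{2}[d]subr0 subr0.
  have := @mean_value_bound G dG 0 d K; rewrite subr0; apply => //.
  by move=> x /andP[x0 xd]; apply: dGK; rewrite !ger0_norm.
rewrite -normrN -[- G d]sub0r -G0 (ltr0_norm d0).
have := @mean_value_bound G dG d 0 K; rewrite sub0r; apply => //; last exact: ltW.
by move=> x /andP[x0 xd]; apply: dGK; rewrite (ler0_norm xd) (ltr0_norm d0) lerN2.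
Qed.

(** The remainder vanishes at 0 and its derivative is the remainder of one order less, so the mean
    value bound is used once per order. This yields [K] instead of [K / 2] here and instead of
    [K / 6] in [taylor2]; only the order of the error matters. *)
Lemma taylor1 (f f1 f2 : R -> R) (K r d : R) :
  (forall s : R, is_derive s (1 : R) f (f1 s)) ->
  (forall s : R, is_derive s (1 : R) f1 (f2 s)) ->
  (forall s, `|s| <= `|d| -> `|f2 (r + s)| <= K) ->
  `|f (r + d) - f r - f1 r * d| <= K * `|d| ^+ 2.
Proof.
move=> ff1 f12 f2K.
pose G s := f (r + s) - f r - f1 r * s.
have K0 : 0 <= K by apply: le_trans (f2K d (lexx _)).
rewrite -[X in `|X|]/(G d) expr2 mulrA.
apply: (@mean_value_bound0 _ (fun s => f1 (r + s) - f1 r)).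
- by rewrite /G addr0 mulr0; ring.
- move=> s; rewrite /G; apply: is_derive_eq.
  by rewrite /GRing.scale /=; ring.
- move=> s sd; pose H u := f1 (r + u) - f1 r.
  rewrite -[X in `|X|]/(H s).
  apply: (@le_trans _ _ (K * `|s|)); last by rewrite ler_wpM2l.
  apply: (@mean_value_bound0 _ (fun u => f2 (r + u))).
  + by rewrite /H addr0 subrr.
  + by move=> u; rewrite /H; apply: is_derive_eq; rewrite /GRing.scale /=; ring.
  + by move=> u us; apply: f2K; exact: le_trans sd.
Qed.

Lemma taylor2 (f f1 f2 f3 : R -> R) (K r d : R) :
  (forall s : R, is_derive s (1 : R) f (f1 s)) ->
  (forall s : R, is_derive s (1 : R) f1 (f2 s)) ->
  (forall s : R, is_derive s (1 : R) f2 (f3 s)) ->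
  (forall s, `|s| <= `|d| -> `|f3 (r + s)| <= K) ->
  `|f (r + d) - f r - f1 r * d - 2^-1 * f2 r * d ^+ 2| <= K * `|d| ^+ 3.
Proof.
move=> ff1 f12 f23 f3K.
pose G s := f (r + s) - f r - f1 r * s - 2^-1 * f2 r * s ^+ 2.
have K0 : 0 <= K by apply: le_trans (f3K d (lexx _)).
rewrite -[X in `|X|]/(G d) exprSr mulrA.
apply: (@mean_value_bound0 _ (fun s => f1 (r + s) - f1 r - f2 r * s)).
- by rewrite /G addr0; ring.
- move=> s; rewrite /G; apply: is_derive_eq.
  by rewrite /GRing.scale /=; field.
- move=> s sd; apply: (@le_trans _ _ (K * `|s| ^+ 2)).
    by apply: (taylor1 f12 f23) => u us; apply: f3K; exact: le_trans sd.
  by rewrite ler_wpM2l ?lerXn2r ?nnegrE.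
Qed.

End calculus.
Arguments taylor1 {R f f1 f2 K} r d.
Arguments taylor2 {R f f1 f2 f3 K} r d.

Lemma integrable_EFinZl dT (T : measurableType dT) (R : realType)
    (mu : {measure set T -> \bar R}) (D : set T) (k : R) (f : T -> R) :
  measurable D -> mu.-integrable D (EFin \o f) ->
  mu.-integrable D (EFin \o (fun t => k * f t)).
Proof.
move=> mD fi; rewrite (_ : EFin \o _ = (fun t => k%:E * (EFin \o f) t)%E) //.
exact: integrableZl.
Qed.

(** * The Gaussian density and its tail *)

Section gauss_tail.
Context {R : realType}.
Notation mu := (@lebesgue_measure R).
Notation phi := (@normal_pdf R 0 1).

Lemma std_normal_pdfE (x : R) : phi x = normal_peak 1 * expR (- (x ^+ 2 / 2)).
Proof.
rewrite normal_pdfE ?oner_neq0// /normal_fun subr0 expr1n; congr (_ * expR _).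
by rewrite mulNr.
Qed.

Global Instance is_derive_std_normal_pdf (x : R) :
  is_derive x (1 : R) phi (- x * phi x).
Proof.
rewrite (_ : phi = fun x => normal_peak 1 * expR (- (x ^+ 2 / 2))); last first.
  by apply/funext => ?; rewrite std_normal_pdfE.
apply: is_derive_eq; by rewrite /GRing.scale /=; field.
Qed.

(** The upper tail beyond [x], reflected to a lower tail so that the fundamental theorem of calculus
    applies with the fixed end -oo. *)
Definition gauss_tail (x : R) : R := \int[mu]_(t in `]-oo, - x]) phi t.

Global Instance is_derive_gauss_tail (x : R) :
  is_derive x (1 : R) gauss_tail (- phi x).
Proof.
pose F y := \int[mu]_(t in `]-oo, y]) phi t.
have dF (y : R) : is_derive y (1 : R) F (phi y).
  have [] := @continuous_FTC1 R phi -oo%O y (y + 1).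
  - by rewrite ltrDl.
  - apply: integrableS (integrable_normal_pdf 0 1) => //.
  - by rewrite ltNyr.
  - by apply: continuous_normal_pdf; exact: oner_neq0.
  - by move=> dF Fy; split; [exact: dF|rewrite -derive1E].
rewrite (_ : gauss_tail = fun x => F (- x)) //.
apply: is_derive_eq; rewrite /GRing.scale /= std_normal_pdfE [in RHS]std_normal_pdfE.
by rewrite sqrrN; ring.
Qed.

Lemma gauss_tail_ge0 x : 0 <= gauss_tail x.
Proof. by apply: Rintegral_ge0 => ? _; exact: normal_pdf_ge0. Qed.

Lemma gauss_tail_le1 x : gauss_tail x <= 1.
Proof.
rewrite /gauss_tail /Rintegral -[leRHS]/(fine 1%:E) -(integral_normal_pdf 0 1).
apply: fine_le.
- apply: integrable_fin_num => //.
  by apply: integrableS (integrable_normal_pdf 0 1).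
- exact: integrable_fin_num (integrable_normal_pdf 0 1).
- apply: ge0_subset_integral => //.
  + by apply/measurable_EFinP; exact: measurable_normal_pdf.
  + by move=> ? _; rewrite lee_fin; exact: normal_pdf_ge0.
Qed.

(** Exponential tilting: [phi t] is [expR (t + 1/2)] times the normal density with mean -1, and
    [t <= - x] on the domain. With [x] of order [r / sqrt s], this decay already beats every power
    of [s]. *)
Lemma gauss_tail_le_expR x : gauss_tail x <= expR (2^-1 - x).
Proof.
have i1 : mu.-integrable `]-oo, - x] (EFin \o phi).
  by apply: integrableS (integrable_normal_pdf 0 1).
have i2 : mu.-integrable setT (EFin \o normal_pdf (-1) 1).
  exact: integrable_normal_pdf.
have i3 : mu.-integrable `]-oo, - x] (EFin \o normal_pdf (-1) 1).
  by apply: integrableS i2.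
apply: (@le_trans _ _
  (\int[mu]_(t in `]-oo, - x]) (expR (2^-1 - x) * normal_pdf (-1) 1 t))).
  apply: le_Rintegral => //.
  - exact: integrable_EFinZl.
  - move=> t; rewrite /= in_itv /= => tx.
    rewrite std_normal_pdfE normal_pdfE ?oner_neq0// /normal_fun mulrCA.
    rewrite ler_wpM2l ?normal_peak_ge0// -expRD ler_expR expr1n opprK.
    by rewrite -subr_ge0 (_ : _ - _ = - x - t) ?subr_ge0//; field.
rewrite RintegralZl// -[leRHS]mulr1 ler_wpM2l ?expR_ge0//.
rewrite /Rintegral -[leRHS]/(fine 1%:E) -(integral_normal_pdf (-1) 1).
apply: fine_le.
- exact: integrable_fin_num.
- exact: integrable_fin_num i2.
- apply: ge0_subset_integral => //.
  + by apply/measurable_EFinP; exact: measurable_normal_pdf.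
  + by move=> ? _; rewrite lee_fin; exact: normal_pdf_ge0.
Qed.

End gauss_tail.

(** * The radial solution and its derivatives *)

Section radial.
Context {R : realType}.
Notation phi := (@normal_pdf R 0 1).
Variable b : R.

(* [profile b s z = radial b s `|z|] is the explicit solution of
   [F_s = F'' / 2 + b * |F'|] issued from the Dirac mass at 0; it is
   [normal_pdf 0 (sqrt s)] when [b = 0]. *)
Definition radial_arg (s r : R) : R := r / Num.sqrt s - b * Num.sqrt s.

Definition radial (s r : R) : R :=
  phi (radial_arg s r) / Num.sqrt s + b * gauss_tail (radial_arg s r).

Definition radial_d1 (s r : R) : R :=
  - (r / Num.sqrt s ^+ 3) * phi (radial_arg s r).

Definition radial_d2 (s r : R) : R :=
  (r * radial_arg s r / Num.sqrt s ^+ 4 - (Num.sqrt s ^+ 3)^-1) * phi (radial_arg s r).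

Definition radial_d3 (s r : R) : R :=
  (2 * r / Num.sqrt s ^+ 5 - b / Num.sqrt s ^+ 3
   - radial_arg s r / Num.sqrt s *
     (r * radial_arg s r / Num.sqrt s ^+ 4 - (Num.sqrt s ^+ 3)^-1)) *
  phi (radial_arg s r).

(** The right-hand side of the equation: for [r >= 0] the radial function decreases, so [|F'|] is
    [- radial_d1]. *)
Definition radial_dt (s r : R) : R := 2^-1 * radial_d2 s r - b * radial_d1 s r.

Definition radial_dtt (s r : R) : R :=
  (3 / 4 / Num.sqrt s ^+ 5 - 5 / 4 * r ^+ 2 / Num.sqrt s ^+ 7
     - 3 / 4 * b * r / Num.sqrt s ^+ 5
   + radial_arg s r * (2^-1 * r / Num.sqrt s ^+ 3 + 2^-1 * b / Num.sqrt s) *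
     (2^-1 * r ^+ 2 / Num.sqrt s ^+ 5 + 2^-1 * b * r / Num.sqrt s ^+ 3
      - 2^-1 / Num.sqrt s ^+ 3)) * phi (radial_arg s r).

(** [radial_dt] is a polynomial in [1 / sqrt s] times [phi] at [radial_arg]. Keeping these two
    functions abstract as [k] and [X] makes the derivative a single [field] identity. *)
Lemma is_derive_radial_aux (k X : R -> R) (r s dk dX : R) :
  is_derive s (1 : R) k dk -> is_derive s (1 : R) X dX ->
  is_derive s (1 : R)
    (fun u => (2^-1 * r ^+ 2 * k u ^+ 5 + 2^-1 * (b * r - 1) * k u ^+ 3) * phi (X u))
    ((5 / 2 * r ^+ 2 * k s ^+ 4 + 3 / 2 * (b * r - 1) * k s ^+ 2) * dk * phi (X s)
     - (2^-1 * r ^+ 2 * k s ^+ 5 + 2^-1 * (b * r - 1) * k s ^+ 3) * (X s * phi (X s)) * dX).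
Proof.
move=> dk' dX'; apply: is_derive_eq.
rewrite /GRing.scale /=; move: (phi _) => P.
by field.
Qed.

(** The tail disappears after one derivative: [phi' = - X phi] and the derivative [- phi] of the
    tail combine, with [X = radial_arg b s r], to [-(X + b sqrt s) phi = -(r / sqrt s) phi]. All
    further derivatives are therefore polynomials times [phi]. *)
Lemma radial_derive (s r : R) : 0 < s ->
  [/\ is_derive r (1 : R) (radial s) (radial_d1 s r),
      is_derive r (1 : R) (radial_d1 s) (radial_d2 s r),
      is_derive r (1 : R) (radial_d2 s) (radial_d3 s r),
      is_derive s (1 : R) (fun u => radial u r) (radial_dt s r) &
      is_derive s (1 : R) (fun u => radial_dt u r) (radial_dtt s r)].
Proof.
move=> s0; have q0 : Num.sqrt s != 0 by rewrite gt_eqF ?sqrtr_gt0.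
have dq := is_derive1_sqrt s0.
split.
- rewrite /radial /radial_arg; apply: is_derive_eq.
  rewrite /GRing.scale /= /radial_d1 /radial_arg.
  move: (phi _) => P; move: (Num.sqrt s) q0 => q q0; by field.
- rewrite /radial_d1 /radial_arg; apply: is_derive_eq.
  rewrite /GRing.scale /= /radial_d2 /radial_arg.
  move: (phi _) => P; move: (Num.sqrt s) q0 => q q0; by field.
- rewrite /radial_d2 /radial_arg; apply: is_derive_eq.
  rewrite /GRing.scale /= /radial_d3 /radial_arg.
  move: (phi _) => P; move: (Num.sqrt s) q0 => q q0; by field.
- rewrite /radial /radial_arg; apply: is_derive_eq.
  rewrite /GRing.scale /= /radial_dt /radial_d2 /radial_d1 /radial_arg.
  move: (phi _) => P; move: (Num.sqrt s) q0 => q q0; by field.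
- rewrite (_ : (fun u => radial_dt u r) = fun u =>
    (2^-1 * r ^+ 2 * (Num.sqrt u)^-1 ^+ 5
     + 2^-1 * (b * r - 1) * (Num.sqrt u)^-1 ^+ 3) * phi (radial_arg u r)); last first.
    apply/funext => u; rewrite /radial_dt /radial_d2 /radial_d1.
    rewrite /radial_arg; move: (phi _) => P; move: (Num.sqrt u) => q.
    (* The two functions of [u] must agree everywhere, also for [u <= 0], where the square root and
       its inverse are 0 and both sides vanish. *)
    have [->|q1] := eqVneq q 0; last by field.
    by rewrite !(expr0n, invr0, mulr0, mul0r, addr0, oppr0).
  have dk : is_derive s (1 : R) (fun u => (Num.sqrt u)^-1)
      (- 2^-1 / Num.sqrt s ^+ 3).
    apply: is_derive_eq; rewrite /GRing.scale /=.
    by move: (Num.sqrt s) q0 => q q0; field.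
  have dX : is_derive s (1 : R) (fun u => radial_arg u r)
      (- (2^-1 * r / Num.sqrt s ^+ 3 + 2^-1 * b / Num.sqrt s)).
    rewrite /radial_arg; apply: is_derive_eq; rewrite /GRing.scale /=.
    by move: (Num.sqrt s) q0 => q q0; field.
  apply: (is_derive_eq (is_derive_radial_aux r dk dX)).
  rewrite /radial_dtt /radial_arg; move: (phi _) => P.
  by move: (Num.sqrt s) q0 => q q0; by field.
Qed.
End radial.

(** * Bounds by powers of a single constant *)

Section power_bounds.
Context {R : realType}.
Variable M : R.
Hypothesis M2 : 2 <= M.

Let M1 : 1 <= M. Proof. by apply: le_trans M2; rewrite ler1n. Qed.

Lemma power_boundM (x y : R) i j : `|x| <= M ^+ i -> `|y| <= M ^+ j ->
  `|x * y| <= M ^+ (i + j).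
Proof. by move=> xi yj; rewrite normrM exprD ler_pM. Qed.

(** The factor 2 from adding two bounds is absorbed into one more power of [M], which is where
    [2 <= M] enters. *)
Lemma power_boundD (x y : R) i j : `|x| <= M ^+ i -> `|y| <= M ^+ j ->
  `|x + y| <= M ^+ (i + j).+1.
Proof.
move=> xi yj; apply: (le_trans (ler_normD _ _)); apply: (le_trans (lerD xi yj)).
rewrite exprS; apply: (@le_trans _ _ (2 * M ^+ (i + j))); last first.
  by rewrite ler_wpM2r// exprn_ge0// (le_trans _ M1).
by rewrite mulrDl mul1r lerD// ler_weXn2l// ?leq_addr ?leq_addl.
Qed.

Lemma power_boundN (x : R) i : `|x| <= M ^+ i -> `|- x| <= M ^+ i.
Proof. by rewrite normrN. Qed.

Lemma power_boundX (x : R) i n : `|x| <= M ^+ i -> `|x ^+ n| <= M ^+ (i * n).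
Proof. by move=> xi; rewrite normrX exprM lerXn2r// nnegrE// exprn_ge0// (le_trans _ M1). Qed.

Lemma power_boundVX (x : R) i n : `|x^-1| <= M ^+ i -> `|(x ^+ n)^-1| <= M ^+ (i * n).
Proof. by rewrite -exprVn; exact: power_boundX. Qed.

Lemma power_bound_nat k : (k <= 5)%N -> `|k%:R : R| <= M ^+ 3.
Proof.
move=> k5; rewrite normr_nat (@le_trans _ _ (2 ^+ 3))//.
  by rewrite -natrX ler_nat (leq_trans k5).
by rewrite lerXn2r// nnegrE// (le_trans _ M1).
Qed.

Lemma power_bound_invn k : `|k.+1%:R^-1 : R| <= M ^+ 1.
Proof.
by apply: (le_trans _ M1); rewrite ger0_norm ?invr_ge0// invf_le1 ?ltr0n// ler1n.
Qed.

End power_bounds.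

(** Follows the syntax of the bounded expression. The exponent is an existential variable that is
    assembled on the way; its size is checked only afterwards, by computation. *)
Ltac power_bounds hD hM hN hX hV hn hi :=
  lazymatch goal with
  | |- is_true (`|_ + _| <= _) => eapply hD; power_bounds hD hM hN hX hV hn hi
  | |- is_true (`|_ * _| <= _) => eapply hM; power_bounds hD hM hN hX hV hn hi
  | |- is_true (`|- _| <= _) => eapply hN; power_bounds hD hM hN hX hV hn hi
  | |- is_true (`|(_ ^+ _)^-1| <= _) => eapply hV; power_bounds hD hM hN hX hV hn hi
  | |- is_true (`|_ ^+ _| <= _) => eapply hX; power_bounds hD hM hN hX hV hn hi
  | |- _ => first [eassumption | apply: hi | (eapply hn; done)]
  end.

Section radial_bounds.
Context {R : realType}.
Notation phi := (@normal_pdf R 0 1).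

(** Completing the square: [N |x| - x^2 / 2 <= N^2 / 2]. *)
Lemma expR_pdf_bound N (x : R) :
  expR `|x| ^+ N * phi x <= normal_peak 1 * expR (N%:R ^+ 2 / 2).
Proof.
rewrite std_normal_pdfE mulrCA ler_wpM2l ?normal_peak_ge0//.
rewrite -expRM_natl -expRD ler_expR -(real_normK (num_real x)).
by move: `|x| => y; have := sqr_ge0 (N%:R - y); rewrite !expr2; lra.
Qed.

Variable b : R.

Lemma radial_bound (e S : R) : 0 < e -> exists2 K : R, 0 <= K & forall s r, e <= s -> s <= S ->
  [/\ `|radial b s r| <= K, `|radial_d1 b s r| <= K * `|r| &
      [/\ `|radial_d1 b s r| <= K, `|radial_d2 b s r| <= K,
          `|radial_d3 b s r| <= K & `|radial_dtt b s r| <= K]].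
Proof.
move=> e0.
pose A := 1 + Num.sqrt S + (Num.sqrt e)^-1 + `|b|.
pose C := 2 * A ^+ 3.
(* Since [1 + |radial_arg|], [1 / sqrt s] and [|b|] are at most
   [M := C * expR |radial_arg|], all the derivatives are at most [M ^+ N * phi],
   where 200 is any number above the degrees that occur. *)
pose N := 200%N.
pose K := C ^+ N * (normal_peak 1 * expR (N%:R ^+ 2 / 2)) + `|b|.
have S0 := sqrtr_ge0 S; have e0' : 0 <= (Num.sqrt e)^-1 by rewrite invr_ge0 sqrtr_ge0.
have b0 := normr_ge0 b.
have A1 : 1 <= A by rewrite /A; lra.
have A0 : 0 <= A by exact: le_trans A1.
have AX n : 1 <= A ^+ n by rewrite exprn_ege1.
have C2 : 2 <= C by rewrite /C; have := AX 3%N; lra.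
have AC : A <= C.
  rewrite /C (@le_trans _ _ (A ^+ 3))//; first by rewrite ler_eXnr.
  by have := AX 3%N; lra.
have C0 : 0 <= C by rewrite (le_trans _ C2).
exists K.
  apply: addr_ge0 => //; apply: mulr_ge0; first exact: exprn_ge0.
  by apply: mulr_ge0; [exact: normal_peak_ge0|exact: expR_ge0].
move=> s r es sS.
have s0 : 0 < s := lt_le_trans e0 es.
set X := radial_arg b s r.
set q := Num.sqrt s.
have q0 : 0 < q by rewrite sqrtr_gt0.
have qA : q <= A.
  have : q <= Num.sqrt S by rewrite ler_wsqrtr.
  by rewrite /A; lra.
have qVA : q^-1 <= A.
  have : q^-1 <= (Num.sqrt e)^-1 by rewrite lef_pV2 ?posrE ?sqrtr_gt0// ler_wsqrtr.
  by rewrite /A; lra.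
have bA : `|b| <= A by rewrite /A; lra.
pose M := C * expR `|X|.
have E1 : 1 <= expR `|X| by rewrite -expR0 ler_expR.
have CM : C <= M by rewrite /M ler_peMr.
have M2 : 2 <= M := le_trans C2 CM.
have AM : A <= M := le_trans AC CM.
have XM : `|X| <= M ^+ 1.
  rewrite expr1 /M (@le_trans _ _ (expR `|X|))//.
    by have := expR_ge1Dx `|X|; lra.
  by rewrite ler_peMl ?expR_ge0//; lra.
(* [r] is unbounded, but [r = q (X + b q)] is controlled by [X]. The constant [C = 2 A^3] is made
   for this bound: [A (E + A^2) <= 2 A^3 E] when [A] and [E = expR |X|] are at least 1. *)
have rM : `|r| <= M ^+ 1.
  have -> : r = q * (X + b * q).
    by rewrite /X /radial_arg -/q; field; rewrite gt_eqF.
  rewrite normrM (gtr0_norm q0) expr1.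
  apply: (@le_trans _ _ (A * (expR `|X| + A * A))).
    apply: ler_pM => //; first exact: ltW.
    apply: (le_trans (ler_normD _ _)); apply: lerD.
      by have := expR_ge1Dx `|X|; lra.
    by rewrite normrM ler_pM// (gtr0_norm q0).
  rewrite /M /C; have := AX 2; move: E1; set E := expR _ => E1 A2.
  have : A * E <= A * E * A ^+ 2 by rewrite ler_peMr// mulr_ge0// (le_trans _ E1).
  have : A ^+ 3 <= A ^+ 3 * E by rewrite ler_peMr// exprn_ge0.
  by rewrite mulrDr !expr2 !exprS expr0; lra.
have bM : `|b| <= M ^+ 1 by rewrite expr1; exact: le_trans AM.
have qM : `|q^-1| <= M ^+ 1.
  by rewrite gtr0_norm ?invr_gt0// expr1; exact: le_trans AM.
have polyK (P : R) (k : nat) : `|P| <= M ^+ k -> (k <= N)%N ->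
    `|P * phi X| <= C ^+ N * (normal_peak 1 * expR (N%:R ^+ 2 / 2)).
  move=> PM kN; rewrite normrM (ger0_norm (normal_pdf_ge0 _ _ _)).
  apply: (@le_trans _ _ (M ^+ N * phi X)).
    rewrite ler_wpM2r ?normal_pdf_ge0// (le_trans PM)//.
    by rewrite ler_weXn2l// (le_trans _ M2)// ler1n.
  by rewrite /M exprMn -mulrA ler_wpM2l ?exprn_ge0// expR_pdf_bound.
have polyK' (P : R) (k : nat) : `|P| <= M ^+ k -> (k <= N)%N ->
    `|P * phi X| <= K.
  by move=> PM kN; apply: (le_trans (polyK _ _ PM kN)); rewrite lerDl.
have hD := power_boundD M2; have hM := @power_boundM R M.
have hN := @power_boundN R M; have hX := power_boundX M2.
have hV := power_boundVX M2; have hn := power_bound_nat M2.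
have hi := power_bound_invn M2.
split.
- apply: (le_trans (ler_normD _ _)); apply: lerD.
    by rewrite mulrC; apply: (polyK _ 1%N).
  rewrite normrM ler_piMr// ger0_norm ?gauss_tail_ge0// gauss_tail_le1//.
- rewrite /radial_d1 -/q -/X.
  rewrite (_ : _ * _ = - (q ^+ 3)^-1 * phi X * r); last by ring.
  rewrite normrM ler_wpM2r//; eapply polyK'; first by power_bounds hD hM hN hX hV hn hi.
  by [].
- split.
  + rewrite /radial_d1 -/q -/X; eapply polyK'; first by power_bounds hD hM hN hX hV hn hi.
    by [].
  + rewrite /radial_d2 -/q -/X; eapply polyK'; first by power_bounds hD hM hN hX hV hn hi.
    by [].
  + rewrite /radial_d3 -/q -/X; eapply polyK'; first by power_bounds hD hM hN hX hV hn hi.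
    by [].
  + rewrite /radial_dtt -/q -/X; eapply polyK'; first by power_bounds hD hM hN hX hV hn hi.
    by [].
Qed.
End radial_bounds.

(** * The even extension to the line *)

Section profile.
Context {R : realType}.
Notation phi := (@normal_pdf R 0 1).
Variable b : R.

Definition profile (s z : R) : R := radial b s `|z|.

Definition profile_d1 (s z : R) : R :=
  - (z / Num.sqrt s ^+ 3) * phi (radial_arg b s `|z|).

Definition profile_d2 (s z : R) : R := radial_d2 b s `|z|.

Lemma profileN s z : profile s (- z) = profile s z.
Proof. by rewrite /profile normrN. Qed.

Lemma profile_d1N s z : profile_d1 s (- z) = - profile_d1 s z.
Proof. by rewrite /profile_d1 normrN; ring. Qed.

Lemma profile_d2N s z : profile_d2 s (- z) = profile_d2 s z.
Proof. by rewrite /profile_d2 normrN. Qed.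

Lemma profile_d1E s z : 0 <= z -> profile_d1 s z = radial_d1 b s z.
Proof. by move=> z0; rewrite /profile_d1 /radial_d1 (ger0_norm z0). Qed.

Lemma normr_profile_d1 s z : `|profile_d1 s z| = - radial_d1 b s `|z|.
Proof.
rewrite /profile_d1 /radial_d1 normrM normrN (ger0_norm (normal_pdf_ge0 _ _ _)).
by rewrite normrM normfV normrX (ger0_norm (sqrtr_ge0 _)) mulNr opprK.
Qed.

(** [F'] has the sign of [- z], and at [z = 0] both sides vanish. This identifies the drift term of
    the bang-bang generator with the [b |F'|] of the equation. *)
Lemma profile_d1_sgn s z : profile_d1 s z * sgn (- z) = `|profile_d1 s z|.
Proof.
rewrite normr_profile_d1 /sgn oppr_le0 /profile_d1 /radial_d1; case: ifPn => z0.
  by rewrite (ger0_norm z0) mulrN1.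
by rewrite -ltNge in z0; rewrite (ltr0_norm z0); ring.
Qed.

(** The cubic expansion serves the Gaussian step, the two-point estimate the exchange of one drift
    for another, and the expansion in [h] the passage from [s] to [s + h]. The bound [K |z|] on the
    derivative makes drift errors small near the switching level. *)
Lemma profile_estimates (e S : R) : 0 < e -> exists2 K : R, 0 <= K &
  forall s z, e <= s -> s <= S ->
  [/\ [/\ `|profile s z| <= K, `|profile_d1 s z| <= K,
          `|profile_d1 s z| <= K * `|z| & `|profile_d2 s z| <= K],
      forall d, `|profile s (z + d) - profile s z - profile_d1 s z * d
                  - 2^-1 * profile_d2 s z * d ^+ 2| <= K * `|d| ^+ 3,
      forall d d', `|profile s (z + d') - profile s (z + d)
                     - profile_d1 s z * (d' - d)|
                   <= K * (`|d' - d| * (`|d| + `|d'|)) &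
      forall h, 0 <= h -> s + h <= S ->
        `|profile (s + h) z - profile s z
          - h * (2^-1 * profile_d2 s z + b * `|profile_d1 s z|)| <= K * h ^+ 2].
Proof.
move=> e0; have [K K0 HK] := radial_bound b S e0.
exists (4 * K); first by rewrite mulr_ge0.
move=> s z es sS; have s0 : 0 < s := lt_le_trans e0 es.
have D1 (r : R) : is_derive r (1 : R) (radial b s) (radial_d1 b s r).
  by have [] := radial_derive b r s0.
have D2 (r : R) : is_derive r (1 : R) (radial_d1 b s) (radial_d2 b s r).
  by have [] := radial_derive b r s0.
have D3 (r : R) : is_derive r (1 : R) (radial_d2 b s) (radial_d3 b s r).
  by have [] := radial_derive b r s0.
have B2 r : `|radial_d2 b s r| <= K by have [_ _ []] := HK _ r es sS.
have B3 r : `|radial_d3 b s r| <= K by have [_ _ []] := HK _ r es sS.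
have KS (r : R) : 0 <= r -> K * r <= 4 * K * r.
  by move=> r0; rewrite ler_wpM2r//; lra.
have d10 : radial_d1 b s 0 = 0 by rewrite /radial_d1 mul0r oppr0 mul0r.
(* [radial b s] is even up to third order, because its derivative vanishes at 0 *)
have even3 w : `|radial b s `|w| - radial b s w| <= 2 * K * `|w| ^+ 3.
  have := taylor2 0 `|w| D1 D2 D3 (fun s _ => B3 _); have := taylor2 0 w D1 D2 D3 (fun s _ => B3 _).
  rewrite !add0r d10 !mul0r !subr0 normr_id (real_normK (num_real w)).
  by move: (radial b s `|w|) (radial b s w) => u v; rewrite !ler_norml; lra.
have even2 w : `|radial b s `|w| - radial b s w| <= 2 * K * `|w| ^+ 2.
  have := taylor1 0 `|w| D1 D2 (fun s _ => B2 _); have := taylor1 0 w D1 D2 (fun s _ => B2 _).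
  rewrite !add0r d10 !mul0r !subr0 normr_id.
  by move: (radial b s `|w|) (radial b s w) => u v; rewrite !ler_norml; lra.
have cross (w d : R) : 0 <= w -> w + d < 0 -> `|w + d| <= `|d|.
  by move=> w0 wd; rewrite (ltr0_norm wd) ler0_norm; lra.
(* While [w + d] stays nonnegative this is the expansion of [radial]. If it crosses 0, then
   [|w + d| <= |d|], and [even3] pays for replacing [|w + d|] by [w + d]. *)
have T3 w d : 0 <= w ->
    `|profile s (w + d) - profile s w - profile_d1 s w * d
      - 2^-1 * profile_d2 s w * d ^+ 2| <= 3 * K * `|d| ^+ 3.
  move=> w0; rewrite profile_d1E// /profile /profile_d2 (ger0_norm w0).
  have := taylor2 w d D1 D2 D3 (fun s _ => B3 _).
  have [wd|wd] := leP 0 (w + d).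
    by rewrite (ger0_norm wd) => /le_trans; apply; rewrite ler_wpM2r ?exprn_ge0//; lra.
  have : 2 * K * `|w + d| ^+ 3 <= 2 * K * `|d| ^+ 3.
    by rewrite ler_wpM2l ?mulr_ge0// lerXn2r ?nnegrE// cross.
  have := even3 (w + d); move: (radial b s _) (radial b s (w + d)) => u v.
  by rewrite !ler_norml; lra.
have T2 w d : `|profile s (w + d) - profile s w - profile_d1 s w * d|
              <= 3 * K * `|d| ^+ 2.
  wlog w0 : w d / 0 <= w => [Hw|].
    have [w0|w0] := leP 0 w; first exact: Hw.
    have := Hw (- w) (- d); rewrite -opprD !profileN profile_d1N mulrNN normrN.
    by apply; rewrite oppr_ge0 ltW.
  rewrite profile_d1E// /profile (ger0_norm w0).
  have := taylor1 w d D1 D2 (fun s _ => B2 _).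
  have [wd|wd] := leP 0 (w + d).
    by rewrite (ger0_norm wd) => /le_trans; apply; rewrite ler_wpM2r ?exprn_ge0//; lra.
  have : 2 * K * `|w + d| ^+ 2 <= 2 * K * `|d| ^+ 2.
    by rewrite ler_wpM2l ?mulr_ge0// lerXn2r ?nnegrE// cross.
  have := even2 (w + d); move: (radial b s _) (radial b s (w + d)) => u v.
  by rewrite !ler_norml; lra.
have D1K w : `|profile_d1 s w| <= K * `|w|.
  rewrite normr_profile_d1 (le_trans (ler_norm _))// normrN.
  by rewrite -[X in K * X]normr_id; have [] := HK s `|w| es sS.
have L w d : `|profile_d1 s (w + d) - profile_d1 s w| <= K * `|d|.
  wlog w0 : w d / 0 <= w => [Hw|].
    have [w0|w0] := leP 0 w; first exact: Hw.
    have := Hw (- w) (- d); rewrite -opprD !profile_d1N -opprD !normrN.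
    by apply; rewrite oppr_ge0 ltW.
  have [wd|wd] := leP 0 (w + d).
    rewrite !profile_d1E//.
    have [d0|d0] := leP 0 d.
      rewrite -[X in K * X](_ : (w + d) - w = _); last by rewrite (ger0_norm d0); ring.
      apply: (@mean_value_bound _ (radial_d1 b s) (radial_d2 b s)); [by move=> x _; exact: B2|lra].
    rewrite distrC -[X in K * X](_ : w - (w + d) = _); last by rewrite (ltr0_norm d0); ring.
    by apply: (@mean_value_bound _ (radial_d1 b s) (radial_d2 b s)); [move=> x _; exact: B2|lra].
  (* On opposite sides of 0 each value is at most [K] times its distance to 0, and the two distances
     add up to [|d|]. *)
  apply: (le_trans (ler_normB _ _)); apply: (le_trans (lerD (D1K _) (D1K _))).
  by rewrite -mulrDr ler_wpM2l// (ltr0_norm wd) (ger0_norm w0) ler0_norm; lra.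
have D1le w : `|profile_d1 s w| <= K.
  rewrite normr_profile_d1 (le_trans (ler_norm _))// normrN.
  by have [_ _ []] := HK s `|w| es sS.
split.
- split.
  + have [+ _ _] := HK s `|z| es sS; rewrite -/(profile s z) => /le_trans; apply; lra.
  + by apply: (le_trans (D1le z)); lra.
  + by apply: (le_trans (D1K z)); exact: KS.
  + by apply: (le_trans (B2 _)); lra.
- move=> d; apply: (@le_trans _ _ (3 * K * `|d| ^+ 3)); last first.
    by rewrite ler_wpM2r ?exprn_ge0//; lra.
  have [z0|z0] := leP 0 z; first exact: T3.
  have := T3 (- z) (- d); rewrite -opprD !profileN profile_d1N profile_d2N mulrNN.
  by rewrite normrN sqrrN; apply; rewrite oppr_ge0 ltW.
- move=> d d'.
  (* Expand around [z + d], then move the derivative back to [z] by its Lipschitz bound [L]. *)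
  have -> : profile s (z + d') - profile s (z + d) - profile_d1 s z * (d' - d) =
    (profile s ((z + d) + (d' - d)) - profile s (z + d)
      - profile_d1 s (z + d) * (d' - d))
    + (profile_d1 s (z + d) - profile_d1 s z) * (d' - d).
    by rewrite (_ : z + d + (d' - d) = z + d'); ring.
  apply: (le_trans (ler_normD _ _)); rewrite normrM.
  apply: (@le_trans _ _ (3 * K * `|d' - d| ^+ 2 + K * `|d| * `|d' - d|)).
    by apply: lerD; [exact: T2|rewrite ler_wpM2r].
  have -> : 4 * K * (`|d' - d| * (`|d| + `|d'|)) =
    `|d' - d| * K * (4 * (`|d| + `|d'|)) by ring.
  have -> : 3 * K * `|d' - d| ^+ 2 + K * `|d| * `|d' - d| =
    `|d' - d| * K * (3 * `|d' - d| + `|d|) by ring.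
  rewrite ler_wpM2l ?mulr_ge0//; have := ler_normB d' d.
  by have := normr_ge0 d'; lra.
- move=> h h0 shS; rewrite normr_profile_d1 mulrN /profile /profile_d2.
  rewrite -/(radial_dt b s `|z|); pose r := `|z|; rewrite -/r.
  have Dt u : s <= u -> is_derive u (1 : R) (fun u => radial b u r) (radial_dt b u r).
    by move=> su; have [] := radial_derive b r (lt_le_trans s0 su).
  have Dtt u : s <= u -> is_derive u (1 : R) (fun u => radial_dt b u r) (radial_dtt b u r).
    by move=> su; have [] := radial_derive b r (lt_le_trans s0 su).
  have L1 u : s <= u -> u <= s + h -> `|radial_dt b u r - radial_dt b s r| <= K * h.
    move=> su uh; apply: (@le_trans _ _ (K * (u - s))); last first.
      by rewrite ler_wpM2l//; lra.
    have dd x : s <= x <= u ->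
        is_derive x (1 : R) (fun v => radial_dt b v r) (radial_dtt b x r).
      by move=> /andP[/Dtt].
    have dK x : s <= x <= u -> `|radial_dtt b x r| <= K.
      move=> /andP[sx xu].
      by have [_ _ []] := HK x r (le_trans es sx) (le_trans (le_trans xu uh) shS).
    exact: (mean_value_bound dd dK su).
  pose G u := radial b u r - (u - s) * radial_dt b s r.
  have dG x : s <= x <= s + h ->
      is_derive x (1 : R) G (radial_dt b x r - radial_dt b s r).
    move=> /andP[/Dt dx _]; rewrite /G; apply: is_derive_eq.
    by rewrite /GRing.scale /=; ring.
  have dGK x : s <= x <= s + h -> `|radial_dt b x r - radial_dt b s r| <= K * h.
    by move=> /andP[sx xh]; exact: L1.
  have ssh : s <= s + h by rewrite lerDl.
  have := mean_value_bound dG dGK ssh.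
  rewrite /G subrr mul0r subr0 (_ : s + h - s = h); last by ring.
  rewrite addrAC => /le_trans; apply.
  by rewrite -mulrA -expr2; exact/KS/sqr_ge0.
Qed.

End profile.

(** * Monotonicity, positivity and concentration of the profile *)

Section concentration.
Context {R : realType}.
Notation phi := (@normal_pdf R 0 1).
Variable b : R.

Lemma profile_le s z z' : 0 < s -> `|z| <= `|z'| -> profile b s z' <= profile b s z.
Proof.
move=> s0 zz'; rewrite /profile.
have dd x : `|z| <= x <= `|z'| -> is_derive x (1 : R) (radial b s) (radial_d1 b s x).
  by move=> _; have [] := radial_derive b x s0.
have [||x] := @MVT_segment R (radial b s) (radial_d1 b s) `|z| `|z'| zz'.
- by move=> x; rewrite in_itv /= => /andP[/ltW zx /ltW xz']; apply: dd; rewrite zx.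
- by apply: derivable_within_continuous => x; rewrite in_itv /= => /dd[].
rewrite in_itv /= => /andP[zx _] H; rewrite -subr_le0 H.
rewrite mulr_le0_ge0 ?subr_ge0// /radial_d1 mulNr oppr_le0 mulr_ge0 ?normal_pdf_ge0//.
by rewrite divr_ge0 ?exprn_ge0 ?sqrtr_ge0// (le_trans _ zx).
Qed.

Lemma std_normal_pdf_le (x : R) : phi x <= normal_peak 1 * expR (2^-1 - x).
Proof.
rewrite std_normal_pdfE ler_wpM2l ?normal_peak_ge0// ler_expR.
by have := sqr_ge0 (x - 1); rewrite !expr2; lra.
Qed.

Lemma radial_le s r : 0 < s ->
  radial b s r <= (normal_peak 1 / Num.sqrt s + `|b|) * expR (2^-1 - radial_arg b s r).
Proof.
move=> s0; have q0 : 0 < (Num.sqrt s)^-1 by rewrite invr_gt0 sqrtr_gt0.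
rewrite /radial mulrDl; apply: lerD.
  by rewrite mulrAC ler_wpM2r ?std_normal_pdf_le// ltW.
apply: (@le_trans _ _ (`|b| * gauss_tail (radial_arg b s r))).
  by rewrite ler_wpM2r ?gauss_tail_ge0// ler_norm.
by rewrite ler_wpM2l// gauss_tail_le_expR.
Qed.

Lemma radial_ge s r : 0 < s -> - `|b| * expR (2^-1 - radial_arg b s r) <= radial b s r.
Proof.
move=> s0; have q0 : 0 < (Num.sqrt s)^-1 by rewrite invr_gt0 sqrtr_gt0.
apply: (@le_trans _ _ (- `|b| * gauss_tail (radial_arg b s r))).
  by rewrite !mulNr lerN2 ler_wpM2l// gauss_tail_le_expR.
rewrite /radial -[leLHS]add0r lerD ?divr_ge0 ?normal_pdf_ge0 ?sqrtr_ge0//.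
by rewrite ler_wpM2r ?gauss_tail_ge0// lerNl -normrN ler_norm.
Qed.

(** For [b < 0] the two terms of [radial] have opposite signs. The profile decreases in [|z|],
    however, and its lower bound [radial_ge] tends to 0 at infinity; [r] is chosen so far out that
    this bound is at least [- e]. *)
Lemma profile_ge0 s z : 0 < s -> 0 <= profile b s z.
Proof.
move=> s0; apply/ler_addgt0Pr => e e0.
have q0 : 0 < Num.sqrt s by rewrite sqrtr_gt0.
pose L := `|b| + 1.
have L0 : 0 < L by rewrite /L; have := normr_ge0 b; lra.
pose X := 2^-1 - ln (e / L).
pose r := Num.max `|z| (Num.sqrt s * (X + b * Num.sqrt s)).
have r0 : 0 <= r by rewrite le_max normr_ge0.
have : profile b s r <= profile b s z.
  by apply: profile_le => //; rewrite (ger0_norm r0) le_max lexx.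
rewrite {1}/profile (ger0_norm r0).
have := radial_ge r s0.
have : - `|b| * expR (2^-1 - radial_arg b s r) >= - e.
  rewrite mulNr lerN2.
  have : expR (2^-1 - radial_arg b s r) <= e / L.
    rewrite -ler_ln ?posrE ?expR_gt0 ?divr_gt0// expRK.
    have : Num.sqrt s * (X + b * Num.sqrt s) <= r by rewrite le_max lexx orbT.
    rewrite -ler_pdivlMl// /radial_arg mulrC /X; lra.
  move=> /(ler_wpM2l (normr_ge0 b)) /le_trans; apply.
  rewrite mulrA ler_pdivrMr// mulrC ler_pM2l// /L; lra.
lra.
Qed.

(** Time [s^2] is the diffusive scale of the distance [s]: up to there the profile has height of
    order [1 / s], while at [rho] it is of order at most [exp(- rho / s) / s]. The left-hand side
    bounds a product of [d + 1] profiles outside the box of radius [rho]; the right-hand side is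
    [del] times a lower bound of its integral over the box of radius [s]. *)
Lemma profile_concentration (d : nat) (rho del : R) : 0 < rho -> 0 < del ->
  exists s : R, [/\ 0 < s, s <= rho, 0 < profile b (s ^+ 2) s &
    profile b (s ^+ 2) 0 ^+ d * profile b (s ^+ 2) rho <
    del * (2 * s * profile b (s ^+ 2) s) ^+ d.+1].
Proof.
move=> rho0 del0.
set p := @normal_peak R 1.
have p0 : 0 < p by apply: normal_peak_gt0; rewrite oner_neq0.
(* [phi >= c] on [[-2, 2]], which contains [1 - b s] once [|b s| < 1]. *)
pose c := p * expR (- 2).
have c0 : 0 < c by rewrite mulr_gt0// expR_gt0.
pose C := p + `|b|.
have C0 : 0 < C by rewrite ltr_wpDr.
(* From [exp(- x) <= (n / x)^n] with [n = d + 2] and [x = rho / s]: of the [d + 2] powers of [s],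
   all but one cancel against [(C / s)^(d + 1)], which leaves [K s]. *)
pose K := C ^+ d.+1 * expR (2^-1 + `|b|) * (d.+2%:R / rho) ^+ d.+2.
have K0 : 0 < K.
  by apply: mulr_gt0; [apply: mulr_gt0; [exact: exprn_gt0|exact: expR_gt0]|
    exact/exprn_gt0/divr_gt0].
have b0 := normr_ge0 b.
(* With [s = 1 / L] the summands yield in turn [s < 1], [|b| s < 1], [s <= rho], [|b| <= c / (2 s)]
   and [K s < del c^(d + 1)]. *)
pose L := 1 + `|b| + rho^-1 + 2 * `|b| / c + K / (del * c ^+ d.+1).
have h1 : 0 < rho^-1 by rewrite invr_gt0.
have h2 : 0 <= 2 * `|b| / c by rewrite divr_ge0 ?mulr_ge0// ltW.
have h3 : 0 < K / (del * c ^+ d.+1) by rewrite divr_gt0// mulr_gt0 ?exprn_gt0.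
have L0 : 0 < L by rewrite /L; lra.
have small u : 0 <= u -> u < L -> u * L^-1 < 1.
  by move=> u0 uL; rewrite ltr_pdivrMr// mul1r.
pose s := L^-1.
have s0 : 0 < s by rewrite invr_gt0.
have s1 : s < 1 by have := small 1 ler01; rewrite mul1r; apply; rewrite /L; lra.
have sb : `|b| * s < 1 by apply: small => //; rewrite /L; lra.
have srho : s <= rho.
  have : rho^-1 * s < 1 by apply: small; [exact: ltW|rewrite /L; lra].
  by rewrite mulrC ltr_pdivrMr// mul1r => /ltW.
have sc : `|b| <= c / 2 / s.
  have : 2 * `|b| / c * s < 1 by apply: small => //; rewrite /L; lra.
  rewrite ler_pdivlMr//.
  rewrite mulrAC ltr_pdivrMr// mul1r; lra.
have sK : K * s < del * c ^+ d.+1.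
  have : K / (del * c ^+ d.+1) * s < 1 by apply: small; [exact: ltW|rewrite /L; lra].
  by rewrite mulrAC ltr_pdivrMr ?mul1r// mulr_gt0 ?exprn_gt0.
clearbody s.
have sq : Num.sqrt (s ^+ 2) = s by rewrite sqrtr_sqr gtr0_norm.
have s20 : 0 < s ^+ 2 by rewrite exprn_gt0.
have bs : `|b * s| < 1 by rewrite normrM (gtr0_norm s0).
have low : c / 2 / s <= profile b (s ^+ 2) s.
  rewrite /profile (gtr0_norm s0) /radial /radial_arg sq divff ?gt_eqF//.
  have : c <= phi (1 - b * s).
    rewrite std_normal_pdfE /c -/p ler_pM2l// ler_expR.
    move: bs; rewrite ltr_norml; move: (b * s) => u /andP[u1 u2].
    rewrite lerN2 ler_pdivrMr// expr2; nra.
  rewrite -(ler_pM2r (_ : 0 < s^-1)) ?invr_gt0// => cphi.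
  have : - `|b| <= b * gauss_tail (1 - b * s).
    rewrite lerNl -mulNr (le_trans (ler_norm _))// normrM normrN ler_piMr//.
    by rewrite ger0_norm ?gauss_tail_ge0 ?gauss_tail_le1.
  have -> : c / 2 / s = c / s - c / 2 / s by field; rewrite gt_eqF.
  lra.
have low0 : 0 < profile b (s ^+ 2) s.
  by apply: lt_le_trans low; rewrite !divr_gt0.
have ps : p / s + `|b| <= C / s.
  rewrite /C mulrDl lerD2l ler_pdivlMr// ler_piMr// ltW//.
have up : profile b (s ^+ 2) 0 <= C / s.
  apply: le_trans ps; rewrite /profile normr0 /radial sq; apply: lerD.
    by rewrite ler_wpM2r ?invr_ge0 ?(ltW s0)//; apply: normal_pdf_ub; exact: oner_neq0.
  rewrite (le_trans (ler_norm _))// normrM ler_piMr//.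
  by rewrite ger0_norm ?gauss_tail_ge0 ?gauss_tail_le1.
have far : profile b (s ^+ 2) rho <= C / s * (expR (2^-1 + `|b|) * expR (- (rho / s))).
  rewrite /profile (gtr0_norm rho0); apply: (le_trans (radial_le _ s20)).
  rewrite sq -expRD; apply: ler_pM => //; last 1 first.
  - rewrite ler_expR /radial_arg sq.
    have : b * s <= `|b|.
      by rewrite (le_trans (ler_norm _))// normrM (gtr0_norm s0) ler_piMr// ltW.
    lra.
  - by rewrite addr_ge0// divr_ge0// ltW.
have expo : expR (- (rho / s)) <= (d.+2%:R / rho * s) ^+ d.+2.
  rewrite expRN invf_ple ?posrE ?expR_gt0 ?exprn_gt0 ?mulr_gt0 ?divr_gt0//.
  rewrite -exprVn (_ : (_ * _)^-1 = rho / s / d.+2%:R); last first.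
    by field; rewrite !gt_eqF.
  have -> : expR (rho / s) = expR (rho / s / d.+2%:R) ^+ d.+2.
    by rewrite -expRM_natl; congr expR; rewrite mulrCA divff ?mulr1 ?pnatr_eq0.
  apply: lerXn2r; rewrite ?nnegrE ?expR_ge0//.
    by rewrite !divr_ge0// ltW.
  by apply: le_trans (expR_ge1Dx _); rewrite lerDr.
exists s; split => //.
have F0 := profile_ge0 0 s20; have Fr := profile_ge0 rho s20.
apply: (@le_lt_trans _ _ ((C / s) ^+ d * (C / s * (expR (2^-1 + `|b|) * expR (- (rho / s)))))).
  apply: ler_pM => //; first exact: exprn_ge0.
  by rewrite lerXn2r// nnegrE// (le_trans F0).
apply: (@le_lt_trans _ _ (K * s)).
  rewrite mulrA -exprSr mulrA.
  apply: (@le_trans _ _ ((C / s) ^+ d.+1 * expR (2^-1 + `|b|) * (d.+2%:R / rho * s) ^+ d.+2)).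
    by rewrite ler_pM2l// mulr_gt0 ?exprn_gt0 ?expR_gt0// divr_gt0.
  rewrite /K exprMn [(_ * s) ^+ _]exprMn exprVn.
  rewrite [s ^+ d.+2]exprSr le_eqVlt; apply/orP; left; apply/eqP.
  by field; rewrite gt_eqF// exprn_gt0.
apply: (lt_le_trans sK); rewrite ler_pM2l//.
have h : c <= 2 * s * profile b (s ^+ 2) s.
  have -> : c = 2 * s * (c / 2 / s) by field; rewrite gt_eqF.
  by rewrite ler_pM2l// mulr_gt0.
by apply: lerXn2r => //; rewrite nnegrE; [exact: ltW|exact: le_trans (ltW c0) h].
Qed.

End concentration.

(** * Gaussian moments and one heat step *)

Section density.
Import HBNNSimple.
Context dT (T : measurableType dT) (R : realType).
Variables (mu nu : {measure set T -> \bar R}) (p : T -> R).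
Hypothesis p0 : forall x, 0 <= p x.
Hypothesis mp : measurable_fun setT p.
Hypothesis nuE : forall A, measurable A -> nu A = (\int[mu]_(x in A) (p x)%:E)%E.
Local Open Scope ereal_scope.

Let mpE : measurable_fun setT (EFin \o p). Proof. exact/measurable_EFinP. Qed.

Let integral_density_indic A : measurable A ->
  \int[nu]_x (\1_A x)%:E = \int[mu]_x ((\1_A x)%:E * (p x)%:E).
Proof.
move=> mA; rewrite integral_indic// setIT nuE// integral_mkcond.
by apply: eq_integral => x _; rewrite epatch_indic /= muleC.
Qed.

Let integral_density_nnsfun (f : {nnsfun T >-> R}) :
  \int[nu]_x (f x)%:E = \int[mu]_x ((f x)%:E * (p x)%:E).
Proof.
under [LHS]eq_integral do rewrite fimfunE -fsumEFin//.
rewrite [LHS]ge0_integral_fsum//; last 2 first.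
  - by move=> r; exact/measurable_EFinP/measurableT_comp.
  - by move=> n x _; rewrite EFinM nnfun_muleindic_ge0.
under [RHS]eq_integral.
  move=> x xD; rewrite fimfunE -fsumEFin// muleC ge0_mule_fsumr; last first.
    by move=> r; rewrite EFinM nnfun_muleindic_ge0.
  over.
rewrite [RHS]ge0_integral_fsum//; last 2 first.
  - move=> r; apply: emeasurable_funM => //.
    by apply/measurable_EFinP; do 2 apply/measurableT_comp => //.
  - by move=> n x _; apply: mule_ge0; [by rewrite lee_fin|by rewrite EFinM nnfun_muleindic_ge0].
apply: eq_fsbigr => r _.
have [r0|r0] := leP 0%R r; last first.
  by rewrite !integral0_eq// => x _; rewrite preimage_nnfun0// indic0 mulr0 ?mule0.
under eq_integral do rewrite EFinM.
have mi : measurable_fun setT (fun x => (\1_(f @^-1` [set r]) x : R)%:E).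
  by apply/measurable_EFinP; exact: measurable_indic.
rewrite ge0_integralZl//.
rewrite integral_density_indic//.
rewrite -ge0_integralZl//; last 2 first.
  - exact: emeasurable_funM.
  - by move=> x _; rewrite mule_ge0 ?lee_fin.
by apply: eq_integral => x _; rewrite -!EFinM; congr EFin; ring.
Qed.

Lemma ge0_integral_density (g : T -> \bar R) : measurable_fun setT g ->
  (forall x, 0 <= g x) -> \int[nu]_x g x = \int[mu]_x (g x * (p x)%:E).
Proof.
move=> mg g0; pose g_ := nnsfun_approx measurableT mg.
transitivity (limn (fun n => \int[nu]_x (g_ n x)%:E)).
  rewrite -monotone_convergence//=.
  - apply: eq_integral => x /[!inE] xD; apply/esym/cvg_lim => //=.
    exact: cvg_nnsfun_approx.
  - by move=> n; exact/measurable_EFinP/measurable_funTS.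
  - by move=> n x _; rewrite lee_fin.
  - by move=> x _ m n mn; rewrite lee_fin; exact/lefP/nd_nnsfun_approx.
under eq_fun do rewrite integral_density_nnsfun.
rewrite -monotone_convergence//=.
- apply: eq_integral => x _; apply/cvg_lim => //=.
  by apply: cvgeZr => //; exact: cvg_nnsfun_approx.
- by move=> n; apply: emeasurable_funM => //; exact/measurable_EFinP/measurable_funTS.
- by move=> n x _; rewrite mule_ge0// lee_fin.
- move=> x _ m n mn; rewrite lee_wpmul2r ?lee_fin//.
  exact/lefP/nd_nnsfun_approx.
Qed.
End density.

Lemma probability_integrable dT (T : measurableType dT) (R : realType)
    (P : probability T R) (f : T -> R) (K : R) :
  measurable_fun setT f -> (forall x, `|f x| <= K) ->
  P.-integrable setT (EFin \o f).
Proof.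
move=> mf fK; apply: (@le_integrable _ _ _ P setT _ _ (EFin \o cst K)) => //.
- exact/measurable_EFinP.
- by move=> x _; rewrite /= lee_fin (le_trans (fK x))// ler_norm.
- exact: finite_measure_integrable_cst.
Qed.

Lemma expR_taylor1 {R : realType} (x : R) :
  `|expR x - 1 - x| <= expR `|x| * `|x| ^+ 2.
Proof.
have dE (u : R) : is_derive u (1 : R) expR (expR u) by exact: is_derive_expR.
have := @taylor1 _ expR expR expR (expR `|x|) 0 x dE dE.
rewrite !add0r expR0 mul1r; apply => u ux.
by rewrite add0r ger0_norm ?expR_ge0// ler_expR (le_trans (ler_norm _)).
Qed.

Lemma expR_taylor2 {R : realType} (x : R) :
  `|expR x - 1 - x - 2^-1 * x ^+ 2| <= expR `|x| * `|x| ^+ 3.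
Proof.
have dE (u : R) : is_derive u (1 : R) expR (expR u) by exact: is_derive_expR.
have := @taylor2 _ expR expR expR expR (expR `|x|) 0 x dE dE dE.
rewrite !add0r expR0 mul1r mulr1; apply => u ux.
by rewrite add0r ger0_norm ?expR_ge0// ler_expR (le_trans (ler_norm _)).
Qed.

Lemma Rintegral_prob_cst dT (T : measurableType dT) (R : realType)
    (P : probability T R) (k : R) : \int[P]_x k = k.
Proof. by rewrite Rintegral_cst//= probability_setT mulr1. Qed.

Lemma normr_Rintegral_le dT (T : measurableType dT) (R : realType)
    (P : probability T R) (f : T -> R) (K : R) :
  measurable_fun setT f -> (forall x, `|f x| <= K) -> `|\int[P]_x f x| <= K.
Proof.
move=> mf fK; have iF := probability_integrable P mf fK.
apply: (le_trans (le_normr_Rintegral measurableT iF)).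
rewrite -[leRHS](Rintegral_prob_cst P); apply: le_Rintegral => //.
- exact: (integrable_abse iF).
- exact: finite_measure_integrable_cst.
Qed.

(** * Moments of the normal law *)

Section normal_moments.
Context {R : realType}.
Variable s : R.
Hypothesis s0 : 0 < s.
Notation mu := (@lebesgue_measure R).
Notation gam := (@normal_prob R 0 s).

Let sN0 : s != 0. Proof. by rewrite gt_eqF. Qed.

Lemma ge0_integral_normal (g : R -> \bar R) : measurable_fun setT g ->
  (forall x, 0 <= g x)%E ->
  (\int[gam]_x g x = \int[mu]_x (g x * (normal_pdf 0 s x)%:E))%E.
Proof.
move=> mg g0; apply: (@ge0_integral_density _ _ _ mu gam (normal_pdf 0 s)) => //.
- by move=> x; exact: normal_pdf_ge0.
- exact: measurable_normal_pdf.
Qed.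

Lemma integral_scaled_pdf (c m t : R) : 0 <= c ->
  (\int[mu]_x (c * normal_pdf m t x)%:E = c%:E)%E.
Proof.
move=> c0; under eq_integral do rewrite EFinM.
have mf : measurable_fun setT (fun x => (normal_pdf m t x)%:E).
  by apply/measurable_EFinP; exact: measurable_normal_pdf.
have pdf0 x : setT x -> (0 <= (normal_pdf m t x)%:E)%E by rewrite lee_fin normal_pdf_ge0.
have := @ge0_integralZl _ _ _ mu setT measurableT _ mf c%:E pdf0.
rewrite lee_fin => /(_ c0) /= ->.
by rewrite integral_normal_pdf mule1.
Qed.

Lemma measurable_expR_comp (f : R -> R) : measurable_fun setT f ->
  measurable_fun setT (fun x => (expR (f x))%:E).
Proof. by move=> mf; apply/measurable_EFinP; apply: measurableT_comp. Qed.

Lemma normal_mgf (l : R) :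
  (\int[gam]_x (expR (l * x))%:E = (expR (l ^+ 2 * s ^+ 2 / 2))%:E)%E.
Proof.
rewrite ge0_integral_normal; last 2 first.
- exact: measurable_expR_comp.
- by move=> x; rewrite lee_fin expR_ge0.
transitivity (\int[mu]_x (expR (l ^+ 2 * s ^+ 2 / 2) * normal_pdf (l * s ^+ 2) s x)%:E)%E;
  last by rewrite integral_scaled_pdf ?expR_ge0.
apply: eq_integral => x _; rewrite -!EFinM; congr EFin.
rewrite !normal_pdfE// /normal_fun mulrCA [RHS]mulrCA; congr *%R.
rewrite -!expRD; congr expR; rewrite subr0 -[s ^+ 2 *+ 2]mulr_natr; field.
by rewrite sN0.
Qed.

(** This exponential turns the normal density of variance [s^2] into [sqrt 2] times that of variance
    [2 s^2]. It thus has finite mean and dominates every polynomial and exponential used below. *)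
Lemma normal_expR_sqr :
  (\int[gam]_x (expR (x ^+ 2 / (4 * s ^+ 2)))%:E = (Num.sqrt 2)%:E)%E.
Proof.
have q0 : 0 < Num.sqrt (2 : R) by rewrite sqrtr_gt0.
have q2 : Num.sqrt (2 : R) ^+ 2 = 2 by rewrite sqr_sqrtr.
have t0 : Num.sqrt 2 * s != 0 by rewrite mulf_neq0// gt_eqF.
rewrite ge0_integral_normal; last 2 first.
- by apply: measurable_expR_comp; apply: measurable_funM => //; exact: measurable_funX.
- by move=> x; rewrite lee_fin expR_ge0.
transitivity (\int[mu]_x (Num.sqrt 2 * normal_pdf 0 (Num.sqrt 2 * s) x)%:E)%E;
  last by rewrite integral_scaled_pdf ?sqrtr_ge0.
apply: eq_integral => x _; rewrite -!EFinM; congr EFin.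
rewrite !normal_pdfE// /normal_fun mulrCA [RHS]mulrA; congr (_ * _).
  rewrite /normal_peak exprMn q2.
  have -> : 2 * s ^+ 2 * pi *+ 2 = 2 * (s ^+ 2 * pi *+ 2) by ring.
  by rewrite sqrtrM// invfM mulrA divff ?mul1r// gt_eqF.
rewrite -!expRD; congr expR; rewrite exprMn q2 subr0.
rewrite -[s ^+ 2 *+ 2]mulr_natr -[(2 * s ^+ 2) *+ 2]mulr_natr; field.
by rewrite sN0.
Qed.

Lemma integrable_normal_dominated (f : R -> R) (K : R) : measurable_fun setT f ->
  (forall x, `|f x| <= K * expR (x ^+ 2 / (4 * s ^+ 2))) ->
  gam.-integrable setT (EFin \o f) /\ \int[gam]_x `|f x| <= 2 * K.
Proof.
move=> mf fK.
have K0 : 0 <= K.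
  by have := le_trans (normr_ge0 _) (fK 0); rewrite pmulr_lge0 ?expR_gt0.
have q2 : Num.sqrt (2 : R) <= 2.
  rewrite -[leRHS](_ : Num.sqrt (2 ^+ 2) = _); last by rewrite sqrtr_sqr ger0_norm.
  by rewrite ler_wsqrtr// expr2; lra.
have le2K : (\int[gam]_x `|(EFin \o f) x| <= (2 * K)%:E)%E.
  apply: (@le_trans _ _ (\int[gam]_x (K%:E * (expR (x ^+ 2 / (4 * s ^+ 2)))%:E))%E).
    apply: ge0_le_integral => //.
    - by apply: measurableT_comp => //; exact/measurable_EFinP.
    - apply: emeasurable_funM => //; apply: measurable_expR_comp.
      by apply: measurable_funM => //; exact: measurable_funX.
    - by move=> x _; rewrite /= lee_fin.
  rewrite ge0_integralZl//; last 1 first.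
  - apply: measurable_expR_comp.
    by apply: measurable_funM => //; exact: measurable_funX.
  by rewrite normal_expR_sqr -EFinM lee_fin mulrC ler_wpM2r.
split.
  apply/integrableP; split; first exact/measurable_EFinP.
  exact: le_lt_trans le2K (ltry _).
rewrite /Rintegral -[leRHS]/(fine (2 * K)%:E); apply: fine_le => //.
have := le_lt_trans le2K (ltry _); rewrite -ge0_fin_numE//.
by apply: integral_ge0.
Qed.

(** With [u = |x| / s], [64 exp(u^2 / 4) >= 64 (1 + u^2 / 8)^2 = (8 + u^2)^2], which exceeds [u],
    [u^2] and [u^3]. *)
Let dom k (x : R) : (1 <= k <= 3)%N ->
  `|x| ^+ k <= 64 * s ^+ k * expR (x ^+ 2 / (4 * s ^+ 2)).
Proof.
move=> k3; pose u := `|x| / s.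
have u0 : 0 <= u by rewrite divr_ge0// ltW.
have xE : `|x| = s * u by rewrite /u mulrCA divff// mulr1.
have -> : x ^+ 2 / (4 * s ^+ 2) = 2%:R * (u ^+ 2 / 8).
  rewrite -(real_normK (num_real x)) xE; field.
  by rewrite sN0.
rewrite xE expRM_natl exprMn mulrAC mulrC ler_wpM2r ?exprn_ge0 ?(ltW s0)//.
apply: (@le_trans _ _ (64 * (1 + u ^+ 2 / 8) ^+ 2)); last first.
  rewrite ler_pM2l//; apply: lerXn2r; rewrite ?nnegrE ?expR_ge0 ?expR_ge1Dx//.
  by rewrite addr_ge0// divr_ge0// sqr_ge0.
have h1 : 0 <= u ^+ 2 by exact: sqr_ge0.
have h2 : 0 <= u ^+ 2 * u ^+ 2 by exact: mulr_ge0.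
have h3 : 0 <= u ^+ 2 * (u - 1) ^+ 2 by rewrite mulr_ge0// sqr_ge0.
have h4 : 0 <= (u - 1) ^+ 2 by exact: sqr_ge0.
rewrite !expr2 in h1 h2 h3 h4 *.
move: k3; case: k => [//|[|[|[|//]]]] _; rewrite ?expr1 ?exprS ?expr0; lra.
Qed.

Let integrable_normrX k : (1 <= k <= 3)%N ->
  gam.-integrable setT (EFin \o (fun x => `|x| ^+ k)) /\
  \int[gam]_x `|x| ^+ k <= 128 * s ^+ k.
Proof.
move=> k3; have := @integrable_normal_dominated (fun x => `|x| ^+ k) (64 * s ^+ k).
have -> : 2 * (64 * s ^+ k) = 128 * s ^+ k by rewrite mulrA; congr (_ * _); lra.
under eq_Rintegral do rewrite ger0_norm ?exprn_ge0//.
apply.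
- by apply: measurable_funX; exact: normr_measurable.
- by move=> x; rewrite ger0_norm ?exprn_ge0// dom.
Qed.

Lemma integrable_normal_id : gam.-integrable setT (EFin \o id).
Proof.
have [||+ _] := @integrable_normal_dominated id (64 * s ^+ 1).
- exact: measurable_id.
- by move=> x; rewrite -[leLHS]expr1 dom.
- exact.
Qed.

Lemma integrable_normal_sqr : gam.-integrable setT (EFin \o (fun x => x ^+ 2)).
Proof.
have [||+ _] := @integrable_normal_dominated (fun x => x ^+ 2) (64 * s ^+ 2).
- exact: measurable_funX.
- by move=> x; rewrite normrX dom.
- exact.
Qed.

Lemma normal_abs_moments :
  [/\ gam.-integrable setT (EFin \o (fun x => `|x|)),
      gam.-integrable setT (EFin \o (fun x => `|x| ^+ 3)),
      \int[gam]_x `|x| <= 128 * s &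
      \int[gam]_x `|x| ^+ 3 <= 128 * s ^+ 3].
Proof.
have [i1 e1] := @integrable_normrX 1 isT; have [i3 e3] := @integrable_normrX 3 isT.
by split.
Qed.

Let int1 : gam.-integrable setT (EFin \o (fun=> 1 : R)).
Proof. exact: finite_measure_integrable_cst. Qed.

(* Expanding [E expR (l * g)] at [l = 0] reads off the first two moments, without
   integrating by parts. *)
Let mgf_expansion : exists C : R, forall l, `|l| <= 1 ->
  `|l * (\int[gam]_x x) + 2^-1 * l ^+ 2 * (\int[gam]_x x ^+ 2 - s ^+ 2)| <= C * `|l| ^+ 3.
Proof.
pose m1 := \int[gam]_x x; pose m2 := \int[gam]_x x ^+ 2; rewrite -/m1 -/m2.
(* [A] combines [|x|^3 <= 6 exp |x|] with [2 |x| <= x^2 / (4 s^2) + 4 s^2]. [B] bounds the quadratic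
   remainder of [expR] at [l^2 s^2 / 2], of order [l^4], hence at most [|l|^3] up to a constant. *)
pose A := 6 * expR (4 * s ^+ 2).
pose B := expR (2^-1 * s ^+ 2) * (2^-1 * s ^+ 2) ^+ 2.
exists (2 * A + B) => l l1.
have absx (x : R) : 2 * `|x| <= x ^+ 2 / (4 * s ^+ 2) + 4 * s ^+ 2.
  have : 0 <= (`|x| / (2 * s) - 2 * s) ^+ 2 by exact: sqr_ge0.
  rewrite -[x ^+ 2](real_normK (num_real x)).
  by rewrite (_ : _ ^+ 2 = `|x| ^+ 2 / (4 * s ^+ 2) + 4 * s ^+ 2 - 2 * `|x|);
    [lra|field; rewrite sN0].
have lx (x : R) : `|l * x| <= `|x| by rewrite normrM ler_piMl.
have iE : gam.-integrable setT (EFin \o (fun x => expR (l * x))).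
  have [||+ _] := @integrable_normal_dominated (fun x => expR (l * x)) (expR (4 * s ^+ 2)).
  - by apply: measurableT_comp => //; exact: measurable_funM.
  - move=> x; rewrite ger0_norm ?expR_ge0// -expRD ler_expR addrC.
    apply: le_trans (absx x); have := lx x; have := ler_norm (l * x).
    by have := normr_ge0 x; lra.
  - exact.
pose rem x := expR (l * x) - 1 - l * x - 2^-1 * l ^+ 2 * x ^+ 2.
have mrem : measurable_fun setT rem.
  apply: measurable_funB; last by apply: measurable_funM => //; exact: measurable_funX.
  apply: measurable_funB; last exact: measurable_funM.
  apply: measurable_funB => //.
  by apply: measurableT_comp => //; exact: measurable_funM.
have remA x : `|rem x| <= A * `|l| ^+ 3 * expR (x ^+ 2 / (4 * s ^+ 2)).
  have := expR_taylor2 (l * x).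
  rewrite exprMn mulrA -/(rem x) => /le_trans; apply.
  rewrite normrM exprMn mulrCA.
  rewrite [leRHS](_ : _ = `|l| ^+ 3 * (A * expR (x ^+ 2 / (4 * s ^+ 2)))); last by ring.
  rewrite ler_wpM2l ?exprn_ge0//.
  apply: (@le_trans _ _ (expR `|x| * (6 * expR `|x|))).
    rewrite ler_pM ?expR_ge0 ?exprn_ge0//.
      by rewrite ler_expR -normrM.
    have := @expR_ge1Dxn R `|x| 2 (normr_ge0 x).
    have -> : (3`!)%:R = 6 :> R by [].
    by rewrite -lerBrDl ler_pdivrMr//; lra.
  rewrite /A mulrCA -mulrA ler_pM2l// -!expRD ler_expR addrC.
  by have := absx x; lra.
have [iR leR] := integrable_normal_dominated mrem remA.
have ixl : gam.-integrable setT (EFin \o (fun x => l * x)).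
  exact: integrable_EFinZl integrable_normal_id.
have ix2 : gam.-integrable setT (EFin \o (fun x => 2^-1 * l ^+ 2 * x ^+ 2)).
  exact: integrable_EFinZl integrable_normal_sqr.
have iE1 : gam.-integrable setT (EFin \o (fun x => expR (l * x) - 1)).
  exact: (integrableB measurableT iE int1).
have iE2 : gam.-integrable setT (EFin \o (fun x => expR (l * x) - 1 - l * x)).
  exact: (integrableB measurableT iE1 ixl).
have remE : \int[gam]_x rem x = expR (l ^+ 2 * s ^+ 2 / 2) - 1 - l * m1 - 2^-1 * l ^+ 2 * m2.
  rewrite RintegralB// RintegralB// RintegralB//.
  rewrite RintegralZl//; last exact: integrable_normal_id.
  rewrite RintegralZl//; last exact: integrable_normal_sqr.
  rewrite Rintegral_cst// mul1r (_ : fine _ = 1); last first.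
    exact: (congr1 fine (probability_setT gam)).
  by rewrite {1}/Rintegral normal_mgf.
have h1 : `|\int[gam]_x rem x| <= 2 * A * `|l| ^+ 3.
  by apply: (le_trans (le_normr_Rintegral _ iR)) => //; rewrite -mulrA.
pose y := l ^+ 2 * s ^+ 2 / 2.
have l2 : l ^+ 2 <= 1 by rewrite -(real_normK (num_real l)) exprn_ile1.
have yE : `|y| = `|l| ^+ 2 * (2^-1 * s ^+ 2).
  have y0 : 0 <= y by rewrite divr_ge0// mulr_ge0// sqr_ge0.
  by rewrite (ger0_norm y0) (real_normK (num_real l)) /y; ring.
have h2 : `|expR y - 1 - y| <= B * `|l| ^+ 3.
  apply: (le_trans (expR_taylor1 y)).
  have s2 : 0 <= 2^-1 * s ^+ 2 by rewrite mulr_ge0 ?sqr_ge0.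
  rewrite [leRHS](_ : _ = expR (2^-1 * s ^+ 2) * (`|l| ^+ 3 * (2^-1 * s ^+ 2) ^+ 2));
    last by rewrite /B; ring.
  rewrite yE; apply: ler_pM; rewrite ?expR_ge0 ?sqr_ge0//.
    by rewrite ler_expR ler_piMl// exprn_ile1.
  by rewrite exprMn -exprM ler_wpM2r ?sqr_ge0// ler_wiXn2l.
have -> : l * m1 + 2^-1 * l ^+ 2 * (m2 - s ^+ 2) =
   (expR y - 1 - y) - \int[gam]_x rem x by rewrite remE /y; field.
by apply: (le_trans (ler_normB _ _)); rewrite mulrDl addrC lerD.
Qed.

Let eq0_le_lin (a C : R) : (forall l, 0 < l -> l <= 1 -> `|a| <= C * l) -> a = 0.
Proof.
move=> aC; apply/eqP; rewrite -normr_eq0 eq_le normr_ge0 andbT leNgt; apply/negP => a0.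
have C0 : 0 < C by apply: (lt_le_trans a0); have := aC 1; rewrite mulr1; apply.
have := aC (Num.min 1 (`|a| / (2 * C))).
rewrite lt_min ltr01 divr_gt0 ?mulr_gt0// ge_min lexx => /(_ isT isT).
apply/negP; rewrite -ltNge; apply: (@le_lt_trans _ _ (C * (`|a| / (2 * C)))).
  by rewrite ler_wpM2l ?(ltW C0)// ge_min lexx orbT.
rewrite (_ : C * (`|a| / (2 * C)) = `|a| / 2); last by field; rewrite gt_eqF.
by rewrite ltr_pdivrMr// mulr2n mulrDr mulr1 ltrDl.
Qed.

(** Comparing the expansion at [l] and [- l] isolates the even part, so the coefficient of [l^2]
    vanishes as [l -> 0]; then so does the coefficient of [l]. *)
Lemma normal_moments : \int[gam]_x x = 0 /\ \int[gam]_x x ^+ 2 = s ^+ 2.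
Proof.
have [C HC] := mgf_expansion.
move: HC; set m1 := \int[gam]_x x; set v := _ - s ^+ 2 => HC.
have Hpm l : 0 < l -> l <= 1 ->
    `|l * m1 + 2^-1 * l ^+ 2 * v| <= C * l ^+ 3 /\
    `|- l * m1 + 2^-1 * l ^+ 2 * v| <= C * l ^+ 3.
  move=> l0 l1; have := HC l; have := HC (- l).
  by rewrite normrN sqrrN (gtr0_norm l0) l1 => -> // ->.
clearbody m1.
have v0 : v = 0.
  apply: (@eq0_le_lin _ (2 * C)) => l l0 l1; have [h1 h2] := Hpm l l0 l1.
  rewrite -(ler_pM2l (_ : 0 < l ^+ 2)) ?exprn_gt0//.
  rewrite -[l ^+ 2 in leLHS]gtr0_norm ?exprn_gt0// -normrM.
  move: h1 h2; rewrite !expr2 !exprS expr0 !ler_norml; lra.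
have m0 : m1 = 0.
  apply: (@eq0_le_lin _ C) => l l0 l1; have [h1 _] := Hpm l l0 l1.
  rewrite v0 mulr0 addr0 in h1.
  apply: (@le_trans _ _ (C * l ^+ 2)).
    rewrite -(ler_pM2l l0) -{1}(gtr0_norm l0) -normrM (le_trans h1)//.
    by rewrite exprS mulrCA.
  have C0 : 0 <= C.
    by have := le_trans (normr_ge0 _) h1; rewrite pmulr_lge0// exprn_gt0.
  by rewrite ler_wpM2l// expr2 ler_piMl// ltW.
by split => //; apply/eqP; rewrite -subr_eq0; apply/eqP.
Qed.

End normal_moments.

(** * One Gaussian step with frozen bang-bang drift *)

Section heat_step.
Context {R : realType}.
Variable b : R.

Lemma measurable_profile s : 0 < s -> measurable_fun setT (profile b s).
Proof.
move=> s0; apply: (@measurableT_comp _ _ _ _ _ _ (radial b s)); last exact: normr_measurable.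
apply: continuous_measurable_fun => r.
have [[dr _] _ _ _ _] := radial_derive b r s0.
exact/differentiable_continuous/derivable1_diffP.
Qed.

Lemma measurable_profile_d1 s : measurable_fun setT (profile_d1 b s).
Proof.
apply: measurable_funM.
  by apply: measurableT_comp => //; exact: measurable_funM.
apply: (@measurableT_comp _ _ _ _ _ _ (normal_pdf 0 1)).
  exact: measurable_normal_pdf.
apply: measurable_funB => //; apply: measurable_funM => //.
Qed.

(** Expand at [(s, z)] in the displacement [a + g] and in the time [h]. The terms in [g] and in
    [g^2 - h] have mean zero, and [D a + h D2 / 2] is [h] times the time derivative, by the
    equation. What remains is of size [h^2 + h |g| + |g|^3], with mean of order [h^(3/2)]. *)
Lemma profile_heat_step (e S : R) : 0 < e -> exists2 K : R, 0 <= K &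
  forall s h z, e <= s -> 0 < h -> h <= 1 -> s + h <= S ->
  `|\int[normal_prob 0 (Num.sqrt h)]_g profile b s (z + b * h * sgn (- z) + g)
    - profile b (s + h) z| <= K * (h * Num.sqrt h).
Proof.
move=> e0; have [K K0 HK] := profile_estimates b S e0.
set A := `|b|; have A0 : 0 <= A by exact: normr_ge0.
(* The coefficients of [K h^2]: from the cubic remainder, from the expansion in time, and from the
   square of the drift. Below, [128] is the constant of the absolute moments and [512 = 4 * 128]. *)
pose c := 4 * A ^+ 3 + 1 + A ^+ 2 / 2.
have c0 : 0 <= c by rewrite /c; have := exprn_ge0 2 A0; have := exprn_ge0 3 A0; lra.
exists (K * (c + 128 * A + 512)); first (apply: mulr_ge0; [exact: K0|
  apply: addr_ge0; [apply: addr_ge0; [exact: c0|apply: mulr_ge0; [exact: ler0n|exact: A0]]|exact: ler0n]]).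
move=> s h z es h0 h1 shS.
have s0 : 0 < s by exact: lt_le_trans es.
have sS : s <= S by lra.
have [[FK DK _ D2K] HT _ HS] := HK s z es sS.
have {}HS := HS h (ltW h0) shS.
pose q := Num.sqrt h; rewrite -/q.
have q0 : 0 < q by rewrite sqrtr_gt0.
have q1 : q <= 1 by rewrite -[leRHS]sqrtr1 ler_wsqrtr.
have hq : h = q ^+ 2 by rewrite sqr_sqrtr// ltW.
pose gam := @normal_prob R 0 q.
rewrite -/gam.
have [m1 m2] := normal_moments q0.
have [i1 i3 e1 e3] := normal_abs_moments q0.
have ii := integrable_normal_id q0; have i2 := integrable_normal_sqr q0.
rewrite -/gam in m1 m2 i1 i3 e1 e3 ii i2.
pose a := b * h * sgn (- z); rewrite -/a.
have aA : `|a| <= A * h.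
  rewrite /a normrM normrM (gtr0_norm h0) /sgn; case: ifP => _.
    by rewrite normrN normr1 mulr1.
  by rewrite normr1 mulr1.
set D := profile_d1 b s z in DK HT HS; set D2 := profile_d2 b s z in D2K HT HS.
have Da : D * a = b * h * `|D|.
  by rewrite /a mulrCA -/D profile_d1_sgn.
set Fh := profile b (s + h) z in HS *.
clearbody D D2 Fh.
pose f g := profile b s (z + a + g).
have mf : measurable_fun setT f.
  apply: measurableT_comp; first exact: measurable_profile.
  exact: measurable_funD.
have fK g : `|f g| <= K by have [[]] := HK s (z + a + g) es sS.
have if_ : gam.-integrable setT (EFin \o f).
  exact: (@probability_integrable _ _ R (normal_prob 0 q) f K mf fK).
(* Subtracting the terms of mean zero does not change the integral of [f - Fh], but leaves an
   integrand that is pointwise small. *)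
pose Z g := f g - Fh - D * g - 2^-1 * D2 * (g ^+ 2 - h).
pose B (g : R) := K * c * h ^+ 2 + K * A * h * `|g| + 4 * K * `|g| ^+ 3.
have ZB g : `|Z g| <= B g.
  have -> : Z g = (profile b s (z + (a + g)) - profile b s z - D * (a + g)
        - 2^-1 * D2 * (a + g) ^+ 2)
      - (Fh - profile b s z - h * (2^-1 * D2 + b * `|D|))
      + (D2 * (a * g) + 2^-1 * D2 * a ^+ 2).
    rewrite /Z /f -(addrA z a g).
    rewrite (_ : h * (2^-1 * D2 + b * `|D|) = 2^-1 * h * D2 + D * a); last by rewrite Da; ring.
    by field.
  apply: (le_trans (ler_normD _ _)).
  apply: (le_trans (lerD (ler_normB _ _) (ler_normD _ _))).
  have t1 := HT (a + g).
  have t2 : `|a + g| ^+ 3 <= 4 * (`|a| ^+ 3 + `|g| ^+ 3).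
    have : `|a + g| ^+ 3 <= (`|a| + `|g|) ^+ 3.
      by rewrite lerXn2r ?nnegrE ?addr_ge0// ler_normD.
    move=> /le_trans; apply.
    have a0 := normr_ge0 a; have g0 := normr_ge0 g.
    move: `|a| `|g| a0 g0 => u v u0 v0.
    have : 0 <= (u + v) * (u - v) ^+ 2 by rewrite mulr_ge0 ?addr_ge0 ?sqr_ge0.
    by rewrite !exprS expr0; lra.
  have t3 : `|D2 * (a * g)| <= K * A * h * `|g|.
    rewrite normrM normrM [leRHS](_ : _ = K * (A * h * `|g|)); last by ring.
    have ag : `|a| * `|g| <= A * h * `|g| by rewrite ler_wpM2r.
    by apply: (ler_pM _ _ _ ag) => //; exact: mulr_ge0.
  have a2 : `|a| ^+ 2 <= A ^+ 2 * h ^+ 2.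
    by rewrite -exprMn lerXn2r ?nnegrE ?mulr_ge0// ltW.
  have a3 : `|a| ^+ 3 <= A ^+ 3 * h ^+ 2.
    apply: (@le_trans _ _ ((A * h) ^+ 3)).
      by rewrite lerXn2r ?nnegrE ?mulr_ge0// ltW.
    by rewrite exprMn ler_wpM2l ?exprn_ge0// ler_wiXn2l// ltW.
  have t4 : `|2^-1 * D2 * a ^+ 2| <= K * (A ^+ 2 / 2) * h ^+ 2.
    rewrite normrM normrM normrX (ger0_norm (_ : 0 <= 2^-1))//.
    rewrite [leRHS](_ : _ = 2^-1 * (K * (A ^+ 2 * h ^+ 2))); last by ring.
    by rewrite -mulrA ler_pM2l// ler_pM ?exprn_ge0.
  have t5 : K * `|a + g| ^+ 3 <= K * (4 * (A ^+ 3 * h ^+ 2 + `|g| ^+ 3)).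
    by rewrite ler_wpM2l// (le_trans t2)// ler_pM2l// lerD2r.
  have -> : B g = K * (4 * (A ^+ 3 * h ^+ 2 + `|g| ^+ 3)) + K * h ^+ 2 +
     (K * A * h * `|g| + K * (A ^+ 2 / 2) * h ^+ 2) by rewrite /B /c; ring.
  by rewrite !lerD// (le_trans t1).
have icst k : gam.-integrable setT (EFin \o (fun=> k : R)).
  exact: finite_measure_integrable_cst.
have iB1 : gam.-integrable setT (EFin \o (fun g => K * A * h * `|g|)).
  exact: integrable_EFinZl.
have iB3 : gam.-integrable setT (EFin \o (fun g => 4 * K * `|g| ^+ 3)).
  exact: integrable_EFinZl.
have iB2 : gam.-integrable setT (EFin \o (fun g => K * c * h ^+ 2 + K * A * h * `|g|)).
  exact: (integrableD measurableT (icst _) iB1).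
have iB : gam.-integrable setT (EFin \o B).
  exact: (integrableD measurableT iB2 iB3).
have iD : gam.-integrable setT (EFin \o (fun g => D * g)).
  exact: integrable_EFinZl.
have i2h : gam.-integrable setT (EFin \o (fun g => g ^+ 2 - h)).
  exact: (integrableB measurableT i2 (icst h)).
have iD2 : gam.-integrable setT (EFin \o (fun g => 2^-1 * D2 * (g ^+ 2 - h))).
  exact: integrable_EFinZl.
have iZ1 : gam.-integrable setT (EFin \o (fun g => f g - Fh)).
  exact: (integrableB measurableT if_ (icst _)).
have iZ2 : gam.-integrable setT (EFin \o (fun g => f g - Fh - D * g)).
  exact: (integrableB measurableT iZ1 iD).
have iZ : gam.-integrable setT (EFin \o Z).
  exact: (integrableB measurableT iZ2 iD2).
have intc k : \int[gam]_x k = k.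
  rewrite Rintegral_cst// (_ : fine _ = 1) ?mulr1//.
  exact: (congr1 fine (probability_setT gam)).
have -> : \int[gam]_g f g - Fh = \int[gam]_g Z g.
  rewrite RintegralB// RintegralB// RintegralB// !RintegralZl// RintegralB//.
  by rewrite m1 m2 !intc hq; ring.
apply: (@le_trans _ _ (\int[gam]_g B g)).
  apply: (le_trans (le_normr_Rintegral _ iZ)) => //.
  apply: le_Rintegral => //.
  by have := integrable_abse iZ.
rewrite RintegralD// RintegralD// !RintegralZl// intc.
have r1 : K * A * h * (\int[gam]_x `|x|) <= K * A * h * (128 * q).
  by rewrite ler_wpM2l// !mulr_ge0// ltW.
have r2 : 4 * K * (\int[gam]_x `|x| ^+ 3) <= 4 * K * (128 * q ^+ 3).
  by rewrite ler_wpM2l// !mulr_ge0.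
have r3 : K * c * h ^+ 2 <= K * c * (h * q).
  rewrite ler_wpM2l ?mulr_ge0// expr2 ler_pM2l// hq expr2 ler_piMr// ltW//.
rewrite [leRHS](_ : _ = K * c * (h * q) + K * A * h * (128 * q) + 4 * K * (128 * q ^+ 3)).
  by rewrite !lerD.
by rewrite hq; ring.
Qed.

End heat_step.

(** * The Euler scheme *)

Section independence.
Context dO (O : measurableType dO) dS (S : measurableType dS) (R : realType).
Variables (P : probability O R) (gam : probability S R).
Variables (G : set (set O)) (g : O -> S).
Hypotheses (GI : setI_closed G) (GT : G setT) (Gm : G `<=` measurable).
Hypothesis mg : measurable_fun setT g.
Hypothesis indep : forall A C, G A -> measurable C ->
  (P (A `&` g @^-1` C) = P A * gam C)%E.

Local Notation T := (g_sigma_algebraType G).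

(** The identity into the coarser measurable space generated by [G]: a function measurable on [T] is
    one that depends on the past only. *)
Let toT (o : O) : T := o.

Let measurable_toT : measurable_fun setT toT.
Proof. by apply: (@measurability _ _ O T setT toT G) => // _ [A GA <-]; rewrite setTI; exact: Gm. Qed.

HB.instance Definition _ := isMeasurableFun.Build _ _ _ _ toT measurable_toT.

Let toTR (o : O) : T * S := (toT o, g o).

Let measurable_toTR : measurable_fun setT toTR.
Proof. exact: measurable_fun_pair. Qed.

HB.instance Definition _ := isMeasurableFun.Build _ _ _ _ toTR measurable_toTR.

(** For fixed [C] both sides are finite measures in [A] that agree on the pi-system [G]. *)
Let indep_sub (A : set T) C : measurable A -> measurable C ->
  (P (A `&` g @^-1` C) = P A * gam C)%E.
Proof.
move=> mA mC.
have mgC : measurable (g @^-1` C) by rewrite -[X in measurable X]setTI; exact: mg.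
pose k := NngNum (fine_ge0 (measure_ge0 gam C)).
pose muC : {measure set O -> \bar R} := mrestr P mgC.
have kE : (k%:num%:E = gam C)%E by rewrite /= fineK// fin_num_measure.
rewrite muleC -kE.
apply: (@measure_unique _ R T G (fun=> setT) _ GI _ _
  (pushforward muC toT) (mscale k (distribution P toT)) _ _ A mA) => //.
- by rewrite bigcup_const.
- by move=> B GB; rewrite /= /mscale kE muleC; exact: indep.
- move=> _; rewrite (@le_lt_trans _ _ 1%E) ?ltry//.
  by rewrite /= /pushforward preimage_setT /mrestr setTI probability_le1.
Qed.

(** Independence makes the law of the pair (past, [g]) a product, and Fubini integrates over [g]
    first with the past frozen. This takes the place of conditional expectations. *)
Lemma integral_independent_le (Phi : T * S -> R) (B K : R) :
  measurable_fun setT Phi -> (forall u, `|Phi u| <= B) ->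
  (forall o, `|\int[gam]_y Phi (o, y)| <= K) ->
  `|\int[P]_o Phi (o, g o)| <= K.
Proof.
move=> mPhi PhiB PhiK.
pose m1 := distribution P toT.
have mT : ((m1 \x gam) setT = 1)%E.
  by rewrite -setXTT product_measure1E//= !probability_setT mule1.
have iPhi : (m1 \x gam)%E.-integrable setT (EFin \o Phi).
  apply/integrableP; split; first exact/measurable_EFinP.
  apply: (@le_lt_trans _ _ (\int[m1 \x gam]_x (cst B%:E) x)%E); last first.
    by rewrite integral_cst//= (_ : _ setT = 1%E) ?mule1 ?ltry.
  apply: ge0_le_integral => //.
  - by apply: measurableT_comp => //; exact/measurable_EFinP.
  - by move=> x _; rewrite /= lee_fin PhiB.
have E : (\int[P]_o (Phi (o, g o))%:E = \int[m1]_o \int[gam]_y (Phi (o, y))%:E)%E.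
  rewrite (integral12_prod_meas1 iPhi).
  transitivity (\int[distribution P toTR]_z (Phi z)%:E)%E.
    rewrite integral_distribution//; first exact/measurable_EFinP.
    apply: (probability_integrable _ (K := B)) => //.
    exact: measurableT_comp.
  apply: eq_measure_integral => A mA _; apply/esym.
  apply: product_measure_unique => //= A1 A2 mA1 mA2.
have iF : m1.-integrable setT (fun o => \int[gam]_y (Phi (o, y))%:E)%E.
  exact: (integrable_fubini_F iPhi).
have FK o : (\int[gam]_y (Phi (o, y))%:E = (\int[gam]_y Phi (o, y))%:E)%E.
  rewrite /Rintegral fineK//; apply: integrable_fin_num => //.
  apply: (probability_integrable gam (K := B)) => //.
  exact: (measurableT_comp mPhi (pair1_measurable _)).
rewrite /Rintegral E; under eq_integral do rewrite FK.
apply: normr_Rintegral_le => //.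
by apply/measurable_EFinP; apply: eq_measurable_fun (measurable_int _ iF) => o _; exact: FK.
Qed.

End independence.

Section products.
Context {R : realType}.

Lemma normr_prod_le (I : finType) (Q : pred I) (f : I -> R) (B : R) :
  1 <= B -> (forall i, Q i -> `|f i| <= B) -> `|\prod_(i | Q i) f i| <= B ^+ #|I|.
Proof.
move=> B1 fB; rewrite big_mkcond normr_prod -prodr_const.
apply: ler_prod => i _; rewrite normr_ge0 /=.
by case: ifPn => [/fB//|_]; rewrite normr1.
Qed.

(** Factors are exchanged one at a time, the others being at most [B]. The bound is one-sided on
    purpose: only the positive part of a drift error is to be paid for. *)
Lemma prod_perturb n (p q e : 'I_n -> R) (B : R) : 1 <= B ->
  (forall i, 0 <= p i) -> (forall i, p i <= B) ->
  (forall i, 0 <= q i) -> (forall i, q i <= B) ->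
  (forall i, 0 <= e i) -> (forall i, p i <= q i + e i) ->
  \prod_i p i <= \prod_i q i + B ^+ n * \sum_i e i.
Proof.
move=> B1; have B0 : 0 <= B by exact: le_trans B1.
elim: n p q e => [|n IH] p q e p0 pB q0 qB e0 pqe.
  by rewrite !big_ord0 mulr0 addr0.
rewrite !big_ord_recl.
set p' := \prod_(i < n) p _; set q' := \prod_(i < n) q _; set e' := \sum_(i < n) _.
have p'0 : 0 <= p' by exact: prodr_ge0.
have p'B : p' <= B ^+ n.
  by rewrite -[n in B ^+ n]card_ord -prodr_const; apply: ler_prod => i _; rewrite p0 pB.
have h : p' <= q' + B ^+ n * e' by apply: IH.
have e'0 : 0 <= e' by exact: sumr_ge0.
apply: (@le_trans _ _ ((q ord0 + e ord0) * p')); first by rewrite ler_wpM2r.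
rewrite mulrDl.
apply: (@le_trans _ _ (q ord0 * (q' + B ^+ n * e') + e ord0 * B ^+ n)).
  by apply: lerD; rewrite ler_wpM2l.
rewrite mulrDr -addrA lerD2l mulrDr addrC; apply: lerD.
  rewrite mulrC ler_wpM2r// exprS ler_peMl// exprn_ge0//.
by rewrite exprS mulrA ler_wpM2r// ler_wpM2r// exprn_ge0.
Qed.
End products.

Lemma measurable_bigprod dT (T : measurableType dT) (R : realType) (I : Type)
    (r : seq I) (Q : pred I) (f : I -> T -> R) :
  (forall i, Q i -> measurable_fun setT (f i)) ->
  measurable_fun setT (fun x => \prod_(i <- r | Q i) f i x).
Proof.
move=> mf; elim: r => [|i r IH].
  rewrite [X in measurable_fun _ X](_ : _ = cst 1); first exact: measurable_cst.
  by apply/funext => x; rewrite big_nil.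
rewrite [X in measurable_fun _ X](_ : _ = fun x => if Q i then
    f i x * \prod_(i <- r | Q i) f i x else \prod_(i <- r | Q i) f i x); last first.
  by apply/funext => x; rewrite big_cons.
have [Qi|_] := boolP (Q i); last exact: IH.
by apply: measurable_funM => //; exact: mf.
Qed.

(** * One Euler step for a product of profiles *)

Section euler_step.
Context dO (O : measurableType dO) (R : realType) (d : nat).
Variables (P : probability O R) (Fs : set_system O).
Variables (Z : 'I_d -> O -> R) (g : 'I_d -> O -> R) (h : R).
Hypotheses (FsI : setI_closed Fs) (FsT : Fs setT) (Fsm : Fs `<=` measurable).
Hypothesis h0 : 0 < h.
Hypothesis FZ : forall i B, measurable B -> Fs (Z i @^-1` B).
Hypothesis mg : forall i, measurable_fun setT (g i).
Hypothesis indep : forall A, Fs A -> forall B : 'I_d -> set R, (forall i, measurable (B i)) ->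
  (P (A `&` [set o | forall i, B i (g i o)]) =
   P A * \prod_(i < d) normal_prob 0 (Num.sqrt h) (B i))%E.
Variable b : R.

Definition euler_drift (z : R) : R := b * h * sgn (- z).

Lemma measurable_euler_drift : measurable_fun setT euler_drift.
Proof.
apply: measurable_funM => //; rewrite /sgn.
apply: measurable_fun_if => //.
by apply: measurable_fun_ler => //; exact: measurableT_comp.
Qed.

Section coordinate.
Variable j : 'I_d.

(** Generates the past [Fs] together with the increments of all coordinates other than [j]. These
    sets form a pi-system independent of [g j]. *)
Let G : set (set O) := [set E | exists A (B : 'I_d -> set R),
  [/\ Fs A, forall i, measurable (B i), B j = setT &
      E = A `&` [set o | forall i, B i (g i o)]]].

Let GI : setI_closed G.
Proof.
move=> _ _ [A [B [FA mB Bj ->]]] [A' [B' [FA' mB' Bj' ->]]].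
exists (A `&` A'), (fun i => B i `&` B' i); split.
- exact: FsI.
- by move=> i; exact: measurableI.
- by rewrite Bj Bj' setTI.
- apply/seteqP; split => o /=.
    by move=> [[Ao Bo] [A'o B'o]].
  by move=> [[Ao A'o] BB]; split; split => // i; have [] := BB i.
Qed.

Let GT : G setT.
Proof.
exists setT, (fun=> setT); split => //.
by apply/seteqP; split.
Qed.

Let Gm : G `<=` measurable.
Proof.
move=> _ [A [B [FA mB _ ->]]]; apply: measurableI; first exact: Fsm.
have -> : [set o | forall i, B i (g i o)] = \bigcap_(i in [set: 'I_d]) (g i @^-1` B i).
  by apply/seteqP; split => o /= Bo i => [_|]; [exact: Bo|exact: (Bo i I)].
apply: fin_bigcap_measurable => [|i _]; first exact: finite_finset.
by rewrite -[X in measurable X]setTI; exact: mg.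
Qed.

Let Gindep A C : G A -> measurable C ->
  (P (A `&` g j @^-1` C) = P A * normal_prob 0 (Num.sqrt h) C)%E.
Proof.
move=> [A' [B [FA mB Bj ->]]] mC.
pose B' i := if i == j then C else B i.
have -> : A' `&` [set o | forall i, B i (g i o)] `&` g j @^-1` C =
    A' `&` [set o | forall i, B' i (g i o)].
  apply/seteqP; split => o /=.
    by move=> [[Ao Bo] Co]; split => // i; rewrite /B'; case: eqVneq => [->|].
  move=> [Ao B'o]; split; last by have := B'o j; rewrite /B' eqxx.
  split => // i; have := B'o i; rewrite /B'; case: eqVneq => // -> _.
  by rewrite Bj.
rewrite !indep//; last by move=> i; rewrite /B'; case: ifP.
rewrite (bigD1 j)//= [in RHS](bigD1 j)//= {1}/B' eqxx Bj.
rewrite (probability_setT (normal_prob 0 (Num.sqrt h))) mul1e muleCA [RHS]muleC.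
congr (_ * (_ * _))%E; apply: eq_bigr => i ij.
by rewrite /B' (negbTE ij).
Qed.

Local Notation T := (g_sigma_algebraType G).

Let mZ i : measurable_fun setT (Z i : T -> R).
Proof.
move=> _ B mB; rewrite setTI; apply: sub_sigma_algebra.
exists (Z i @^-1` B), (fun=> setT); split => //; first exact: FZ.
by apply/seteqP; split => o //= [].
Qed.

Let mgi i : i != j -> measurable_fun setT (g i : T -> R).
Proof.
move=> ij _ B mB; rewrite setTI; apply: sub_sigma_algebra.
exists setT, (fun k => if k == i then B else setT); split => //.
- by move=> k; case: ifP.
- by rewrite eq_sym (negbTE ij).
- apply/seteqP; split => o /= => [Bo|[_ /(_ i)]]; last by rewrite eqxx.
  by split => // k; case: eqVneq => // ->.
Qed.

(** Given the past and the other increments, only [g j] is integrated: the difference in coordinate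
    [j] contributes at most [K], the remaining factors at most [B ^+ d]. [Q] marks the coordinates
    already advanced to [s + h]. *)
Lemma euler_step_coord (B K s : R) (Q : pred 'I_d) :
  1 <= B -> 0 < s -> 0 <= K ->
  (forall u z, s <= u -> u <= s + h -> `|profile b u z| <= B) ->
  (forall z, `|\int[normal_prob 0 (Num.sqrt h)]_y profile b s (z + euler_drift z + y)
    - profile b (s + h) z| <= K) ->
  `|\int[P]_o
     (\prod_(i | i != j) (if Q i then profile b (s + h) (Z i o)
                else profile b s (Z i o + euler_drift (Z i o) + g i o)) *
     (profile b s (Z j o + euler_drift (Z j o) + g j o) - profile b (s + h) (Z j o)))|
  <= B ^+ d * K.
Proof.
move=> B1 s0 K0 FB FK.
have ssh : s <= s + h by rewrite lerDl ltW.
have sh0 : 0 < s + h by exact: addr_gt0.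
have B0 : 0 <= B by exact: le_trans B1.
pose Psi (o : T) := \prod_(i | i != j) (if Q i then profile b (s + h) (Z i o)
                else profile b s (Z i o + euler_drift (Z i o) + g i o)).
have mdrift i : measurable_fun setT (fun o : T => Z i o + euler_drift (Z i o)).
  apply: measurable_funD => //.
  exact: (measurableT_comp measurable_euler_drift (mZ i)).
have mPsi : measurable_fun setT Psi.
  apply: measurable_bigprod => i ij; case: (Q i).
    exact: (measurableT_comp (measurable_profile b sh0) (mZ i)).
  apply: (measurableT_comp (measurable_profile b s0)).
  by apply: measurable_funD => //; exact: mgi.
have PsiB o : `|Psi o| <= B ^+ d.
  rewrite -[d in B ^+ d]card_ord; apply: normr_prod_le => // i _.
  by case: (Q i); apply: FB; rewrite ?lexx.
pose Phi (u : T * R) := Psi u.1 *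
  (profile b s (Z j u.1 + euler_drift (Z j u.1) + u.2) - profile b (s + h) (Z j u.1)).
have mPhi : measurable_fun setT Phi.
  apply: measurable_funM; first exact: (measurableT_comp mPsi measurable_fst).
  apply: measurable_funB.
    apply: (measurableT_comp (measurable_profile b s0)).
    apply: measurable_funD => //.
    exact: (measurableT_comp (mdrift j) measurable_fst).
  apply: (measurableT_comp (measurable_profile b sh0)).
  exact: (measurableT_comp (mZ j) measurable_fst).
have PhiB u : `|Phi u| <= B ^+ d * (B + B).
  rewrite /Phi normrM ler_pM// (le_trans (ler_normB _ _))// lerD//.
    by apply: FB; rewrite ?lexx.
  by apply: FB; rewrite ?lexx.
rewrite -[X in `|X|]/(\int[P]_o Phi (o, g j o)).
have key := (@integral_independent_le _ O _ _ R P (normal_prob 0 (Num.sqrt h)) G (g j)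
  GI GT Gm (mg j) Gindep Phi (B ^+ d * (B + B)) (B ^+ d * K) mPhi PhiB).
apply: key => o.
rewrite /Phi /=.
have mf : measurable_fun setT (fun y => profile b s (Z j o + euler_drift (Z j o) + y)).
  apply: (measurableT_comp (measurable_profile b s0)).
  exact: measurable_funD.
have i1 : (normal_prob 0 (Num.sqrt h)).-integrable setT
    (EFin \o (fun y => profile b s (Z j o + euler_drift (Z j o) + y))).
  apply: (@probability_integrable _ _ R (normal_prob 0 (Num.sqrt h)) _ B mf) => y.
  by apply: FB; rewrite ?lexx.
have i2 : (normal_prob 0 (Num.sqrt h)).-integrable setT
    (EFin \o (fun=> profile b (s + h) (Z j o))).
  exact: finite_measure_integrable_cst.
rewrite RintegralZl//; last exact: (integrableB measurableT i1 i2).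
rewrite RintegralB// (Rintegral_prob_cst (normal_prob 0 (Num.sqrt h))).
by rewrite normrM ler_pM.
Qed.

End coordinate.

(** Lindeberg exchange: [C k] has its first [k] factors at time [s + h] and the others at time [s],
    so that consecutive hybrids differ in one coordinate. *)
Lemma euler_step (B K s : R) :
  1 <= B -> 0 < s -> 0 <= K ->
  (forall u z, s <= u -> u <= s + h -> `|profile b u z| <= B) ->
  (forall z, `|\int[normal_prob 0 (Num.sqrt h)]_y profile b s (z + euler_drift z + y)
    - profile b (s + h) z| <= K) ->
  `|\int[P]_o (\prod_i profile b s (Z i o + euler_drift (Z i o) + g i o))
   - \int[P]_o (\prod_i profile b (s + h) (Z i o))| <= d%:R * (B ^+ d * K).
Proof.
move=> B1 s0 K0 FB FK.
have ssh : s <= s + h by rewrite lerDl ltW.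
have sh0 : 0 < s + h by exact: addr_gt0.
pose f k (i : 'I_d) o := if (i < k)%N then profile b (s + h) (Z i o)
  else profile b s (Z i o + euler_drift (Z i o) + g i o).
pose C k o := \prod_i f k i o.
have mZ i : measurable_fun setT (Z i).
  by move=> _ D mD; rewrite setTI; apply: Fsm; exact: FZ.
have mf k i : measurable_fun setT (f k i).
  rewrite /f; case: (i < k)%N.
    exact: (measurableT_comp (measurable_profile b sh0) (mZ i)).
  apply: (measurableT_comp (measurable_profile b s0)).
  apply: measurable_funD => //; apply: measurable_funD => //.
  exact: (measurableT_comp measurable_euler_drift (mZ i)).
have fB k i o : `|f k i o| <= B.
  by rewrite /f; case: ifP => _; apply: FB; rewrite ?lexx.
have iC k : P.-integrable setT (EFin \o C k).
  apply: (probability_integrable P (K := B ^+ d)).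
    by apply: measurable_bigprod => i _.
  by move=> o; rewrite -[d in B ^+ d]card_ord; apply: normr_prod_le.
suff H k : (k <= d)%N -> `|\int[P]_o C 0%N o - \int[P]_o C k o| <= k%:R * (B ^+ d * K).
  have := H d (leqnn d).
  have -> : C d = fun o => \prod_i profile b (s + h) (Z i o).
    by apply/funext => o; apply: eq_bigr => i _; rewrite /f ltn_ord.
  by [].
elim: k => [_|k IH kd]; first by rewrite subrr normr0 mul0r.
rewrite -[in leRHS]natr1 mulrDl mul1r.
rewrite -[X in `|X|](subrKA (\int[P]_o C k o)).
apply: (le_trans (ler_normD _ _)); apply: lerD; first exact: IH (ltnW kd).
pose j := Ordinal kd.
rewrite -RintegralB//.
have -> : (fun o => C k o - C k.+1 o) = fun o =>
   \prod_(i | i != j) (if (i < k)%N then profile b (s + h) (Z i o)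
                else profile b s (Z i o + euler_drift (Z i o) + g i o)) *
     (profile b s (Z j o + euler_drift (Z j o) + g j o) - profile b (s + h) (Z j o)).
  apply/funext => o; rewrite /C (bigD1 j)//= [in X in _ - X](bigD1 j)//=.
  rewrite {1}/f ltnn {2}/f ltnSn mulrC [X in _ - X]mulrC mulrBr; congr (_ * _ - _ * _).
  apply: eq_bigr => i ij; rewrite /f ltnS leq_eqVlt.
  by rewrite -(inj_eq val_inj) /= in ij; rewrite (negbTE ij).
exact: (@euler_step_coord j B K s (fun i => (i < k)%N)).
Qed.

End euler_step.

Lemma integrable_EFinD dT (T : measurableType dT) (R : realType)
    (mu : {measure set T -> \bar R}) (D : set T) (f1 f2 : T -> R) :
  measurable D -> mu.-integrable D (EFin \o f1) -> mu.-integrable D (EFin \o f2) ->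
  mu.-integrable D (EFin \o (fun x => f1 x + f2 x)).
Proof. by move=> mD i1 i2; exact: (integrableD mD i1 i2). Qed.

Lemma Rintegral_sum dT (T : measurableType dT) (R : realType)
    (mu : {measure set T -> \bar R}) (I : Type) (r : seq I) (f : I -> T -> R) :
  (forall i, mu.-integrable setT (EFin \o f i)) ->
  mu.-integrable setT (EFin \o (fun x => \sum_(i <- r) f i x)) /\
  \int[mu]_x (\sum_(i <- r) f i x) = \sum_(i <- r) \int[mu]_x f i x.
Proof.
move=> fi; elim: r => [|i r [IH1 IH2]].
  rewrite (_ : (fun x => _) = cst 0); last by apply/funext => x; rewrite big_nil.
  by rewrite big_nil /Rintegral integral0; split => //; exact: integrable0.
rewrite (_ : (fun x => \sum_(i <- i :: r) f i x) =
   fun x => f i x + \sum_(i <- r) f i x); last by apply/funext => x; rewrite big_cons.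
by split; [exact: integrable_EFinD|rewrite big_cons RintegralD// IH2].
Qed.

Lemma ge0_integral_law dO (O : measurableType dO) dS (S : measurableType dS)
    (R : realType) (P : {measure set O -> \bar R}) (gam : {measure set S -> \bar R})
    (g : O -> S) (f : S -> \bar R) :
  measurable_fun setT g ->
  (forall B, measurable B -> P (g @^-1` B) = gam B) ->
  measurable_fun setT f -> (forall x, 0 <= f x)%E ->
  (\int[P]_o f (g o) = \int[gam]_x f x)%E.
Proof.
move=> mg gE mf f0; transitivity (\int[pushforward P g]_x f x)%E.
  by rewrite ge0_integral_pushforward.
by apply: eq_measure_integral => A mA _; exact: gE.
Qed.

Lemma close_le {R : realType} (p q c r m : R) : `|p - q - c| <= r -> c <= m ->
  p <= q + (m + r).
Proof. by rewrite ler_norml => /andP[_ ?] ?; lra. Qed.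

Lemma close_ge {R : realType} (p q c r m : R) : `|p - q - c| <= r -> - c <= m ->
  q <= p + (m + r).
Proof. by rewrite ler_norml => /andP[? _] ?; lra. Qed.

(** * One step with the true drift *)

Section one_step.
Context dO (O : measurableType dO) (R : realType) (d : nat).
Variables (P : probability O R).

Lemma normal_increment_moment (g : O -> R) (q : R) : 0 < q ->
  measurable_fun setT g ->
  (forall B, measurable B -> P (g @^-1` B) = normal_prob 0 q B) ->
  P.-integrable setT (EFin \o (fun o => `|g o|)) /\ \int[P]_o `|g o| <= 128 * q.
Proof.
move=> q0 mg gE; have [i1 _ e1 _] := normal_abs_moments q0.
have E : (\int[P]_o (`|g o|)%:E = \int[normal_prob 0 q]_x (`|x|)%:E)%E.
  apply: (@ge0_integral_law _ O _ _ R P (normal_prob 0 q) g (fun x => (`|x|)%:E)) => //.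
  by apply/measurable_EFinP; exact: normr_measurable.
split; last by rewrite /Rintegral E.
apply/integrableP; split.
  by apply/measurable_EFinP; exact: measurableT_comp.
under eq_integral do rewrite /= normr_id.
rewrite E; move/integrableP : i1 => [_].
by under eq_integral do rewrite /= normr_id.
Qed.

Variables (b M : R).
Hypothesis bM : `|b| <= M.

Let M0 : 0 <= M. Proof. exact: le_trans bM. Qed.

Definition drift_gap (h s z a : R) : R := profile_d1 b s z * (a - euler_drift h b z).

Lemma one_step (e S : R) : 0 < e -> exists2 K : R, 0 <= K &
  forall (Fs : set_system O) (Z g a : 'I_d -> O -> R) (h s : R),
  setI_closed Fs -> Fs setT -> Fs `<=` measurable ->
  0 < h -> h <= 1 -> e <= s -> s + h <= S ->
  (forall i B, measurable B -> Fs (Z i @^-1` B)) ->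
  (forall i, measurable_fun setT (g i)) ->
  (forall A, Fs A -> forall B : 'I_d -> set R, (forall i, measurable (B i)) ->
    (P (A `&` [set o | forall i, B i (g i o)]) =
     P A * \prod_(i < d) normal_prob 0 (Num.sqrt h) (B i))%E) ->
  (forall i, measurable_fun setT (a i)) -> (forall i o, `|a i o| <= M * h) ->
  \int[P]_o (\prod_i profile b s (Z i o + a i o + g i o)) <=
  \int[P]_o (\prod_i profile b (s + h) (Z i o)) +
  K * (\sum_i \int[P]_o (Num.max 0 (drift_gap h s (Z i o) (a i o))) + h * Num.sqrt h) /\
  \int[P]_o (\prod_i profile b (s + h) (Z i o)) <=
  \int[P]_o (\prod_i profile b s (Z i o + a i o + g i o)) +
  K * (\sum_i \int[P]_o (Num.max 0 (- drift_gap h s (Z i o) (a i o))) + h * Num.sqrt h).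
Proof.
move=> e0.
have [K0 K00 HK0] := profile_estimates b S e0.
have [K1 K10 HK1] := profile_heat_step b S e0.
pose B := K0 + 1.
have B1 : 1 <= B by rewrite /B lerDr.
have B0 : 0 <= B by exact: le_trans B1.
have Bd : 0 <= B ^+ d by exact: exprn_ge0.
pose L := 4 * K0 * M * (M + 128).
have L0 : 0 <= L.
  by rewrite /L; apply: mulr_ge0; [rewrite !mulr_ge0|apply: addr_ge0 => //; exact: ler0n].
exists (B ^+ d * (1 + d%:R * L + d%:R * K1)).
  by apply: mulr_ge0 => //; rewrite !addr_ge0// mulr_ge0// ler0n.
move=> Fs Z g a h s FsI FsT Fsm h0 h1 es shS FZ mg indep ma aM.
pose q := Num.sqrt h; rewrite -/q.
have q0 : 0 < q by rewrite sqrtr_gt0.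
have q1 : q <= 1 by rewrite -[leRHS]sqrtr1 ler_wsqrtr.
have hq : h = q ^+ 2 by rewrite sqr_sqrtr// ltW.
have s0 : 0 < s := lt_le_trans e0 es.
have sS : s <= S by lra.
have sh0 : 0 < s + h by exact: addr_gt0.
have mZ i : measurable_fun setT (Z i).
  by move=> _ D mD; rewrite setTI; apply: Fsm; exact: FZ.
have FB u z : s <= u -> u <= s + h -> `|profile b u z| <= B.
  move=> su ush; have [[+ _ _ _] _ _ _] := HK0 u z (le_trans es su) (le_trans ush shS).
  by move=> /le_trans; apply; rewrite /B lerDl.
have EU := @euler_step _ O R d P Fs Z g h FsI FsT Fsm h0 FZ mg indep b B
  (K1 * (h * q)) s B1 s0 (mulr_ge0 K10 (mulr_ge0 (ltW h0) (ltW q0))) FB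
  (fun z => HK1 s h z es h0 h1 shS).
pose V := \int[P]_o (\prod_i profile b (s + h) (Z i o)); rewrite -/V in EU *.
pose p i o := profile b s (Z i o + a i o + g i o).
pose qq i o := profile b s (Z i o + euler_drift h b (Z i o) + g i o).
pose c i o := drift_gap h s (Z i o) (a i o).
(* The two drifts differ by at most [2 M h] and both displacements are at most [M h + |g|]. As [|g|]
   has mean at most [128 sqrt h], the mean of [r] is of order [h^(3/2)]. *)
pose r i o := 4 * K0 * M * h * (M * h + `|g i o|).
have mad i : measurable_fun setT (fun o => euler_drift h b (Z i o)).
  exact: (measurableT_comp (measurable_euler_drift h b) (mZ i)).
have mp i : measurable_fun setT (p i).
  apply: (measurableT_comp (measurable_profile b s0)).
  by apply: measurable_funD => //; exact: measurable_funD.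
have mqq i : measurable_fun setT (qq i).
  apply: (measurableT_comp (measurable_profile b s0)).
  by apply: measurable_funD => //; exact: measurable_funD.
have p0 i o : 0 <= p i o by exact: profile_ge0.
have qq0 i o : 0 <= qq i o by exact: profile_ge0.
have ss : s <= s + h by rewrite lerDl ltW.
have pB i o : p i o <= B by rewrite (le_trans (ler_norm _))// FB.
have qqB i o : qq i o <= B by rewrite (le_trans (ler_norm _))// FB.
have adM z : `|euler_drift h b z| <= M * h.
  rewrite /euler_drift normrM normrM (gtr0_norm h0) /sgn.
  have : `|b| * h <= M * h by rewrite ler_wpM2r// ltW.
  by case: ifP => _; rewrite ?normrN normr1 mulr1.
have close i o : `|p i o - qq i o - c i o| <= r i o.
  have [_ _ + _] := HK0 s (Z i o) es sS.
  move=> /(_ (euler_drift h b (Z i o) + g i o) (a i o + g i o)).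
  rewrite !addrA -/(p i o) -/(qq i o).
  rewrite (_ : a i o + g i o - (euler_drift h b (Z i o) + g i o) =
     a i o - euler_drift h b (Z i o)); last by ring.
  rewrite -/(drift_gap h s (Z i o) (a i o)) -/(c i o) => /le_trans; apply.
  rewrite /r.
  rewrite [leRHS](_ : _ = K0 * (2 * (M * h) * (2 * (M * h + `|g i o|)))); last by ring.
  have n1 : `|a i o - euler_drift h b (Z i o)| <= 2 * (M * h).
    by rewrite (le_trans (ler_normB _ _))// mulr2n mulrDl mul1r lerD.
  have n2 : `|euler_drift h b (Z i o) + g i o| + `|a i o + g i o| <= 2 * (M * h + `|g i o|).
    rewrite mulr2n mulrDl mul1r.
    by apply: lerD; rewrite (le_trans (ler_normD _ _))// lerD2r.
  by rewrite ler_wpM2l//; apply: ler_pM => //; exact: addr_ge0.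
have mc i : measurable_fun setT (c i).
  apply: measurable_funM; last exact: measurable_funB.
  exact: (measurableT_comp (measurable_profile_d1 b s) (mZ i)).
have cB i o : `|c i o| <= K0 * (M * h + M * h).
  have [[_ + _ _] _ _ _] := HK0 s (Z i o) es sS => DK.
  rewrite /c /drift_gap normrM ler_pM// (le_trans (ler_normB _ _))// lerD//.
have gN i B' : measurable B' -> P (g i @^-1` B') = normal_prob 0 q B'.
  move=> mB'; have := indep setT FsT (fun j => if j == i then B' else setT).
  rewrite setTI probability_setT mul1e (bigD1 i)//= eqxx big1 ?mule1; last first.
    by move=> j /negbTE ->; exact: (probability_setT (normal_prob 0 q)).
  rewrite /q => <-; last by move=> j; case: ifP.
  congr (P _); apply/seteqP; split => o /=.
    by move=> Bo j; case: eqVneq => // ->.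
  by move=> /(_ i); rewrite eqxx.
have ir i : P.-integrable setT (EFin \o r i) /\ \int[P]_o r i o <= L * (h * q).
  have [ig eg] := normal_increment_moment q0 (mg i) (gN i).
  have icst k : P.-integrable setT (EFin \o (fun=> k : R)).
    exact: finite_measure_integrable_cst.
  have i1 := integrable_EFinD measurableT (icst (M * h)) ig.
  split; first exact: integrable_EFinZl.
  rewrite /r RintegralZl// RintegralD// Rintegral_prob_cst.
  rewrite [leRHS](_ : _ = 4 * K0 * M * h * (M * q + 128 * q)); last by rewrite /L; ring.
  apply: ler_wpM2l; first by rewrite !mulr_ge0// ltW.
  apply: lerD => //; rewrite ler_wpM2l// hq expr2 ler_piMr// ltW//.
have r0 i o : 0 <= r i o.
  by rewrite /r mulr_ge0 ?addr_ge0 ?mulr_ge0// ltW.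
(* Stated for general [w], [u], [v] so that it gives both inequalities: with [c] in one direction,
   with [- c] in the other. *)
have step (w u v : 'I_d -> O -> R) :
   (forall i, measurable_fun setT (w i)) ->
   (forall i o, `|w i o| <= K0 * (M * h + M * h)) ->
   (forall i, measurable_fun setT (u i)) -> (forall i, measurable_fun setT (v i)) ->
   (forall i o, 0 <= u i o) -> (forall i o, u i o <= B) ->
   (forall i o, 0 <= v i o) -> (forall i o, v i o <= B) ->
   (forall i o, u i o <= v i o + (Num.max 0 (w i o) + r i o)) ->
   \int[P]_o (\prod_i u i o) <= \int[P]_o (\prod_i v i o) +
     B ^+ d * (\sum_i \int[P]_o (Num.max 0 (w i o)) + d%:R * L * (h * q)).
  move=> mw wB mu mv u0 uB v0 vB uv.
  have mm i : measurable_fun setT (fun o => Num.max 0 (w i o)).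
    exact: measurable_maxr.
  have im i : P.-integrable setT (EFin \o (fun o => Num.max 0 (w i o))).
    apply: (@probability_integrable _ _ R P _ (K0 * (M * h + M * h)) (mm i)) => o.
    rewrite ger0_norm ?le_max ?lexx// ge_max (le_trans _ (wB i o))//=.
    by rewrite (le_trans (ler_norm _)).
  have ie i := integrable_EFinD measurableT (im i) (ir i).1.
  have [is1 is2] := Rintegral_sum (index_enum 'I_d) ie.
  have iu : P.-integrable setT (EFin \o (fun o => \prod_i u i o)).
    apply: (@probability_integrable _ _ R P _ (B ^+ d)).
      by apply: measurable_bigprod => i _.
    move=> o; rewrite -[d in B ^+ d]card_ord; apply: normr_prod_le => // i _.
    by rewrite ger0_norm.
  have iv : P.-integrable setT (EFin \o (fun o => \prod_i v i o)).
    apply: (@probability_integrable _ _ R P _ (B ^+ d)).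
      by apply: measurable_bigprod => i _.
    move=> o; rewrite -[d in B ^+ d]card_ord; apply: normr_prod_le => // i _.
    by rewrite ger0_norm.
  have iBs := integrable_EFinZl (B ^+ d) measurableT is1.
  apply: (@le_trans _ _ (\int[P]_o (\prod_i v i o +
     B ^+ d * (\sum_i (Num.max 0 (w i o) + r i o))))).
    apply: le_Rintegral => //; first exact: integrable_EFinD.
    move=> o _; apply: prod_perturb => // i.
    by rewrite addr_ge0// le_max lexx.
  rewrite RintegralD// RintegralZl// is2 lerD2l ler_wpM2l//.
  rewrite [leRHS](_ : _ = \sum_(i < d) (\int[P]_o (Num.max 0 (w i o)) + L * (h * q))).
    apply: ler_sum => i _; rewrite RintegralD//; last exact: (ir i).1.
    by rewrite lerD2l; exact: (ir i).2.
  rewrite big_split /= sumr_const card_ord -[in RHS]mulr_natl.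
  by rewrite -!mulrA.
have hqle : 0 <= h * q by rewrite mulr_ge0// ltW.
have sum0 (w : 'I_d -> O -> R) : 0 <= \sum_i \int[P]_o (Num.max 0 (w i o)).
  by apply: sumr_ge0 => i _; apply: Rintegral_ge0 => o _; rewrite le_max lexx.
have final (A D s1 : R) : 0 <= s1 ->
    A <= D + d%:R * (B ^+ d * (K1 * (h * q))) + B ^+ d * (s1 + d%:R * L * (h * q)) ->
    A <= D + B ^+ d * (1 + d%:R * L + d%:R * K1) * (s1 + h * q).
  move=> s10 /le_trans; apply; rewrite -subr_ge0.
  rewrite [leRHS](_ : _ = B ^+ d * (h * q) +
    B ^+ d * (d%:R * L + d%:R * K1) * s1); last by ring.
  apply: addr_ge0; first exact: mulr_ge0.
  by apply: mulr_ge0 => //; apply: mulr_ge0 => //; apply: addr_ge0; exact: mulr_ge0.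
move: EU; rewrite ler_norml => /andP[EU1 EU2].
split; apply: final => //.
- have H := step c p qq mc cB mp mqq p0 pB qq0 qqB.
  apply: (le_trans (H _)); last by rewrite lerD2r -lerBlDl.
  by move=> i o; apply: close_le (close i o) _; rewrite le_max lexx orbT.
- have mNc i : measurable_fun setT (fun o => - c i o) by exact: measurableT_comp.
  have NcB i o : `|- c i o| <= K0 * (M * h + M * h) by rewrite normrN.
  have H := step (fun i o => - c i o) qq p mNc NcB mqq mp qq0 qqB p0 pB.
  rewrite addrAC; apply: (@le_trans _ _ (\int[P]_o (\prod_i qq i o) +
    d%:R * (B ^+ d * (K1 * (h * q))))).
    by rewrite -lerBlDr addrC -lerBrDr.
  rewrite lerD2r; apply: H => i o.
  by apply: close_ge (close i o) _; rewrite le_max lexx orbT.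
Qed.

End one_step.

Section clip.
Context {R : realType}.

Definition clip (m r : R) : R := Num.max (- m) (Num.min m r).

Lemma clip_bound m r : 0 <= m -> `|clip m r| <= m.
Proof.
move=> m0; rewrite ler_norml /clip le_max lexx /= ge_max ge_min lexx /= andbT.
lra.
Qed.

Lemma clip_id m r : `|r| <= m -> clip m r = r.
Proof. by rewrite ler_norml /clip => /andP[mr rm]; rewrite min_r// max_r. Qed.

Lemma measurable_clip m : measurable_fun setT (clip m).
Proof. by apply: measurable_maxr => //; exact: measurable_minr. Qed.

End clip.

Lemma ae_eq_Rintegral dT (T : measurableType dT) (R : realType)
    (mu : {measure set T -> \bar R}) (f g : T -> R) :
  measurable_fun setT f -> measurable_fun setT g ->
  {ae mu, forall x, f x = g x} -> \int[mu]_x f x = \int[mu]_x g x.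
Proof.
move=> mf mg fg; congr fine; apply: ae_eq_integral.
- exact: measurableT.
- exact/measurable_EFinP.
- exact/measurable_EFinP.
- by apply: filterS fg => x fgx _; rewrite fgx.
Qed.

Lemma ler_addl_trans {R : realType} (a b c p q : R) :
  a <= b + p -> b <= c + q -> a <= c + (p + q).
Proof. by move=> ? ?; lra. Qed.

(** * The Euler grid along a weak solution *)

Section scheme.
Context dO (O : measurableType dO) (R : realType) (d : nat).
Variables (P : probability O R) (F : R -> set_system O).
Variables (W X : O -> pathspace R d) (J : set R).
Hypotheses (HF : is_filtration F) (HW : is_brownian_motion P F W).
Hypothesis HX : is_adapted F J X.
Variables (M t : R) (x y : 'rV[R]_d).
Hypotheses (M0 : 0 <= M) (t0 : 0 < t) (tJ : forall u, 0 <= u -> u <= t -> J u).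

(** The drift integral from [u] to [v], expressed through the paths, so that its measurability in
    [o] follows from adaptedness. *)
Definition increment (u v : R) (i : 'I_d) (o : O) : R :=
  at_time (X o) v 0 i - at_time (X o) u 0 i - (at_time (W o) v 0 i - at_time (W o) u 0 i).

Hypothesis Xinc : {ae P, forall o, at_time (X o) 0 = x /\
  forall u v i, 0 <= u -> u <= v -> v <= t -> `|increment u v i o| <= M * (v - u)}.

Definition shifted (u : R) (i : 'I_d) (o : O) : R := at_time (X o) u 0 i - y 0 i.

(* The bound on [increment] holds only almost surely; clipping makes it hold
   everywhere without losing measurability. *)
Definition clipped (u v : R) (i : 'I_d) (o : O) : R :=
  clip (M * (v - u)) (increment u v i o).

Lemma filtration_measurable u : 0 <= u -> F u `<=` measurable.
Proof. by case: HF => _ + _; apply. Qed.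

Lemma measurable_X u i : 0 <= u -> u <= t ->
  measurable_fun setT (fun o => at_time (X o) u 0 i).
Proof.
move=> u0 ut; apply: (@measurableT_comp _ _ _ _ _ _ (fun v : 'rV[R]_d => v 0 i)).
  exact: measurable_coord.
move=> _ B mB; rewrite setTI; apply: (filtration_measurable u0).
exact: (HX (tJ u0 ut)).
Qed.

Lemma measurable_W u i : 0 <= u -> measurable_fun setT (fun o => at_time (W o) u 0 i).
Proof.
move=> u0; apply: (@measurableT_comp _ _ _ _ _ _ (fun v : 'rV[R]_d => v 0 i)).
  exact: measurable_coord.
move=> _ B mB; rewrite setTI; apply: (filtration_measurable u0).
case: HW => WF _ _; apply: WF => //.
by rewrite /= in_itv /= u0.
Qed.

Lemma measurable_shifted u i : 0 <= u -> u <= t -> measurable_fun setT (shifted u i).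
Proof. by move=> u0 ut; apply: measurable_funB => //; exact: measurable_X. Qed.

Lemma measurable_clipped u v i : 0 <= u -> u <= v -> v <= t ->
  measurable_fun setT (clipped u v i).
Proof.
move=> u0 uv vt; have v0 := le_trans u0 uv; have ut := le_trans uv vt.
apply: (measurableT_comp (measurable_clip _)).
apply: measurable_funB; apply: measurable_funB;
  by [exact: measurable_X|exact: measurable_W].
Qed.

Variables (b eps : R).
Hypotheses (bM : `|b| <= M) (eps0 : 0 < eps).

Definition value (u : R) : R :=
  \int[P]_o (\prod_i profile b (eps + (t - u)) (shifted u i o)).

Definition gap (u v : R) (i : 'I_d) (o : O) : R :=
  drift_gap b (v - u) (eps + (t - v)) (shifted u i o) (clipped u v i o).

Definition grid (n k : nat) : R := k%:R * (t / n%:R).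

(** [sg] is 1 or -1 according to the inequality wanted. Each direction pays only for gaps of its own
    sign; this is why the error is identically 0 for [b = M] with [sg = 1] and for [b = - M] with
    [sg = -1]. *)
Definition total_gap (sg : R) (n : nat) : R :=
  \sum_(k < n) \sum_i \int[P]_o (Num.max 0 (sg * gap (grid n k) (grid n k.+1) i o)).

Lemma value_step : exists2 K : R, 0 <= K & forall u v, 0 <= u -> u < v -> v <= t ->
  v - u <= 1 ->
  value v <= value u +
    K * (\sum_i \int[P]_o (Num.max 0 (gap u v i o)) + (v - u) * Num.sqrt (v - u)) /\
  value u <= value v +
    K * (\sum_i \int[P]_o (Num.max 0 (- gap u v i o)) + (v - u) * Num.sqrt (v - u)).
Proof.
have [K K0 HK] := @one_step _ O R d P b M bM eps (eps + t) eps0.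
exists K => // u v u0 uv vt uv1.
have v0 := le_trans u0 (ltW uv); have ut := le_trans (ltW uv) vt.
have h0 : 0 < v - u by rewrite subr_gt0.
pose g (i : 'I_d) o := at_time (W o) v 0 i - at_time (W o) u 0 i.
have s0 : 0 < eps + (t - v) by rewrite ltr_wpDr// subr_ge0.
have [FsA _ _] := HF; have [Fs0 FsC FsU] := FsA u u0.
have FsT : F u setT by have := FsC _ Fs0; rewrite setD0.
have FsI : setI_closed (F u).
  move=> A B FA FB; pose U (n : nat) := if n is 0%N then ~` A else ~` B.
  have := FsC (\bigcup_n U n); rewrite setTD => H.
  have -> : A `&` B = ~` \bigcup_n U n.
    rewrite setC_bigcup; apply/seteqP; split => [ o [Ao Bo] [|n] _ | o H'] /=.
    - by move=> /(_ Ao).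
    - by move=> /(_ Bo).
    - by split; apply: contrapT => nAB; [exact: (H' 0%N I nAB)|exact: (H' 1%N I nAB)].
  apply: H; apply: FsU => -[|n] /=; rewrite -setTD; exact: FsC.
have FZ i B : measurable B -> F u (shifted u i @^-1` B).
  move=> mB.
  have mB' : measurable ((fun w : 'rV[R]_d => w 0 i - y 0 i) @^-1` B).
    rewrite -[X in measurable X]setTI.
    have mf : measurable_fun setT (fun w : 'rV[R]_d => w 0 i - y 0 i).
      by apply: measurable_funB => //; exact: measurable_coord.
    exact: mf.
  exact: (HX (tJ u0 ut) mB').
have mg i : measurable_fun setT (g i).
  by apply: measurable_funB; exact: measurable_W.
have indep A (FA : F u A) (B : 'I_d -> set R) (mB : forall i, measurable (B i)) :
    (P (A `&` [set o | forall i, B i (g i o)]) =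
     P A * \prod_(i < d) normal_prob 0 (Num.sqrt (v - u)) (B i))%E.
  by case: HW => _ _ Wi; apply: Wi.
have aM i o : `|clipped u v i o| <= M * (v - u).
  by apply: clip_bound; rewrite mulr_ge0// ltW.
have ma i := measurable_clipped i u0 (ltW uv) vt.
have := HK (F u) (shifted u) g (clipped u v) (v - u) (eps + (t - v))
  FsI FsT (filtration_measurable u0) h0 uv1.
rewrite lerDl subr_ge0 => /(_ vt).
rewrite (_ : eps + (t - v) + (v - u) = eps + (t - u)); last by ring.
rewrite lerD2l gerBl => /(_ u0 FZ mg indep ma aM).
(* Almost surely the clipping is inactive, and position, drift and noise add up to the shifted path
   at time [v]. *)
suff -> : \int[P]_o (\prod_i profile b (eps + (t - v))
    (shifted u i o + clipped u v i o + g i o)) = value v by [].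
apply: ae_eq_Rintegral.
- apply: measurable_bigprod => i _.
  apply: (measurableT_comp (measurable_profile b s0)).
  by apply: measurable_funD => //; apply: measurable_funD => //; exact: measurable_shifted.
- apply: measurable_bigprod => i _.
  by apply: (measurableT_comp (measurable_profile b s0)); exact: measurable_shifted.
apply: filterS Xinc => o [_ inc]; apply: eq_bigr => i _.
rewrite /clipped clip_id; last exact: (inc _ _ _ u0 (ltW uv) vt).
by congr profile; rewrite /shifted /increment /g; ring.
Qed.

Lemma value0 : value 0 = \prod_i profile b (eps + t) (x 0 i - y 0 i).
Proof.
rewrite -[RHS](Rintegral_prob_cst P) /value subr0.
have s0 : 0 < eps + t by exact: addr_gt0.
apply: ae_eq_Rintegral.
- apply: measurable_bigprod => i _.
  apply: (measurableT_comp (measurable_profile b s0)); apply: measurable_shifted => //.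
  exact: ltW.
- exact: measurable_cst.
- apply: filterS Xinc => o [Xo _]; apply: eq_bigr => i _.
  by rewrite /shifted Xo.
Qed.

(** The [n] errors [h sqrt h] with [h = t / n] sum to [t sqrt(t / n)]. The condition [t < n] ensures
    [h <= 1]. *)
Lemma value_grid : exists2 K : R, 0 <= K & forall n : nat, t < n%:R ->
  value t <= value 0 + K * (total_gap 1 n + t * Num.sqrt (t / n%:R)) /\
  value 0 <= value t + K * (total_gap (-1) n + t * Num.sqrt (t / n%:R)).
Proof.
have [K K0 HK] := value_step; exists K => // n tn.
have n0 : 0 < n%:R :> R by exact: lt_trans tn.
pose h := t / n%:R; have h0 : 0 < h by exact: divr_gt0.
have h1 : h <= 1 by rewrite ler_pdivrMr// mul1r ltW.
have gn : grid n n = t by rewrite /grid mulrCA divff ?mulr1// gt_eqF.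
pose S (sg : R) k := \sum_(j < k) (\sum_i \int[P]_o
  (Num.max 0 (sg * gap (grid n j) (grid n j.+1) i o)) + h * Num.sqrt h).
suff H k : (k <= n)%N -> value (grid n k) <= value 0 + K * S 1 k /\
    value 0 <= value (grid n k) + K * S (-1) k.
  have SE sg : S sg n = total_gap sg n + t * Num.sqrt (t / n%:R).
    rewrite /S big_split /= sumr_const card_ord; congr (_ + _).
    by rewrite -[LHS]mulr_natl mulrA -/h; congr (_ * _); exact: gn.
  by have := H n (leqnn n); rewrite gn !SE.
elim: k => [_|k IH kn].
  have g00 : grid n 0 = 0 by rewrite /grid mul0r.
  have S0 sg : S sg 0%N = 0 by exact: big_ord0.
  by rewrite g00 !S0 mulr0 !addr0; split; exact: lexx.
have [IH1 IH2] := IH (ltnW kn).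
have gS : grid n k.+1 - grid n k = h by rewrite /grid -[k.+1%:R]natr1 mulrDl mul1r -/h addrAC subrr add0r.
have g0 : 0 <= grid n k by rewrite mulr_ge0// ltW.
have gk : grid n k < grid n k.+1 by rewrite -subr_gt0 gS.
have gt : grid n k.+1 <= t.
  by rewrite -[leRHS]gn /grid ler_pM2r; [rewrite ler_nat|exact: h0].
have := HK _ _ g0 gk gt; rewrite gS => /(_ h1)[H1 H2].
have SS sg : S sg k.+1 = S sg k + (\sum_i \int[P]_o
    (Num.max 0 (sg * gap (grid n k) (grid n k.+1) i o)) + h * Num.sqrt h).
  exact: big_ord_recr.
rewrite !SS.
have E1 : \sum_i \int[P]_o (Num.max 0 (1 * gap (grid n k) (grid n k.+1) i o)) =
    \sum_i \int[P]_o (Num.max 0 (gap (grid n k) (grid n k.+1) i o)).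
  by apply: eq_bigr => i _; apply: eq_Rintegral => o _; rewrite mul1r.
have E2 : \sum_i \int[P]_o (Num.max 0 (-1 * gap (grid n k) (grid n k.+1) i o)) =
    \sum_i \int[P]_o (Num.max 0 (- gap (grid n k) (grid n k.+1) i o)).
  by apply: eq_bigr => i _; apply: eq_Rintegral => o _; rewrite mulN1r.
rewrite E1 E2 [K * (S 1 k + _)]mulrDr [K * (S (-1) k + _)]mulrDr; split.
  by rewrite [K * S 1 k + _]addrC; exact: ler_addl_trans H1 IH1.
exact: ler_addl_trans IH2 H2.
Qed.

End scheme.

(** * Passage to the limit *)

Lemma uniform_continuity_segment {R : realType} (f : R -> R) (t eta : R) :
  continuous f -> 0 < eta ->
  exists2 del : R, 0 < del & forall u v, 0 <= u -> u <= t -> `|u - v| < del ->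
    `|f u - f v| < eta.
Proof.
move=> cf eta0.
have /compact_near_coveringP cK := @segment_compact R 0 t.
pose Q (del u : R) := forall v, `|u - v| < del -> `|f u - f v| < eta.
have [del [del0 H]] : exists del : R, 0 < del /\ `[0, t]%classic `<=` Q del.
  have H : \forall del \near (0 : R)^'+, `[0, t]%classic `<=` Q del.
    apply: cK => u _.
    have e2 : 0 < eta / 2 by rewrite divr_gt0.
    have /cvgr_dist_lt /(_ _ e2) : f x @[x --> u] --> f u by exact: cf.
    rewrite near_nbhs => /nbhs_ballP[rho /= rho0 Hrho].
    have rho2 : 0 < rho / 2 by rewrite divr_gt0.
    have N0 : \forall del \near (0 : R)^'+, 0 < del < rho / 2.
      by apply: filterS2 (nbhs_right_gt 0) (nbhs_right_lt rho2) => del -> ->.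
    exists (ball u (rho / 2), [set del | 0 < del < rho / 2]) => /=.
      by split => //; exact: nbhsx_ballx.
    move=> [u' del] /= [uu' /andP[del0 delr]] v u'v.
    have uv : ball u rho v.
      rewrite /ball /= -(subrKA u') (le_lt_trans (ler_normD _ _))//.
      by rewrite (splitr rho) ltrD// (lt_trans u'v).
    have uu : ball u rho u'.
      by move: uu'; rewrite /ball /= => /lt_le_trans; apply; rewrite ler_pdivrMr// ler_peMr ?ler1n ?ltW.
    rewrite -(subrKA (f u)) (le_lt_trans (ler_normD _ _))//.
    rewrite (splitr eta) ltrD//; last exact: Hrho uv.
    by rewrite distrC; exact: Hrho uu.
  have [del [del0 Hdel]] := filter_ex (filterI (nbhs_right_gt (0 : R)) H).
  by exists del; split.
by exists del => // u v u0 ut; apply: H; rewrite /= in_itv /= u0 ut.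
Qed.

Section limits.
Context {R : realType}.

Lemma le_of_vanishing_error (A B K t : R) (s : nat -> R) : 0 <= K -> 0 < t ->
  (forall n : nat, t < n%:R -> A <= B + K * (s n + t * Num.sqrt (t / n%:R))) ->
  (forall eta, 0 < eta -> exists N : nat, forall n, (N <= n)%N -> s n <= eta) ->
  A <= B.
Proof.
move=> K0 t0 H Hs; apply/ler_addgt0Pr => e e0.
pose K1 := K + 1; have K10 : 0 < K1 by rewrite ltr_wpDl.
pose eta := e / K1 / 2.
have eta0 : 0 < eta by rewrite !divr_gt0.
have [N HN] := Hs eta eta0.
pose del := eta / t; have del0 : 0 < del by rewrite divr_gt0.
(* The first summand forces [sqrt(t / n) <= del] for [n] beyond [m], the second forces [t < n]. *)
have [m Hm] : exists m : nat, t / del ^+ 2 + t <= m%:R.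
  exists (Num.bound (t / del ^+ 2 + t)).
  apply/ltW/archi_boundP; apply: addr_ge0; last exact: ltW.
  by apply: divr_ge0; [exact: ltW|exact: sqr_ge0].
have tm : t < (maxn N m).+1%:R.
  apply: (@le_lt_trans _ _ m%:R); last by rewrite ltr_nat ltnS leq_maxr.
  apply: le_trans Hm; rewrite lerDr; apply: divr_ge0; [exact: ltW|exact: sqr_ge0].
have n0 : 0 < (maxn N m).+1%:R :> R by rewrite ltr0n.
apply: (le_trans (H _ tm)); rewrite lerD2l.
apply: (@le_trans _ _ (K1 * (eta + eta))); last first.
  rewrite (_ : K1 * (eta + eta) = e)// /eta; field; by rewrite gt_eqF.
have sq : t * Num.sqrt (t / (maxn N m).+1%:R) <= eta.
  rewrite mulrC -ler_pdivlMr// -/del -[leRHS](ger0_norm (ltW del0)) -sqrtr_sqr.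
  rewrite ler_wsqrtr// ler_pdivrMr// mulrC -ler_pdivrMr ?exprn_gt0//.
  apply: (@le_trans _ _ m%:R); first by apply: le_trans Hm; rewrite lerDl ltW.
  by rewrite ler_nat ltnW// ltnS leq_maxr.
have hs : s (maxn N m).+1 <= eta.
  by apply: HN; rewrite ltnW// ltnS leq_maxl.
have h2 := lerD hs sq.
apply: (@le_trans _ _ (K * (eta + eta))); first by rewrite ler_wpM2l.
by rewrite ler_wpM2r ?addr_ge0 ?(ltW eta0)// lerDl.
Qed.

End limits.

Lemma continuous_at_time (R : realType) (d : nat) (w : pathspace R d) (i : 'I_d) :
  continuous (fun u : R => at_time w u 0 i).
Proof.
have ct : continuous (@to_time R).
  apply: continuous_comp_initial => s.
  by apply: continuous_max; [exact: cst_continuous|move=> ?].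
move=> u; apply: (@continuous_comp _ _ _ (fun u => at_time w u) (fun v : 'rV[R]_d => v 0 i)).
  by apply: (continuous_comp (ct u)); exact: cts_fun.
exact: coord_continuous.
Qed.

Lemma drift_gapE (R : realType) (b h s z a : R) :
  drift_gap b h s z a = profile_d1 b s z * a - b * h * `|profile_d1 b s z|.
Proof. by rewrite /drift_gap /euler_drift -(profile_d1_sgn b s z); ring. Qed.

(** Optimality of the bang-bang drift: it attains the maximum [M h |F'|] of [F' a] over the
    admissible [a]. *)
Lemma drift_gap_le0 (R : realType) (M h s z a : R) : `|a| <= M * h ->
  drift_gap M h s z a <= 0.
Proof.
move=> aM; rewrite drift_gapE subr_le0 mulrC (le_trans (ler_norm _))// normrM.
by rewrite ler_wpM2r.
Qed.

Lemma drift_gap_ge0 (R : realType) (M h s z a : R) : `|a| <= M * h ->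
  0 <= drift_gap (- M) h s z a.
Proof.
move=> aM; rewrite drift_gapE !mulNr opprK.
have : `|profile_d1 (- M) s z * a| <= M * h * `|profile_d1 (- M) s z|.
  by rewrite normrM mulrC ler_wpM2r.
by rewrite ler_norml => /andP[? _]; lra.
Qed.

Lemma euler_drift_bound (R : realType) (b M h z : R) : `|b| <= M -> 0 <= h ->
  `|euler_drift h b z| <= M * h.
Proof.
move=> bM h0; rewrite /euler_drift normrM normrM (ger0_norm h0).
have : `|b| * h <= M * h by rewrite ler_wpM2r.
by rewrite /sgn; case: ifP => _; rewrite ?normrN normr1 mulr1.
Qed.

Lemma drift_gap_bound (R : realType) (b M h s z a K : R) : `|b| <= M -> 0 <= h ->
  `|a| <= M * h -> `|profile_d1 b s z| <= K -> `|drift_gap b h s z a| <= K * (2 * M * h).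
Proof.
move=> bM h0 aM DK; rewrite /drift_gap normrM ler_pM// (le_trans (ler_normB _ _))//.
by rewrite -mulrA mulr2n mulrDl mul1r lerD// euler_drift_bound.
Qed.

Lemma le0_iff_close (R : realType) (p q c : R) :
  `|p - q| < `|p - c| -> (c - q <= 0) = (- (p - c) <= 0).
Proof.
rewrite opprB subr_le0 subr_le0; have [cp|cp] := leP c p.
  by rewrite (ger0_norm (x := p - c)) ?subr_ge0// ltr_norml => /andP[_ ?]; apply/idP; lra.
rewrite (ltr0_norm (x := p - c)) ?subr_lt0// ltr_norml => /andP[? _].
by apply/negbTE; rewrite -ltNge; lra.
Qed.

Lemma Rintegral_sgn_const (R : realType) (b c u v : R) (f : R -> R) : u <= v ->
  (forall r, u <= r -> r <= v -> `|f u - f r| < `|f u - c|) ->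
  \int[lebesgue_measure]_(r in `]u, v]) (b * sgn (c - f r)) =
  euler_drift (v - u) b (f u - c).
Proof.
move=> uv H.
rewrite (_ : \int[lebesgue_measure]_(r in `]u, v]) _ =
   \int[lebesgue_measure]_(r in `]u, v]) (b * sgn (- (f u - c)))); last first.
  apply: eq_Rintegral => r; rewrite inE /= in_itv /= => /andP[ur rv].
  by rewrite /sgn (le0_iff_close (H r (ltW ur) rv)).
rewrite Rintegral_cst//= lebesgue_measure_itv /= lte_fin /euler_drift.
have [_|vu] := ltP u v; first by rewrite /= mulrAC.
by rewrite (@le_anti _ _ u v) ?uv// subrr !mulr0 mul0r.
Qed.

Lemma path_modulus (R : realType) (d : nat) (w : pathspace R d) (t eta : R) : 0 < eta ->
  exists2 del : R, 0 < del & forall i u v, 0 <= u -> u <= t -> `|u - v| < del ->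
    `|at_time w u 0 i - at_time w v 0 i| < eta.
Proof.
move=> eta0.
have H (i : 'I_d) := uniform_continuity_segment t (@continuous_at_time R d w i) eta0.
have /choice[D HD] : forall i, exists del : R, 0 < del /\ forall u v, 0 <= u -> u <= t ->
    `|u - v| < del -> `|at_time w u 0 i - at_time w v 0 i| < eta.
  by move=> i; have [del del0 Hd] := H i; exists del.
exists (\big[Num.min/1]_i D i).
  by apply: lt_bigmin; [exact: ltr01|move=> i _; have [] := HD i].
move=> i u v u0 ut uv; have [_ Hi] := HD i; apply: Hi => //.
by apply: (lt_le_trans uv); exact: bigmin_le.
Qed.

Lemma gridS (R : realType) (t : R) n k : grid t n k.+1 = grid t n k + t / n%:R.
Proof. by rewrite /grid -[k.+1%:R]natr1 mulrDl mul1r. Qed.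

Lemma grid_le (R : realType) (t : R) n k : 0 < t -> grid t n k <= grid t n k.+1.
Proof. by move=> t0; rewrite gridS lerDl divr_ge0// ltW. Qed.

(** * Comparison of terminal and initial values *)

Section comparison.
Context dO (O : measurableType dO) (R : realType) (d : nat).
Variables (P : probability O R) (F : R -> set_system O).
Variables (W X : O -> pathspace R d) (J : set R).
Hypotheses (HF : is_filtration F) (HW : is_brownian_motion P F W).
Hypothesis HX : is_adapted F J X.
Variables (M t : R) (x y : 'rV[R]_d).
Hypotheses (M0 : 0 <= M) (t0 : 0 < t) (tJ : forall u, 0 <= u -> u <= t -> J u).
Hypothesis Xinc : {ae P, forall o, at_time (X o) 0 = x /\
  forall u v i, 0 <= u -> u <= v -> v <= t -> `|increment W X u v i o| <= M * (v - u)}.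
Variables (b eps : R).
Hypotheses (bM : `|b| <= M) (eps0 : 0 < eps).

Notation terminal := (\int[P]_o (\prod_i profile b eps (at_time (X o) t 0 i - y 0 i))).
Notation initial := (\prod_i profile b (eps + t) (x 0 i - y 0 i)).

Let valuet : value P X t y b eps t = terminal.
Proof.
by rewrite /value (subrr t) (addr0 eps).
Qed.

Let tgap := total_gap P W X M t y b eps.

Definition vanishing (s : nat -> R) := forall eta : R, 0 < eta ->
  exists N : nat, forall n, (N <= n)%N -> s n <= eta.

Lemma terminal_le_initial : vanishing (tgap 1) -> terminal <= initial.
Proof.
move=> V; have [K K0 HK] := value_grid HF HW HX y M0 t0 tJ Xinc bM eps0.
rewrite -valuet -(value0 HF HX y t0 tJ Xinc b eps0).
by apply: (le_of_vanishing_error K0 t0 _ V) => n /HK[].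
Qed.

Lemma initial_le_terminal : vanishing (tgap (-1)) -> initial <= terminal.
Proof.
move=> V; have [K K0 HK] := value_grid HF HW HX y M0 t0 tJ Xinc bM eps0.
rewrite -valuet -(value0 HF HX y t0 tJ Xinc b eps0).
by apply: (le_of_vanishing_error K0 t0 _ V) => n /HK[].
Qed.

Let clipped_bound u v i o : u <= v -> `|clipped W X M u v i o| <= M * (v - u).
Proof.
move=> uv; rewrite /clipped; apply: clip_bound.
by apply: mulr_ge0; [exact: M0|rewrite subr_ge0].
Qed.

Let vanishing_tgap0 sg : (forall u v i o, u <= v -> sg * gap W X M t y b eps u v i o <= 0) ->
  vanishing (tgap sg).
Proof.
move=> H eta eta0; exists 0%N => n _; rewrite /tgap /total_gap big1; first exact: ltW.
move=> k _; apply: big1 => i _; rewrite -[RHS](Rintegral_prob_cst P).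
by apply: eq_Rintegral => o _; apply: max_l; exact: H (grid_le n k t0).
Qed.

Lemma terminal_le_initial_bounded : b = M -> terminal <= initial.
Proof.
move=> bE; apply: terminal_le_initial; apply: vanishing_tgap0 => u v i o uv.
by rewrite mul1r /gap bE; apply: drift_gap_le0; exact: clipped_bound.
Qed.

Lemma initial_le_terminal_bounded : b = - M -> initial <= terminal.
Proof.
move=> bE; apply: initial_le_terminal; apply: vanishing_tgap0 => u v i o uv.
by rewrite mulN1r oppr_le0 /gap bE; apply: drift_gap_ge0; exact: clipped_bound.
Qed.

Section bang_bang_drift.
Hypothesis Xbb : {ae P, forall o u v i, 0 <= u -> u <= v -> v <= t ->
  increment W X u v i o =
  \int[lebesgue_measure]_(r in `]u, v]) (b * sgn (y 0 i - at_time (X o) r 0 i))}.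

(** The first bound is uniform in the path, to serve as a dominating constant. In the second, [del]
    comes from the modulus of continuity of the path and so depends on [o]. *)
Lemma gap_small : exists2 K : R, 0 <= K &
  (forall u v i o, 0 <= u -> u <= v -> v <= t ->
    `|gap W X M t y b eps u v i o| <= K * (v - u)) /\
  {ae P, forall o, forall eta, 0 < eta -> exists2 del, 0 < del &
    forall u v i, 0 <= u -> u <= v -> v <= t -> v - u < del ->
    `|gap W X M t y b eps u v i o| <= eta * (K * (v - u))}.
Proof.
have [K K0 HK] := profile_estimates b (eps + t) eps0.
have HD v z : 0 <= v -> v <= t ->
    `|profile_d1 b (eps + (t - v)) z| <= K /\ `|profile_d1 b (eps + (t - v)) z| <= K * `|z|.
  move=> v0 vt; have h1 : eps <= eps + (t - v) by rewrite lerDl subr_ge0.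
  have h2 : eps + (t - v) <= eps + t by rewrite lerD2l gerBl.
  by have [[_ D1 D2 _] _ _ _] := HK (eps + (t - v)) z h1 h2; split; [exact: D1|exact: D2].
exists (K * (2 * M)); first by apply: mulr_ge0; [exact: K0|apply: mulr_ge0; [exact: ler0n|exact: M0]].
split.
  move=> u v i o u0 uv vt; rewrite -mulrA; apply: drift_gap_bound.
  - exact: bM.
  - by rewrite subr_ge0.
  - exact: clipped_bound.
  - by have [] := HD v (shifted X y u i o) (le_trans u0 uv) vt.
apply: filterS2 Xinc Xbb => o [_ inc] bb eta eta0.
have [del del0 Hdel] := path_modulus (X o) t eta0.
exists del; first exact: del0.
move=> u v i u0 uv vt uvd.
have v0 := le_trans u0 uv; have ut := le_trans uv vt.
have vu0 : 0 <= v - u by rewrite subr_ge0.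
set z := shifted X y u i o.
(* Near the switching level [|F'| <= K eta]. Away from it, the path cannot reach the level within a
   step shorter than [del], and the gap is exactly 0. *)
have [ze|ze] := leP `|z| eta.
  rewrite [leRHS](_ : _ = (K * eta) * (2 * M * (v - u))); last by ring.
  apply: drift_gap_bound; [exact: bM|exact: vu0|exact: clipped_bound|].
  have [_ h] := HD v z v0 vt; apply: (le_trans h).
  by apply: ler_wpM2l; [exact: K0|exact: ze].
have -> : gap W X M t y b eps u v i o = 0.
  rewrite /gap /drift_gap /clipped clip_id; last exact: inc u0 uv vt.
  rewrite (bb u v i u0 uv vt).
  rewrite (@Rintegral_sgn_const _ b (y 0 i) u v (fun r => at_time (X o) r 0 i) uv).
    by rewrite subrr mulr0.
  move=> r ur rv; apply: lt_trans ze; apply: Hdel; [exact: u0|exact: ut|].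
  rewrite distrC ger0_norm ?subr_ge0; last exact: ur.
  by apply: le_lt_trans uvd; rewrite lerD2r.
rewrite normr0; apply: mulr_ge0; first exact: ltW.
apply: mulr_ge0; last exact: vu0.
by apply: mulr_ge0; [exact: K0|apply: mulr_ge0; [exact: ler0n|exact: M0]].
Qed.

End bang_bang_drift.
End comparison.

Lemma bounded_convergence_vanishing dT (T : measurableType dT) (R : realType)
    (P : probability T R) (G : nat -> T -> R) (C : R) :
  (forall n, measurable_fun setT (G n)) -> (forall n o, 0 <= G n o) ->
  (forall n o, G n o <= C) -> {ae P, forall o, vanishing (fun n => G n o)} ->
  vanishing (fun n => \int[P]_o G n o).
Proof.
move=> mG G0 GC Gv eta eta0.
have mGE n : measurable_fun setT (EFin \o G n) by exact/measurable_EFinP.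
have iC : P.-integrable setT (EFin \o cst C) by exact: finite_measure_integrable_cst.
have cG : {ae P, forall o, setT o -> (fun n => (G n o)%:E) @ \oo --> (cst 0%E : T -> \bar R) o}.
  apply: filterS Gv => o Go _; apply: cvg_EFin; first exact: nearW.
  apply/cvgrPdist_le => e e0; have [N HN] := Go e e0.
  by exists N => // n /= Nn; rewrite sub0r normrN ger0_norm ?HN.
have GCa : {ae P, forall o n, setT o -> (`|(EFin \o G n) o| <= (EFin \o cst C) o)%E}.
  by apply: aeW => o n _; rewrite /= lee_fin ger0_norm.
have [_ _] := @dominated_convergence _ T R P setT measurableT (fun n => EFin \o G n)
  (cst 0%E) (EFin \o cst C) mGE (@measurable_cst _ _ _ _ _ _) cG iC GCa.
rewrite integral0 => /fine_cvg /cvgrPdist_le /(_ _ eta0)[N _ HN].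
exists N => n Nn; have := HN n Nn.
rewrite sub0r normrN; apply: le_trans; exact: ler_norm.
Qed.

(** * The total gap of a bang-bang diffusion *)

Section bang_bang_vanishing.
Context dO (O : measurableType dO) (R : realType) (d : nat).
Variables (P : probability O R) (F : R -> set_system O).
Variables (W X : O -> pathspace R d) (J : set R).
Hypotheses (HF : is_filtration F) (HW : is_brownian_motion P F W).
Hypothesis HX : is_adapted F J X.
Variables (M t : R) (x y : 'rV[R]_d).
Hypotheses (M0 : 0 <= M) (t0 : 0 < t) (tJ : forall u, 0 <= u -> u <= t -> J u).
Hypothesis Xinc : {ae P, forall o, at_time (X o) 0 = x /\
  forall u v i, 0 <= u -> u <= v -> v <= t -> `|increment W X u v i o| <= M * (v - u)}.
Variables (b eps : R).
Hypotheses (bM : `|b| <= M) (eps0 : 0 < eps).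
Hypothesis Xbb : {ae P, forall o u v i, 0 <= u -> u <= v -> v <= t ->
  increment W X u v i o =
  \int[lebesgue_measure]_(r in `]u, v]) (b * sgn (y 0 i - at_time (X o) r 0 i))}.

Let step_gap n k i o := gap W X M t y b eps (grid t n k) (grid t n k.+1) i o.

(** Absolute values dominate both signs of the gap at once. *)
Let all_gaps n o := \sum_(k < n) \sum_(i < d) `|step_gap n k i o|.

Let grid_ge0 n k : 0 <= grid t n k.
Proof. by apply: mulr_ge0; [exact: ler0n|apply: divr_ge0; [exact: ltW|exact: ler0n]]. Qed.

Let grid_le_t n (k : 'I_n) : grid t n k.+1 <= t.
Proof.
have n0 : 0 < n%:R :> R by rewrite ltr0n; apply: leq_ltn_trans (ltn_ord k).
rewrite /grid mulrA ler_pdivrMr; last exact: n0.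
by rewrite mulrC; apply: ler_wpM2l; [exact: ltW|rewrite ler_nat; exact: ltn_ord].
Qed.

Let grid_step n k : grid t n k.+1 - grid t n k = t / n%:R.
Proof. by rewrite gridS addrC addKr. Qed.

Let measurable_step_gap n (k : 'I_n) i : measurable_fun setT (step_gap n k i).
Proof.
have kt := grid_le_t k; have kk := grid_le n k t0.
have ms := measurable_shifted HF HX y tJ i (grid_ge0 n k) (le_trans kk kt).
apply: measurable_funM; first exact: (measurableT_comp (measurable_profile_d1 _ _) ms).
apply: measurable_funB; first exact: (measurable_clipped HF HW HX M tJ i (grid_ge0 n k) kk kt).
exact: (measurableT_comp (measurable_euler_drift _ _) ms).
Qed.

Let all_gaps_le n o c : 0 <= c -> (forall (k : 'I_n) i, `|step_gap n k i o| <= c * (t / n%:R)) ->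
  all_gaps n o <= d%:R * (c * t).
Proof.
move=> c0 H; rewrite /all_gaps.
apply: (@le_trans _ _ (\sum_(k < n) \sum_(i < d) c * (t / n%:R))).
  by apply: ler_sum => k _; apply: ler_sum => i _; exact: H.
rewrite !sumr_const !card_ord.
have -> : c * (t / n%:R) *+ d *+ n = d%:R * (n%:R * (c * (t / n%:R))).
  by rewrite [d%:R * _]mulr_natl [n%:R * _]mulr_natl -!mulrnA mulnC.
apply: ler_wpM2l; first exact: ler0n.
have [->|n0] := eqVneq n 0%N.
  by rewrite mul0r; apply: mulr_ge0; [exact: c0|exact: ltW].
by rewrite mulrCA [n%:R * _]mulrCA divff ?mulr1 ?pnatr_eq0.
Qed.

(** [all_gaps] is at most [d K t] for every path and every [n], and tends to 0 along almost every
    path, at a speed that depends on the path; dominated convergence passes to the mean. *)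
Lemma bang_bang_total_gap sg : `|sg| = 1 ->
  vanishing (total_gap P W X M t y b eps sg).
Proof.
move=> sg1.
have [K K0 [HK1 HK2]] := gap_small M0 Xinc bM eps0 Xbb.
have dK0 : 0 <= d%:R * (K * t).
  by apply: mulr_ge0; [exact: ler0n|apply: mulr_ge0; [exact: K0|exact: ltW]].
have GC n o : all_gaps n o <= d%:R * (K * t).
  apply: all_gaps_le => [//|k i]; rewrite -(grid_step n k).
  exact: HK1 (grid_ge0 n k) (grid_le n k t0) (grid_le_t k).
have G0 n o : 0 <= all_gaps n o.
  by apply: sumr_ge0 => k _; apply: sumr_ge0 => i _; exact: normr_ge0.
have mabs n (k : 'I_n) i : measurable_fun setT (fun o => `|step_gap n k i o|).
  exact: (measurableT_comp (@normr_measurable R setT) (measurable_step_gap k i)).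
have iabs n (k : 'I_n) i : P.-integrable setT (EFin \o (fun o => `|step_gap n k i o|)).
  apply: (@probability_integrable _ _ R P _ (K * (t / n%:R)) (mabs n k i)) => o.
  rewrite normr_id -(grid_step n k).
  exact: HK1 (grid_ge0 n k) (grid_le n k t0) (grid_le_t k).
have isum n (k : 'I_n) := Rintegral_sum (index_enum 'I_d) (iabs n k).
have iall n := Rintegral_sum (index_enum 'I_n) (fun k => (isum n k).1).
have mG n : measurable_fun setT (all_gaps n).
  by apply/measurable_EFinP; exact: (measurable_int _ (iall n).1).
have Gv : {ae P, forall o, vanishing (fun n => all_gaps n o)}.
  apply: filterS HK2 => o Ho eta eta0.
  (* Chosen so that [d eta1 K t <= eta]; the added 1 keeps the denominator positive. *)
  pose eta1 := eta / (d%:R * (K * t) + 1).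
  have c1 : 0 < d%:R * (K * t) + 1 by apply: ltr_wpDl => //; exact: ltr01.
  have eta10 : 0 < eta1 by exact: divr_gt0.
  have [del del0 Hdel] := Ho eta1 eta10.
  exists (Num.bound (t / del)) => n Nn.
  have tdel : 0 <= t / del by apply: divr_ge0; exact: ltW.
  have ndel : t / n%:R < del.
    have h1 : t / del < n%:R by apply: lt_le_trans (archi_boundP tdel) _; rewrite ler_nat.
    have n0 : 0 < n%:R :> R by exact: le_lt_trans h1.
    by rewrite ltr_pdivrMr// mulrC -ltr_pdivrMr.
  apply: (@le_trans _ _ (d%:R * (eta1 * K * t))).
    apply: all_gaps_le; first by apply: mulr_ge0; [exact: ltW|exact: K0].
    move=> k i; rewrite -(grid_step n k) -mulrA.
    apply: Hdel; [exact: grid_ge0|exact: grid_le|exact: grid_le_t|].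
    by rewrite grid_step.
  rewrite (_ : d%:R * (eta1 * K * t) = eta1 * (d%:R * (K * t))); last by ring.
  rewrite /eta1 mulrAC ler_pdivrMr; last exact: c1.
  by apply: ler_wpM2l; [exact: ltW|rewrite lerDl ler01].
have V := bounded_convergence_vanishing mG G0 GC Gv.
move=> eta eta0; have [N HN] := V eta eta0.
exists N => n Nn; apply: le_trans (HN n Nn).
rewrite /all_gaps (iall n).2; apply: ler_sum => k _.
rewrite (isum n k).2; apply: ler_sum => i _.
apply: le_Rintegral.
- exact: measurableT.
- have mm : measurable_fun setT (fun o => Num.max 0 (sg * step_gap n k i o)).
    apply: measurable_maxr; first exact: measurable_cst.
    by apply: measurable_funM; [exact: measurable_cst|exact: measurable_step_gap].
  apply: (@probability_integrable _ _ R P _ (K * (t / n%:R)) mm) => o.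
  rewrite ger0_norm; last by rewrite le_max lexx.
  have h := HK1 _ _ i o (grid_ge0 n k) (grid_le n k t0) (grid_le_t k).
  rewrite grid_step in h; apply: le_trans h.
  rewrite ge_max normr_ge0 (le_trans (ler_norm _))// normrM sg1 mul1r; exact: lexx.
- exact: iabs.
- move=> o _; rewrite ge_max normr_ge0 /= (le_trans (ler_norm _))// normrM sg1 mul1r; exact: lexx.
Qed.

End bang_bang_vanishing.

(** * Comparison of the densities *)

Section density_comparison.
Context {R : realType} {d : nat}.
Local Notation rV := 'rV[R]_d.+1.
Notation lam := (lebesgue_rV R d.+1).

Lemma continuous_measurable_rV (f : rV -> R) : continuous f -> measurable_fun setT f.
Proof.
move=> cf; apply: (measurability _ (measurable_realfun.RGenOInfty.measurableE R)).
move=> _ [_ [a ->] <-]; rewrite setTI; apply: sub_sigma_algebra.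
by apply: open_comp; [move=> v _; exact: cf|exact: interval_open].
Qed.

Definition box (y : rV) (r : R) : set rV := [set v | forall i, `[y 0 i - r, y 0 i + r]%classic (v 0 i)].

Lemma boxP y r v : box y r v <-> forall i, `|v 0 i - y 0 i| <= r.
Proof.
by split => + i => /(_ i); rewrite /= in_itv /= ler_distl.
Qed.

Lemma measurable_box y r : measurable (box y r).
Proof.
have -> : box y r = \bigcap_(j in [set: 'I_d.+1])
    ((fun v : rV => v 0 j) @^-1` `[y 0 j - r, y 0 j + r]%classic).
  by apply/seteqP; split => v Cv j => [_|]; [exact: (Cv j)|exact: (Cv j I)].
apply: fin_bigcap_measurable => [|j _]; first exact: finite_finset.
by rewrite -[X in measurable X]setTI; apply: measurable_coord.
Qed.

Lemma lebesgue_box y r : 0 <= r -> lam (box y r) = ((2 * r) ^+ d.+1)%:E.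
Proof.
move=> r0; rewrite (@lebesgue_rV_box R d.+1 (fun i => `[y 0 i - r, y 0 i + r]%classic))//.
rewrite (eq_bigr (fun=> (2 * r)%:E)).
  by rewrite prodEFin prodr_const card_ord.
move=> i _; rewrite lebesgue_measure_itv /= lte_fin.
have [_|h] := ltP (y 0 i - r) (y 0 i + r).
  by rewrite -EFinB; congr EFin; ring.
have -> : r = 0 by lra.
by rewrite mulr0.
Qed.

Definition bump (b s : R) (y v : rV) : R := \prod_i profile b s (v 0 i - y 0 i).

Lemma measurable_bump b s y : 0 < s -> measurable_fun setT (bump b s y).
Proof.
move=> s0; apply: measurable_bigprod => i _.
apply: (measurableT_comp (measurable_profile b s0)).
by apply: measurable_funB => //; exact: measurable_coord.
Qed.

Lemma bump_ge0 b s y v : 0 < s -> 0 <= bump b s y v.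
Proof. by move=> s0; apply: prodr_ge0 => i _; exact: profile_ge0. Qed.

Lemma bump_ge b s y v r : 0 < s -> 0 <= r -> box y r v ->
  profile b s r ^+ d.+1 <= bump b s y v.
Proof.
move=> s0 r0 /boxP yv; rewrite -[d.+1 in leLHS]card_ord -prodr_const.
apply: ler_prod => i _; rewrite profile_ge0//=.
by apply: profile_le => //; rewrite (ger0_norm r0).
Qed.

(** At least one coordinate is farther than [r], and each of the other [d] factors is at most the
    maximum of the profile. *)
Lemma bump_le b s y v r : 0 < s -> 0 <= r -> ~ box y r v ->
  bump b s y v <= profile b s 0 ^+ d * profile b s r.
Proof.
move=> s0 r0 nbox.
have [i ri] : exists i, r < `|v 0 i - y 0 i|.
  apply: contrapT => H; apply: nbox; apply/boxP => i; rewrite leNgt; apply/negP => ?.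
  by apply: H; exists i.
have far : profile b s (v 0 i - y 0 i) <= profile b s r.
  by apply: profile_le => //; rewrite (ger0_norm r0) ltW.
have others : \prod_(j < d.+1 | j != i) profile b s (v 0 j - y 0 j) <= profile b s 0 ^+ d.
  apply: (@le_trans _ _ (\prod_(j < d.+1 | j != i) profile b s 0)).
    apply: ler_prod => j _; rewrite profile_ge0//=.
    by apply: profile_le => //; rewrite normr0.
  by rewrite prodr_const cardC1 card_ord.
rewrite /bump (bigD1 i)//= mulrC; apply: ler_pM => //; last exact: profile_ge0.
by apply: prodr_ge0 => j _; exact: profile_ge0.
Qed.

(** If [f1 y > f2 y], continuity gives [f1 >= f2 + del] on a box [N] around [y]. The contribution
    [I] of [f2] on [N] occurs on both sides and cancels; what is left compares [del] times the mass
    of the bump near [y] with its supremum outside [N], against [profile_concentration]. *)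
Lemma density_le dO1 (O1 : measurableType dO1) dO2 (O2 : measurableType dO2)
    (P1 : probability O1 R) (P2 : probability O2 R) (Z1 : O1 -> rV) (Z2 : O2 -> rV)
    (f1 f2 : rV -> R) (b : R) (y : rV) :
  measurable_fun setT Z1 -> measurable_fun setT Z2 ->
  is_continuous_density P1 Z1 f1 -> is_continuous_density P2 Z2 f2 ->
  (forall s, 0 < s -> \int[P1]_o bump b s y (Z1 o) <= \int[P2]_o bump b s y (Z2 o)) ->
  f1 y <= f2 y.
Proof.
move=> mZ1 mZ2 [cf1 f10 f1E] [cf2 f20 f2E] H; rewrite leNgt; apply/negP => lt21.
pose del := (f1 y - f2 y) / 2.
have del0 : 0 < del by rewrite divr_gt0// subr_gt0.
have [rho rho0 Hrho] : exists2 rho : R, 0 < rho & forall v, box y rho v -> f2 v + del <= f1 v.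
  have c : {for y, continuous (fun v => f1 v - f2 v)} by apply: continuousB; [exact: cf1|exact: cf2].
  have /cvgr_dist_lt /(_ _ del0) : (f1 v - f2 v) @[v --> y] --> f1 y - f2 y by exact: c.
  rewrite near_nbhs => /nbhs_ballP[r /= r0 Hr].
  exists (r / 2); first by rewrite divr_gt0.
  move=> v /boxP vy.
  have /Hr /= : ball y r v.
    split => // i j; rewrite ord1 /ball /= distrC (le_lt_trans (vy j))//.
    by rewrite ltr_pdivrMr// ltr_pMr ?ltr1n.
  by rewrite ltr_norml /del => /andP[_]; lra.
have [s [s0 srho low Hs]] := profile_concentration b d rho0 del0.
have s20 : 0 < s ^+ 2 by rewrite exprn_gt0.
pose v := bump b (s ^+ 2) y.
have mv : measurable_fun setT (EFin \o v) by apply/measurable_EFinP; exact: measurable_bump.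
have v0 z : 0 <= v z by exact: bump_ge0.
have mf1 := continuous_measurable_rV cf1; have mf2 := continuous_measurable_rV cf2.
have mf1E : measurable_fun setT (EFin \o f1) by exact/measurable_EFinP.
have mf2E : measurable_fun setT (EFin \o f2) by exact/measurable_EFinP.
have law dO (O : measurableType dO) (P : probability O R) (Z : O -> rV) (f : rV -> R) :
    measurable_fun setT Z -> measurable_fun setT f -> (forall z, 0 <= f z) ->
    (forall A, measurable A -> P (Z @^-1` A) = (\int[lam]_(z in A) (f z)%:E)%E) ->
    (\int[P]_o (v (Z o))%:E = \int[lam]_z ((v z)%:E * (f z)%:E))%E.
  move=> mZ mf f0 fE.
  pose Z' : {mfun O >-> rV} := HB.pack Z (isMeasurableFun.Build _ _ _ _ Z mZ).
  transitivity (\int[distribution P Z']_z (v z)%:E)%E.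
    by rewrite ge0_integral_distribution// => z; rewrite lee_fin.
  apply: (@ge0_integral_density _ rV R lam (distribution P Z') f f0 mf) => //.
pose N := box y rho; have mN : measurable N := measurable_box y rho.
have E1 := law _ _ P1 Z1 f1 mZ1 mf1 f10 f1E.
have E2 := law _ _ P2 Z2 f2 mZ2 mf2 f20 f2E.
pose kap := profile b (s ^+ 2) 0 ^+ d * profile b (s ^+ 2) rho.
pose ell := profile b (s ^+ 2) s ^+ d.+1.
have ell0 : 0 <= ell by apply/exprn_ge0/ltW.
have mvf f : measurable_fun setT (EFin \o f) ->
    measurable_fun setT (fun z : rV => ((v z)%:E * (f z)%:E)%E).
  by move=> mf; exact: emeasurable_funM.
pose I := (\int[lam]_(z in N) ((v z)%:E * (f2 z)%:E))%E.
have vf0 f z : (forall z, 0 <= f z) -> (0 <= (v z)%:E * (f z)%:E)%E.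
  by move=> f0; rewrite mule_ge0 ?lee_fin.
have I0 : (0 <= I)%E by apply: integral_ge0 => z _; exact: vf0.
have vB z : v z <= profile b (s ^+ 2) 0 ^+ d.+1.
  rewrite -[d.+1 in leRHS]card_ord -prodr_const; apply: ler_prod => i _.
  by rewrite profile_ge0//=; apply: profile_le => //; rewrite normr0.
have f2T : (\int[lam]_z (f2 z)%:E = 1)%E.
  by rewrite -f2E// preimage_setT probability_setT.
have kap0 : 0 <= kap.
  by rewrite mulr_ge0 ?exprn_ge0 ?profile_ge0.
(* Outside [N] the bump is at most [kap], and [f2] has total mass 1. *)
have up2 : (\int[P2]_o (v (Z2 o))%:E <= I + kap%:E)%E.
  rewrite E2 -(setUv N) ge0_integral_setU//=; last 4 first.
  - exact: measurableC.
  - by rewrite setUv; exact: mvf.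
  - by move=> z _; exact: vf0.
  - exact/disj_setPCl.
  rewrite leeD2l//.
  apply: (@le_trans _ _ (\int[lam]_(z in ~` N) (kap%:E * (f2 z)%:E))%E).
    apply: ge0_le_integral.
    - exact: measurableC.
    - by move=> z _; exact: vf0.
    - by apply: measurable_funTS; exact: mvf.
    - by apply: measurable_funTS; exact: emeasurable_funM.
    - move=> z Nz; rewrite -!EFinM lee_fin ler_wpM2r//.
      exact: bump_le (ltW rho0) Nz.
  rewrite ge0_integralZl//; last 3 first.
  - exact: measurableC.
  - exact: measurable_funTS.
  - by move=> z _; rewrite lee_fin.
  rewrite -[leRHS]mule1 lee_wpmul2l ?lee_fin// -f2T.
  apply: ge0_subset_integral => //; first exact: measurableC.
  by move=> z _; rewrite lee_fin.
have Ifin : I \is a fin_num.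
  rewrite ge0_fin_numE//; apply: (@le_lt_trans _ _ (\int[P2]_o (v (Z2 o))%:E)%E).
    rewrite E2; apply: ge0_subset_integral => //; first exact: mvf.
    by move=> z _; exact: vf0.
  apply: (@le_lt_trans _ _ (\int[P2]_o (cst (profile b (s ^+ 2) 0 ^+ d.+1)%:E) o)%E).
    apply: ge0_le_integral => //.
    - by move=> o _; rewrite lee_fin.
    - exact: (measurableT_comp mv mZ2).
    - by move=> o _; rewrite /= lee_fin; exact: vB.
  by rewrite integral_cst//= probability_setT mule1 ltry.
(* The surplus [del] is integrated only over the smaller box of radius [s], where the bump is at
   least [ell]. *)
have low1 : (I + (del * (2 * s) ^+ d.+1 * ell)%:E <= \int[P1]_o (v (Z1 o))%:E)%E.
  rewrite E1; apply: (@le_trans _ _ (\int[lam]_(z in N) ((v z)%:E * (f1 z)%:E))%E); last first.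
    apply: ge0_subset_integral => //; first exact: mvf.
    by move=> z _; exact: vf0.
  apply: (@le_trans _ _ (\int[lam]_(z in N)
    ((v z)%:E * (f2 z)%:E + (del%:E * (v z)%:E)))%E); last first.
    apply: ge0_le_integral => //.
    - by move=> z _; rewrite adde_ge0 ?vf0// mule_ge0 ?lee_fin// ltW.
    - apply: measurable_funTS; apply: emeasurable_funD; first exact: mvf.
      exact: emeasurable_funM.
    - by apply: measurable_funTS; exact: mvf.
    - move=> z Nz; rewrite -!EFinM -EFinD lee_fin [del * _]mulrC -mulrDr ler_wpM2l//.
      exact: Hrho.
  rewrite ge0_integralD//; last 4 first.
  - by move=> z _; exact: vf0.
  - by apply: measurable_funTS; exact: mvf.
  - by move=> z _; rewrite mule_ge0 ?lee_fin// ltW.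
  - by apply: measurable_funTS; exact: emeasurable_funM.
  rewrite leeD2l// ge0_integralZl//; last 3 first.
  - exact: measurable_funTS.
  - by move=> z _; rewrite lee_fin.
  - by rewrite lee_fin ltW.
  rewrite -mulrA EFinM lee_wpmul2l ?lee_fin ?(ltW del0)//.
  have sub : box y s `<=` N.
    by move=> z /boxP yz; apply/boxP => i; exact: le_trans (yz i) srho.
  apply: (@le_trans _ _ (\int[lam]_(z in box y s) (v z)%:E)%E); last first.
    apply: ge0_subset_integral => //; first exact: measurable_box.
      exact: measurable_funTS.
    by move=> z _; rewrite lee_fin.
  apply: (@le_trans _ _ (\int[lam]_(z in box y s) (cst ell%:E) z)%E).
    have lb : (ell%:E * lam (box y s) = (ell * (2 * s) ^+ d.+1)%:E)%E.
      by rewrite lebesgue_box ?(ltW s0)// -EFinM.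
    rewrite integral_cst; last exact: measurable_box.
    by rewrite [leRHS]lb lee_fin mulrC.
  apply: ge0_le_integral.
  - exact: measurable_box.
  - by move=> z _; rewrite lee_fin.
  - exact: measurable_cst.
  - exact: measurable_funTS.
  - by move=> z bz; rewrite lee_fin; exact: bump_ge (ltW s0) bz.
have HE : (\int[P1]_o (v (Z1 o))%:E <= \int[P2]_o (v (Z2 o))%:E)%E.
  have fin2 dO (O : measurableType dO) (P : probability O R) (Z : O -> rV) :
      measurable_fun setT Z -> (\int[P]_o (v (Z o))%:E)%E \is a fin_num.
    move=> mZ; apply: (@integrable_fin_num _ _ _ P) => //.
    apply: (@probability_integrable _ _ R P (fun o => v (Z o)) (profile b (s ^+ 2) 0 ^+ d.+1)).
      by apply: measurableT_comp => //; exact: measurable_bump.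
    by move=> o; rewrite ger0_norm.
  rewrite -(fineK (fin2 _ _ P1 Z1 mZ1)) -(fineK (fin2 _ _ P2 Z2 mZ2)) lee_fin.
  exact: H.
have := le_trans low1 (le_trans HE up2).
rewrite leeD2lE// lee_fin; apply/negP; rewrite -ltNge.
by apply: (lt_le_trans Hs); rewrite exprMn mulrA; exact: lexx.
Qed.

End density_comparison.

(** * Weak solutions *)

Lemma bounded_integrable_itv (R : realType) (c : R -> R) (t M : R) :
  measurable_fun `[0, t]%classic c -> (forall s, 0 <= s -> `|c s| <= M) ->
  lebesgue_measure.-integrable `[0, t]%classic (EFin \o c).
Proof.
move=> mc cM; apply: measurable_bounded_integrable => //.
  by rewrite /= lebesgue_measure_itv /=; case: ifP => _; rewrite ?ltry// -EFinD ltry.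
exists M; split; first exact: num_real.
move=> y My s; rewrite /= in_itv /= => /andP[s0 _].
exact: le_trans (cM s s0) (ltW My).
Qed.

Section weak_solution_increments.
Context dO (O : measurableType dO) (R : realType) (d : nat).
Variables (P : probability O R) (F : R -> set_system O).
Variables (W X : O -> pathspace R d) (J : set R) (c : R -> pathspace R d -> 'rV[R]_d).
Variables (x : 'rV[R]_d) (t M : R).
Hypothesis sol : is_weak_solution J c x P F W X.
Hypotheses (t0 : 0 < t) (tJ : forall u, 0 <= u -> u <= t -> J u).
Hypothesis mc : forall o i, measurable_fun `[0, t]%classic (fun s => c s (X o) 0 i).
Hypothesis cM : forall o i s, 0 <= s -> `|c s (X o) 0 i| <= M.

(** The equation holds for all times on one event of probability 1, so it may be subtracted at any
    two times there. *)
Lemma weak_solution_increment : {ae P, forall o, at_time (X o) 0 = x /\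
  forall u v i, 0 <= u -> u <= v -> v <= t ->
    increment W X u v i o = \int[lebesgue_measure]_(r in `]u, v]) c r (X o) 0 i}.
Proof.
have [_ [_ W0 _] _ eqX] := sol.
apply: filterS2 W0 eqX => o Wo Xo; split.
  apply/rowP => i; rewrite (Xo 0 (tJ (lexx 0) (ltW t0))) Wo set_itv1 Rintegral_set1 mxE.
  by rewrite !addr0.
move=> u v i u0 uv vt; have v0 := le_trans u0 uv; have ut := le_trans uv vt.
rewrite /increment (Xo u (tJ u0 ut)) (Xo v (tJ v0 vt)).
have iv : lebesgue_measure.-integrable `[0, v]%classic (EFin \o (fun s => c s (X o) 0 i)).
  apply: (bounded_integrable_itv (M := M)); last exact: cM.
  by apply: measurable_funS (mc o i) => // r; rewrite /= !in_itv /= => /andP[-> /le_trans]; apply.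
rewrite -(@Rintegral_itvB R _ (BLeft 0) (BRight v) u iv)//; ring.
Qed.

Lemma weak_solution_lipschitz : {ae P, forall o, at_time (X o) 0 = x /\
  forall u v i, 0 <= u -> u <= v -> v <= t -> `|increment W X u v i o| <= M * (v - u)}.
Proof.
apply: filterS weak_solution_increment => o [X0 inc]; split => // u v i u0 uv vt.
rewrite inc//.
have sub : `]u, v] `<=` `[0, t].
  move=> r; rewrite /= !in_itv /= => /andP[ur rv].
  by rewrite (le_trans u0 (ltW ur)) (le_trans rv vt).
have iv : lebesgue_measure.-integrable `]u, v]%classic (EFin \o (fun s => c s (X o) 0 i)).
  exact: integrableS (bounded_integrable_itv (mc o i) (cM o i)).
have iM : lebesgue_measure.-integrable `]u, v]%classic (EFin \o (fun=> M)).
  have := @bounded_integrable_itv R (fun=> M) t `|M| (measurable_cst _) (fun _ _ => lexx _).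
  exact: integrableS.
apply: (le_trans (le_normr_Rintegral _ iv)) => //.
apply: (@le_trans _ _ (\int[lebesgue_measure]_(r in `]u, v]) M)).
  apply: le_Rintegral => //; first exact: (integrable_abse iv).
  by move=> r; rewrite /= in_itv /= => /andP[ur _]; apply: cM; rewrite (le_trans u0)// ltW.
rewrite Rintegral_cst//= lebesgue_measure_itv /= lte_fin.
case: ltP => [_|vu] /=; first by [].
by rewrite (@le_anti _ _ u v) ?uv// subrr.
Qed.

End weak_solution_increments.

Lemma measurable_sgn (R : realType) : measurable_fun setT (@sgn R).
Proof.
rewrite /sgn; apply: measurable_fun_if => //.
exact: measurable_fun_ler.
Qed.

Lemma measurable_bang_bang (R : realType) (d : nat) (alpha beta : 'rV[R]_d) (t : R)
    (w : pathspace R d) i :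
  measurable_fun `[0, t]%classic (fun s => bang_bang alpha beta s w 0 i).
Proof.
apply: measurable_funTS; under eq_fun do rewrite mxE.
apply: measurable_funM => //.
apply: (measurableT_comp (@measurable_sgn R)); apply: measurable_funB => //.
exact: (continuous_measurable_fun (@continuous_at_time R d w i)).
Qed.

Lemma bang_bang_bound (R : realType) (d : nat) (alpha beta : 'rV[R]_d) s
    (w : pathspace R d) i : `|bang_bang alpha beta s w 0 i| <= `|beta 0 i|.
Proof.
by rewrite mxE normrM /sgn; case: ifP => _; rewrite ?normrN normr1 mulr1.
Qed.

Lemma coord_le_euclidean_norm (R : realType) (d : nat) (v : 'rV[R]_d) i :
  `|v 0 i| <= euclidean_norm v.
Proof.
rewrite /euclidean_norm -sqrtr_sqr ler_wsqrtr// (bigD1 i)//= lerDl.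
by apply: sumr_ge0 => j _; exact: sqr_ge0.
Qed.

(** [drift_bounded] makes the supremum genuine; on an unbounded set [sup] would be a default
    value. *)
Lemma drift_norm_bound (R : realType) (d : nat) (b : R -> pathspace R d -> 'rV[R]_d) s w i :
  drift_bounded b -> 0 <= s -> `|b s w 0 i| <= drift_norm b.
Proof.
move=> [M bM] s0; apply: (le_trans (coord_le_euclidean_norm _ _)).
rewrite /drift_norm; apply: ub_le_sup; last by exists (s, w).
by exists M => _ [[u w'] /= [u0 _] <-]; exact: bM.
Qed.

Lemma measurable_drift_path (R : realType) (d : nat) (b : R -> pathspace R d -> 'rV[R]_d)
    (t : R) (w : pathspace R d) i :
  measurable_fun ([set t : R | 0 <= t] `*` [set: pathspace R d]) (fun tw => b tw.1 tw.2) ->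
  measurable_fun `[0, t]%classic (fun s => b s w 0 i).
Proof.
move=> mb.
apply: (@measurableT_comp _ _ _ _ _ _ (fun v : 'rV[R]_d => v 0 i)); first exact: measurable_coord.
apply: (measurable_comp _ _ mb (g := fun s => (s, w))) => //.
- by rewrite -set_itvcy; apply: measurableX.
- by move=> _ [s /= + <-]; rewrite in_itv /= => /andP[s0 _].
- by apply: measurable_funTS; exact: pair2_measurable.
Qed.

Theorem theorem3p13 (R : realType) (d : nat) (d_gt0 : (0 < d)%N)
  (T : R) (T_gt0 : 0 < T)
  (b : R -> pathspace R d -> 'rV[R]_d)
  (b_bounded : drift_bounded b)
  (b_measurable : measurable_fun ([set t : R | 0 <= t] `*` [set: pathspace R d])
     (fun tw => b tw.1 tw.2))
  (b_nonanticipative : forall t, 0 < t ->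
     forall B, measurable B -> past t (b t @^-1` B))
  (p : R -> 'rV[R]_d -> 'rV[R]_d -> R)
  (p_density : forall x, is_solution_density `[0, T] b x (fun t => p t x))
  (q : 'rV[R]_d -> 'rV[R]_d -> R -> 'rV[R]_d -> 'rV[R]_d -> R)
  (q_density : forall alpha beta x,
     is_solution_density `[0, +oo[ (bang_bang alpha beta) x
       (fun t => q alpha beta t x)) :
  forall (t : R) (x y : 'rV[R]_d), 0 < t -> t <= T ->
    q y (const_mx (- drift_norm b)) t x y <= p t x y /\
    p t x y <= q y (const_mx (drift_norm b)) t x y.
Proof.
move=> t x y t0 tT; set M := drift_norm b.
destruct d as [|d']; first by [].
(* [M] dominates a coordinate of the drift, taken at time 0 along an arbitrary path; such a
   coordinate exists because the dimension is positive. *)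
have M0 : 0 <= M.
  apply: (le_trans (normr_ge0 _)).
  exact: (drift_norm_bound (s := 0) (point : pathspace R d'.+1) ord0 b_bounded (lexx 0)).
have [dO [ O [P [F [W [X [sol dens]]]]]]] := p_density x.
have tJ u : 0 <= u -> u <= t -> (`[0, T]%classic : set R) u.
  by move=> u0 ut; rewrite /= in_itv /= u0 (le_trans ut tT).
have tJ' u : 0 <= u -> u <= t -> (`[0, +oo[%classic : set R) u.
  by move=> u0 _; rewrite /= in_itv /= u0.
have Xinc := weak_solution_lipschitz sol t0 tJ
  (fun o i => measurable_drift_path (X o) i b_measurable)
  (fun o i s s0 => drift_norm_bound (X o) i b_bounded s0).
rewrite -/M in Xinc.
have [HF HW HX _] := sol.
have mXt dO' (O' : measurableType dO') (F' : R -> set_system O') (X' : O' -> pathspace R d'.+1) J :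
    is_filtration F' -> is_adapted F' J X' -> J t -> measurable_fun setT (fun o => at_time (X' o) t).
  move=> [_ Fm _] HX' Jt _ B mB; rewrite setTI.
  by apply: (Fm t (ltW t0)); exact: HX'.
have mX := mXt _ _ _ _ _ HF HX (tJ t (ltW t0) (lexx t)).
have densX := dens t (tJ t (ltW t0) (lexx t)) t0.
(* Along the bang-bang diffusion the gaps of both signs vanish in the limit, so the two inequalities
   combine to an equality. The right-hand side is a number that does not refer to the probability
   space, which links [Y] with a solution [X] living elsewhere. *)
have bb (beta : R) : `|beta| = M -> exists (dO' : measure_display) (O' : measurableType dO')
    (P' : probability O' R) (Y : O' -> pathspace R d'.+1),
    [/\ measurable_fun setT (fun o => at_time (Y o) t),
     is_continuous_density P' (fun o => at_time (Y o) t) (q y (const_mx beta) t x) &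
     forall eps, 0 < eps ->
     \int[P']_o bump beta eps y (at_time (Y o) t) =
     \prod_i profile beta (eps + t) (x 0 i - y 0 i)].
  move=> betaM.
  have [dO' [ O' [P' [F' [W' [Y [sol' dens']]]]]]] := q_density y (const_mx beta) x.
  have [HF' HW' HY _] := sol'.
  exists dO', O', P', Y; split.
  - exact: mXt HF' HY (tJ' t (ltW t0) (lexx t)).
  - exact: dens' (tJ' t (ltW t0) (lexx t)) t0.
  move=> eps eps0.
  have mc o i := measurable_bang_bang y (const_mx beta) (t := t) (Y o) i.
  have cM o i s (s0 : 0 <= s) : `|bang_bang y (const_mx beta) s (Y o) 0 i| <= M.
    by apply: (le_trans (bang_bang_bound _ _ _ _ _)); rewrite mxE betaM.
  have Yinc := weak_solution_lipschitz sol' t0 tJ' mc cM.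
  have bM : `|beta| <= M by rewrite betaM.
  have Ybb : {ae P', forall o u v i, 0 <= u -> u <= v -> v <= t ->
      increment W' Y u v i o =
      \int[lebesgue_measure]_(r in `]u, v]) (beta * sgn (y 0 i - at_time (Y o) r 0 i))}.
    apply: filterS (weak_solution_increment sol' t0 tJ' mc cM) => o [_ inc] u v i u0 uv vt.
    rewrite inc//; apply: eq_Rintegral => r _.
    by rewrite !mxE.
  have V sg : `|sg| = 1 -> vanishing (total_gap P' W' Y M t y beta eps sg).
    by move=> sg1; exact: (bang_bang_total_gap HF' HW' HY M0 t0 tJ' Yinc bM eps0 Ybb sg1).
  apply/le_anti/andP; split.
    exact: (terminal_le_initial HF' HW' HY M0 t0 tJ' Yinc bM eps0 (V 1 (normr1 _))).
  apply: (initial_le_terminal HF' HW' HY M0 t0 tJ' Yinc bM eps0 (V (-1) _)).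
  by rewrite normrN normr1.
split.
- have nM : `|- M| = M by rewrite normrN ger0_norm.
  have [dO' [ O' [P' [Y [mY densY EY]]]]] := bb (- M) nM.
  apply: (density_le (b := - M) mY mX densY densX) => eps eps0.
  rewrite EY//.
  have bM : `|- M| <= M by rewrite nM.
  exact: (initial_le_terminal_bounded HF HW HX y M0 t0 tJ Xinc bM eps0 erefl).
- have nM : `|M| = M by rewrite ger0_norm.
  have [dO' [ O' [P' [Y [mY densY EY]]]]] := bb M nM.
  apply: (density_le (b := M) mX mY densX densY) => eps eps0.
  rewrite EY//.
  have bM : `|M| <= M by rewrite nM.
  exact: (terminal_le_initial_bounded HF HW HX y M0 t0 tJ Xinc bM eps0 erefl).
Qed.
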